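(* There exist universal numerical constants $c_N,c_m,c_\Delta,c_t>0$ such that the following holds. Let $n\ge8$, $p\in\{1,2\}$, let $x^*$ be an arbitrary minimizer of $f(x)=\mathbb{E}_\xi[F(x,\xi)]$ on $\mathbb{R}^n$ and let $\Theta_p$ satisfy $V[x_0](x^* )\le\Theta_p$. Let $\varepsilon>0$ and define $$A=\tfrac{\ln n\,L_2\Theta_1}{\varepsilon}\ \text{ if } p=1,\qquad A=\tfrac{nL_2\Theta_2}{\varepsilon}\ \text{ if } p=2,$$ and, for both values of $p$, $$M=\max\Big\{1,\tfrac{\sigma^2}{L_2\varepsilon}\Big\},\quad D=\min\Big\{\tfrac{\varepsilon}{n},\tfrac{\varepsilon^2}{nL_2\Theta_p}\Big\},\quad T=\min\Big\{\sqrt{\tfrac{\varepsilon}{nL_2}},\tfrac{\varepsilon}{\sqrt{nL_2^2\Theta_p}}\Big\}.$$ Assume that the noise level satisfies $0<\Delta\le L_2\Theta_pn\rho_n^2/2$ and $\Delta=c_\Delta D$, and that RDFDS (defined in the context) is run from $x_0$ with smoothing parameter $t=c_tT$ and positive integers $N,m$ such that $c_NA\le N\le2c_NA$ and $c_mM\le m\le2c_mM$. Then its output satisfies $\mathbb{E}[f(\bar x_N)]-f(x^* )\le\varepsilon$. Moreover, the overall number of oracle calls is $Nm$, which is at most a universal constant times $$\max\Big\{\tfrac{L_2\Theta_1\ln n}{\varepsilon},\tfrac{\sigma^2\Theta_1\ln n}{\varepsilon^2}\Big\}\ \text{ for } p=1,\qquad \max\Big\{\tfrac{nL_2\Theta_2}{\varepsilon},\tfrac{n\sigma^2\Theta_2}{\varepsilon^2}\Big\}\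 \text{ for } p=2.$$
   Context: Problem. $\xi$ is a random vector with distribution $P$ on $\mathcal{X}$; $f(x)=\mathbb{E}_\xi[F(x,\xi)]$ is a closed convex function on $\mathbb{R}^n$ having a minimizer ($F(\cdot,\xi)$ itself need not be convex). Almost surely in $\xi$, $F(\cdot,\xi)$ has a gradient $g(x,\xi)$ with $\|g(x,\xi)-g(y,\xi)\|_2\le L(\xi)\|x-y\|_2$ for all $x,y$. The constant $L_2>0$ satisfies $\sqrt{\mathbb{E}_\xi L(\xi)^2}\le L_2$; consequently $\mathbb{E}_\xi g(x,\xi)=\nabla f(x)$ and $\nabla f$ is $L_2$-Lipschitz in $\|\cdot\|_2$. For all $x$, $\mathbb{E}_\xi\|g(x,\xi)-\nabla f(x)\|_2^2\le\sigma^2$. Oracle. Given a pair of points $(x,y)$, an oracle call returns $(\widetilde f(x,\xi),\widetilde f(y,\xi))$ for one sample $\xi\sim P$ (the same for both points), where $\widetilde f(x,\xi)=F(x,\xi)+\eta(x,\xi)$ and $|\eta(x,\xi)|\le\Delta$ for all $x\in\mathbb{R}^n$, a.s. in $\xi$. All functions are measurable, so that expectations make sense. Proximal setup. $q$ is given by $\frac1p+\frac1q=1$ ($q=\infty$ for $p=1$, $q=2$ for $p=2$). The prox-function is $d(x)=\frac12\|x\|_2^2$ for $p=2$, and $d(x)=\frac12\,\exp(1)\,n^{(\kappa-1)(2-\kappa)/\kappa}\ln n\,\|x\|_\kappa^2$ with $\kappa=1+\frac1{\ln n}$ for $p=1$; it is $1$-strongly convex w.r.t. $\|\cdot\|_p$.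 $V[z](x)=d(x)-d(z)-\langle\nabla d(z),x-z\rangle$ is the Bregman divergence. $\rho_n=\min\{q-1,\,16\ln n-8\}\,n^{2/q-1}$, i.e. $\rho_n=(16\ln n-8)/n$ for $p=1$ and $\rho_n=1$ for $p=2$ (when $n\ge 8$). Gradient approximation. For $e$ in the unit Euclidean sphere and samples $\xi_1,\dots,\xi_m$, $\widetilde\nabla^m f^t(x)=\frac1m\sum_{i=1}^m\frac{\widetilde f(x+te,\xi_i)-\widetilde f(x,\xi_i)}{t}\,e$. RDFDS. Input $x_0\in\mathbb{R}^n$, $N,m\ge1$, $t>0$, stepsize $\alpha=\frac{1}{48n\rho_nL_2}$. For $k=0,\dots,N-1$: draw $e_{k+1}$ uniformly from the unit Euclidean sphere of $\mathbb{R}^n$ and $m$ independent copies $\xi_1^{k+1},\dots,\xi_m^{k+1}$ of $\xi$, all independent of each other and of previous iterations; compute $\widetilde\nabla^m f^t(x_k)$ with $e=e_{k+1}$ and $\xi_i=\xi_i^{k+1}$; set $x_{k+1}=\arg\min_{x\in\mathbb{R}^n}\{\alpha n\langle\widetilde\nabla^m f^t(x_k),x-x_k\rangle+V[x_k](x)\}$. Output $\bar x_N=\frac1N\sum_{k=0}^{N-1}x_k$. $\mathbb{E}$ is the expectation over all randomness of the algorithm. ''Universal'' constants do not depend on any problem data or on $\varepsilon$, $n$, $p$. *)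

(* Defs.v *)
From HB Require Import structures.
From mathcomp Require Import all_boot all_order all_algebra.
From mathcomp Require Import all_classical all_reals all_analysis.

Set Implicit Arguments.
Unset Strict Implicit.
Unset Printing Implicit Defensive.

Import Order.TTheory GRing.Theory Num.Theory.
Import numFieldNormedType.Exports.

Local Open Scope classical_set_scope.
Local Open Scope ring_scope.

(* Matrices (in particular row vectors, which represent R^n) carry the Borel
   sigma-algebra of their canonical topology. *)
HB.instance Definition _ (R : realType) (m n : nat) :=
  @isMeasurable.Build (sigma_display (@open 'M[R]_(m, n))) 'M[R]_(m, n)
    <<s @open 'M[R]_(m, n) >>
    (@sigma_algebra0 _ setT (@open 'M[R]_(m, n)))
    (@sigma_algebraC _ (@open 'M[R]_(m, n)))
    (@sigma_algebra_bigcup _ setT (@open 'M[R]_(m, n))).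

Section euclidean_space.
Context {R : realType} {n : nat}.
Implicit Types (x y v : 'rV[R]_n) (f : 'rV[R]_n -> R).

Definition dot x y : R := \sum_(i < n) x 0 i * y 0 i.

Definition norm2 x : R := Num.sqrt (dot x x).

Definition lnorm (s : R) x : R := (\sum_(i < n) `|x 0 i| `^ s) `^ s^-1.

Definition gradient f x : 'rV[R]_n := \row_(i < n) 'D_(delta_mx 0 i) f x.

Definition has_gradient f x v : Prop := differentiable f x /\ gradient f x = v.

Definition is_minimizer f x : Prop := forall y, f x <= f y.

Definition closed_convex f : Prop :=
  convex_function setT f /\ closed [set z : 'rV[R]_n * R | f z.1 <= z.2].

Definition bregman (d : 'rV[R]_n -> R) (z x : 'rV[R]_n) : R :=
  d x - d z - dot (gradient d z) (x - z).

(* The uniform law on the unit Euclidean sphere is the unique Borel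
   probability carried by the sphere and invariant under rotations. *)
Definition uniform_on_sphere (mu : set 'rV[R]_n -> \bar R) : Prop :=
  mu [set v | norm2 v = 1] = 1%E /\
  forall Q : 'M[R]_n, Q *m Q^T = 1%:M ->
    forall A, measurable A -> mu ((fun v => v *m Q) @^-1` A) = mu A.

End euclidean_space.

Section proximal_setup.
Context {R : realType}.

(* In \bar R the inverse of 0 is +oo, so that q = +oo for p = 1. *)
Definition conjugate_exponent (p : nat) : \bar R :=
  ((1 - (p%:R)%:E^-1)^-1)%E.

(* In \bar R the inverse of +oo is 0, so that n^(2/q - 1) = 1/n for p = 1. *)
Definition rho (p n : nat) : R :=
  let q := conjugate_exponent p in
  fine (Order.min (q - 1) (16 * ln n%:R - 8)%:E)%E *
  n%:R `^ fine (2%:E / q - 1)%E.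

Definition prox (p n : nat) (x : 'rV[R]_n) : R :=
  if p == 1%N then
    let kappa := 1 + (ln n%:R)^-1 in
    2^-1 * expR 1 * n%:R `^ ((kappa - 1) * (2 - kappa) / kappa) * ln n%:R *
      lnorm kappa x ^+ 2
  else 2^-1 * norm2 x ^+ 2.

End proximal_setup.

Section independence.
Context {R : realType} {d : measure_display} {T : measurableType d}.
Variable Pr : probability T R.

Definition mutually_independent (I : finType) (G : I -> set (set T)) : Prop :=
  forall (J : {set I}) (A : I -> set T), (forall i, i \in J -> G i (A i)) ->
    Pr (\bigcap_(i in [set` J]) A i) = (\prod_(i in J) Pr (A i))%E.

End independence.

Section stochastic_problem.
Context {R : realType} {n : nat} {d : measure_display} {X : measurableType d}.
Variable P : probability X R.
Implicit Types (F eta : 'rV[R]_n -> X -> R) (g : 'rV[R]_n -> X -> 'rV[R]_n)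
  (L : X -> R).

Definition objective F (x : 'rV[R]_n) : R := fine 'E_P[F x].

Record problem_assumptions F g L (L2 sigma : R) : Prop := {
  measurable_F : measurable_fun setT (fun z : 'rV[R]_n * X => F z.1 z.2) ;
  measurable_g : measurable_fun setT (fun z : 'rV[R]_n * X => g z.1 z.2) ;
  measurable_L : measurable_fun setT L ;
  integrable_F : forall x, P.-integrable setT (EFin \o F x) ;
  objective_closed_convex : closed_convex (objective F) ;
  gradient_F : {ae P, forall xi,
    (forall x, has_gradient (F ^~ xi) x (g x xi)) /\
    (forall x y, norm2 (g x xi - g y xi) <= L xi * norm2 (x - y))} ;
  L2_gt0 : 0 < L2 ;
  L_bound : (sqrte 'E_P[fun xi => (L xi ^+ 2)%R] <= L2%:E)%E ;
  variance_bound : forall x,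
    ('E_P[fun xi => (norm2 (g x xi - gradient (objective F) x) ^+ 2)%R]
       <= (sigma ^+ 2)%:E)%E
}.

Definition noise_assumptions eta (Delta : R) : Prop :=
  measurable_fun setT (fun z : 'rV[R]_n * X => eta z.1 z.2) /\
  {ae P, forall xi, forall x, `|eta x xi| <= Delta}.

End stochastic_problem.

Section algorithm.
Context {R : realType} {n : nat} {X : Type}.

(* A query is a pair of points together with the sample used by the oracle. *)
Definition query : Type := ('rV[R]_n * 'rV[R]_n) * X.

Definition oracle (F eta : 'rV[R]_n -> X -> R) (c : query) : R * R :=
  (F c.1.1 c.2 + eta c.1.1 c.2, F c.1.2 c.2 + eta c.1.2 c.2).

Section run.
Variables (O : query -> R * R) (N m : nat) (t alpha : R).
Variables (d : 'rV[R]_n -> R) (x0 : 'rV[R]_n).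
(* The direction e k and the samples xi k are those drawn at iteration k,
   that is, e_(k+1) and xi^(k+1). *)
Variables (e : 'I_N -> 'rV[R]_n) (xi : 'I_N -> 'I_m -> X).
Variable x : nat -> 'rV[R]_n.

Definition queries (k : 'I_N) : seq query :=
  [seq ((x k + t *: e k, x k), xi k i) | i <- enum 'I_m].

Definition gradient_approximation (k : 'I_N) : 'rV[R]_n :=
  m%:R^-1 *: \sum_(c <- queries k) (((O c).1 - (O c).2) / t) *: e k.

Definition rdfds_run : Prop :=
  x 0%N = x0 /\
  forall k : 'I_N, is_minimizer
    (fun y => alpha * n%:R * dot (gradient_approximation k) (y - x k)
              + bregman d (x k) y)
    (x k.+1).

Definition oracle_calls : seq query := flatten [seq queries k | k <- enum 'I_N].

Definition rdfds_output : 'rV[R]_n := N%:R^-1 *: \sum_(k < N) x k.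

End run.
End algorithm.

Section randomness.
Context {R : realType} {n : nat} {d d' : measure_display}.
Context {X : measurableType d} {Omega : measurableType d'}.
Variables (P : probability X R) (Pr : probability Omega R).

Record rdfds_randomness (N m : nat) (e : 'I_N -> {RV Pr >-> 'rV[R]_n})
    (xi : 'I_N -> 'I_m -> {RV Pr >-> X}) : Prop := {
  directions_uniform : forall k, uniform_on_sphere (distribution Pr (e k)) ;
  samples_law : forall k i A, measurable A -> distribution Pr (xi k i) A = P A ;
  draws_independent :
    mutually_independent Pr (fun j : 'I_N + 'I_N * 'I_m =>
      match j with
      | inl k => g_sigma_algebra_preimage (e k)
      | inr (k, i) => g_sigma_algebra_preimage (xi k i)
      end)
}.

End randomness.

(* Main.v *)
Require Import Defs.
From HB Require Import structures.
From mathcomp Require Import all_boot all_order all_algebra perm.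
From mathcomp Require Import all_classical all_reals all_analysis.
From mathcomp Require Import measurable_realfun ring lra.

Set Implicit Arguments.
Unset Strict Implicit.
Unset Printing Implicit Defensive.

Import Order.TTheory GRing.Theory Num.Theory.
Import numFieldNormedType.Exports.

Local Open Scope classical_set_scope.
Local Open Scope ring_scope.

(** Each iteration is a mirror descent step along theta e, where theta is an
    averaged finite difference and e is uniform on the sphere. Up to an error of
    mean square O(t^2 L2^2 + Delta^2 / t^2), theta is the inner product of e with
    the mean of the sampled gradients. Sign changes and transpositions of
    coordinates preserve the law of e, which gives E[theta <e, v>] = <grad f, v> / n
    up to this error. The strong convexity of the prox-function only enters through
    an inequality <e, v>^2 <= S(e) |v|_p^2; for p = 1 the squared sup-norm of e is
    dominated, by Young's inequality, by a power sum S(e) of degree 2r with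
    r ~ log2 n, whose expectation the moments of the sphere bound by rho. With
    |grad f|^2 <= 4 L2 (f - f_min) and the convexity of f this yields, for the
    Bregman divergence V_k from x_k to the minimizer,
      E V_(k+1) + (2 alpha / 3) E (f(x_k) - f_min) <= (1 + 1/N) E V_k + B.
    The factor (1 + 1/N)^N <= 4 absorbs the bias term theta-error * |x_k - x*|. *)

(** * Independence *)

(** The scalar theta depends on e, so the quadratic term of a mirror step, theta^2 S(e), is a
    product of dependent factors. The invariance of S under signed permutations separates them:
    E[<e, v>^2 S(e)] = |v|^2 / n * E[S(e)]. The squared sup-norm has this invariance too, but it is
    the mean of a power sum that algebra can reach, through a recursion on the moments of one
    coordinate. The stepsize is such that the part of the quadratic term coming from |grad f|^2 is
    at most (alpha / 3) (f(x_k) - f_min); the linear term provides alpha, and 2 alpha / 3 remains.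
    The bias is multiplied by the distance to the minimizer, which has no a priori bound; Young's
    inequality with weight 4 alpha N trades it for V_k / N plus a term proportional to N, and this
    is where the upper bound on N matters. The strong convexity of the prox-function is obtained up
    to a factor 4 and the Taylor bounds up to a factor 2; the numerical constants absorb both
    losses. *)

Section independence_theory.
Context {R : realType} {d : measure_display} {Omega : measurableType d}.
Variable Pr : probability Omega R.

Definition independent_events (A B : set Omega) :=
  (Pr (A `&` B) = Pr A * Pr B)%E.

Lemma independent_eventsC A B :
  independent_events A B -> independent_events B A.
Proof. by rewrite /independent_events setIC muleC. Qed.

(** Dynkin's argument: for a fixed [B], the measurable events independent of [B] are closed under
    proper differences and increasing unions, so it suffices to check a generating pi-system. *)
Lemma independent_events_sigma (G : set (set Omega)) (B : set Omega) :
  setI_closed G -> G `<=` measurable -> measurable B ->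
  (forall A, G A -> independent_events A B) ->
  forall A, <<s G >> A -> independent_events A B.
Proof.
move=> GI Gm mB GB.
pose H := [set A | measurable A /\ independent_events A B].
have HD : lambda_system setT H.
  split => //.
  - by split=> //; rewrite /independent_events setTI probability_setT mul1e.
  - move=> A1 A2 A21 [mA1 i1] [mA2 i2]; split; first exact: measurableD.
    have i12 : A2 `&` B `<=` A1 `&` B by apply: setSI.
    have muD C E : measurable C -> measurable E -> E `<=` C ->
        Pr (C `\` E) = (Pr C - Pr E)%E.
      move=> mC mE EC; rewrite measureD//; last first.
        by apply: le_lt_trans (probability_le1 _ mC) _; rewrite ltry.
      by rewrite (setIidr EC).
    rewrite /independent_events (_ : _ `&` B = (A1 `&` B) `\` (A2 `&` B)); last first.
      apply/seteqP; split=> [x [[A1x A2x] Bx]|x [[A1x Bx] AB]]; split=> //.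
      + by case.
      + by split => // A2x; apply: AB.
    rewrite !muD//; [|exact: measurableI|exact: measurableI].
    by rewrite i1 i2 muleBl ?fin_num_measure// fin_num_adde_defl // fin_numN fin_num_measure.
  - move=> F ndF HF; split; first by apply: bigcup_measurable => k _; exact: (HF k).1.
    rewrite /independent_events setI_bigcupl.
    have mF k := (HF k).1.
    have c1 : Pr (F k `&` B) @[k --> \oo] --> Pr (\bigcup_k (F k `&` B)).
      apply: nondecreasing_cvg_mu.
      - by move=> k; exact: measurableI.
      - by apply: bigcup_measurable => k _; exact: measurableI.
      - by move=> i j ij; apply/subsetPset; apply: setSI; apply/subsetPset/ndF.
    have c2 : Pr (F k) @[k --> \oo] --> Pr (\bigcup_k F k).
      by apply: nondecreasing_cvg_mu => //; exact: bigcup_measurable.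
    have c3 : (Pr (F k) * Pr B)%E @[k --> \oo] --> (Pr (\bigcup_k F k) * Pr B)%E.
      by apply: cvgeZr => //; rewrite fin_num_measure.
    rewrite -(cvg_lim _ c3)// -(cvg_lim _ c1)//.
    by congr (lim (_ @ \oo)); apply/funext => k; exact: (HF k).2.
have : <<s G >> `<=` H.
  apply: lambda_system_subset => //.
  by move=> A GA; split; [exact: Gm|exact: GB].
by move=> GH A /GH[].
Qed.

Lemma independent_sigma (G1 G2 : set (set Omega)) :
  setI_closed G1 -> setI_closed G2 ->
  G1 `<=` measurable -> G2 `<=` measurable ->
  (forall A B, G1 A -> G2 B -> independent_events A B) ->
  forall A B, <<s G1 >> A -> <<s G2 >> B -> independent_events A B.
Proof.
move=> I1 I2 m1 m2 ind.
have sm (G : set (set Omega)) A : G `<=` measurable -> <<s G >> A -> measurable A.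
  move=> Gm; apply: (smallest_sub _ Gm).
  exact: sigma_algebra_measurable.
move=> A B GA GB; apply: independent_eventsC.
apply: (independent_events_sigma I2 m2) GB; first exact: sm GA.
move=> B' GB'; apply: independent_eventsC.
apply: (independent_events_sigma I1 m1) GA; first exact: m2.
by move=> A' GA'; exact: ind.
Qed.

Definition independent_maps {d1 d2} {T1 : measurableType d1}
    {T2 : measurableType d2} (U1 : Omega -> T1) (U2 : Omega -> T2) :=
  forall A B, measurable A -> measurable B ->
    independent_events (U1 @^-1` A) (U2 @^-1` B).

Section independent_maps.
Context {d1 d2} {T1 : measurableType d1} {T2 : measurableType d2}.
Variables (U1 : Omega -> T1) (U2 : Omega -> T2).
Hypotheses (mU1 : measurable_fun setT U1) (mU2 : measurable_fun setT U2).
Hypothesis U12 : independent_maps U1 U2.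

Let X1 : {mfun Omega >-> T1} :=
  HB.pack U1 (isMeasurableFun.Build _ _ _ _ _ mU1).
Let X2 : {mfun Omega >-> T2} :=
  HB.pack U2 (isMeasurableFun.Build _ _ _ _ _ mU2).
Let X12 : {mfun Omega >-> (T1 * T2)%type} :=
  HB.pack (fun w => (U1 w, U2 w))
    (isMeasurableFun.Build _ _ _ _ _ (measurable_fun_pair mU1 mU2)).

Let joint_law A : measurable A ->
  (distribution Pr X1 \x distribution Pr X2)%E A = distribution Pr X12 A.
Proof.
by move=> mA; apply: product_measure_unique => // A1 A2 mA1 mA2; exact: U12.
Qed.

Lemma independent_tonelli (h : T1 * T2 -> \bar R) :
  measurable_fun setT h -> (forall z, 0 <= h z)%E ->
  (\int[Pr]_w h (U1 w, U2 w) = \int[Pr]_w1 \int[Pr]_w2 h (U1 w1, U2 w2))%E.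
Proof.
move=> mh h0.
transitivity (\int[distribution Pr X12]_z h z)%E.
  by rewrite ge0_integral_distribution.
rewrite (eq_measure_integral (distribution Pr X1 \x distribution Pr X2)%E); last first.
  by move=> A mA _; exact/esym/joint_law.
rewrite fubini_tonelli1// /fubini_F ge0_integral_distribution//; last 2 first.
- exact: measurable_fun_fubini_tonelli_F.
- by move=> x; exact: integral_ge0.
apply: eq_integral => w _ /=; rewrite ge0_integral_distribution//.
exact: measurableT_comp.
Qed.

Lemma measurable_tonelli_inner (h : T1 * T2 -> \bar R) :
  measurable_fun setT h -> (forall z, 0 <= h z)%E ->
  measurable_fun setT (fun w1 => \int[Pr]_w2 h (U1 w1, U2 w2))%E.
Proof.
move=> mh h0.
have -> : (fun w1 => \int[Pr]_w2 h (U1 w1, U2 w2))%E =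
    fubini_F (distribution Pr X2) h \o U1.
  apply/funext => w; rewrite /= /fubini_F ge0_integral_distribution//.
  exact: measurableT_comp.
by apply: measurableT_comp => //; exact: measurable_fun_fubini_tonelli_F.
Qed.

End independent_maps.

(** Tonelli on the absolute values gives a product of two finite integrals; this integrability is
    what allows Fubini for the signed product. *)
Lemma independent_expectationM (Y1 Y2 : Omega -> R) :
  independent_maps Y1 Y2 ->
  Pr.-integrable setT (EFin \o Y1) -> Pr.-integrable setT (EFin \o Y2) ->
  Pr.-integrable setT (EFin \o (Y1 \* Y2)) /\
  \int[Pr]_w (Y1 w * Y2 w) = \int[Pr]_w Y1 w * \int[Pr]_w Y2 w.
Proof.
move=> Y12 i1 i2.
have mY1 : measurable_fun setT Y1 by apply/measurable_EFinP; exact: measurable_int i1.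
have mY2 : measurable_fun setT Y2 by apply/measurable_EFinP; exact: measurable_int i2.
pose X1 : {mfun Omega >-> R} := HB.pack Y1 (isMeasurableFun.Build _ _ _ _ _ mY1).
pose X2 : {mfun Omega >-> R} := HB.pack Y2 (isMeasurableFun.Build _ _ _ _ _ mY2).
pose X12 : {mfun Omega >-> (R * R)%type} :=
  HB.pack (fun w => (Y1 w, Y2 w))
    (isMeasurableFun.Build _ _ _ _ _ (measurable_fun_pair mY1 mY2)).
have law A : measurable A ->
    (distribution Pr X1 \x distribution Pr X2)%E A = distribution Pr X12 A.
  move=> mA; apply: product_measure_unique => // A1 A2 mA1 mA2; exact: Y12.
pose f (z : R * R) := (z.1 * z.2)%:E.
have mf : measurable_fun setT f.
  by apply/measurable_EFinP; exact: measurable_funM.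
have iM : Pr.-integrable setT (EFin \o (Y1 \* Y2)).
  apply/integrableP; split.
    by apply/measurable_EFinP; exact: measurable_funM.
  have -> : (\int[Pr]_w `|(EFin \o (Y1 \* Y2)%R) w| = \int[Pr]_w1 \int[Pr]_w2 `|f (Y1 w1, Y2 w2)|)%E.
    rewrite -(independent_tonelli mY1 mY2 Y12 (h := fun z => `|f z|%E))//.
    exact: measurableT_comp.
  under eq_integral => w1 _.
    under eq_integral => w2 _ do rewrite /f /= normrM EFinM.
    rewrite ge0_integralZl//; last first.
      by apply/measurable_EFinP; exact: measurableT_comp.
    over.
  have [mi1 ii1] := integrableP _ _ _ i1.
  have [mi2 ii2] := integrableP _ _ _ i2.
  rewrite ge0_integralZr//; last 2 first.
    by apply/measurable_EFinP; exact: measurableT_comp.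
    exact: integral_ge0.
  rewrite lte_mul_pinfty ?integral_ge0//.
  by rewrite ge0_fin_numE ?integral_ge0.
split => //.
have if12 : (distribution Pr X1 \x distribution Pr X2)%E.-integrable setT f.
  apply/integrableP; split => //.
  rewrite (eq_measure_integral (distribution Pr X12)); last first.
    by move=> A mA _; exact: law.
  rewrite ge0_integral_distribution//; last exact: measurableT_comp.
  by have [] := integrableP _ _ _ iM.
apply/EFin_inj; rewrite EFinM /Rintegral !fineK; try exact: integrable_fin_num.
transitivity (\int[distribution Pr X12]_z f z)%E.
  by rewrite integral_distribution.
rewrite (eq_measure_integral (distribution Pr X1 \x distribution Pr X2)%E); last first.
  by move=> A mA _; exact/esym/law.
rewrite -integral12_prod_meas1// /fubini_F.
have E1 : (\int[distribution Pr X2]_y (y%:E) = \int[Pr]_w (Y2 w)%:E)%E.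
  by rewrite integral_distribution.
have j2 : (distribution Pr X2).-integrable setT (EFin : R -> \bar R).
  by apply: integrable_pushforward.
transitivity (\int[distribution Pr X1]_x (x%:E * \int[Pr]_w (Y2 w)%:E))%E.
  apply: eq_integral => x _.
  rewrite -E1 -integralZl//.
rewrite -(fineK (integrable_fin_num measurableT i2)) integralZr//; last first.
  by apply: integrable_pushforward.
by rewrite fineK ?integral_distribution //; exact: integrable_fin_num.
Qed.

End independence_theory.

(** * Independence of disjoint blocks of draws *)

Section blocks.
Context {R : realType} {d : measure_display} {Omega : measurableType d}.
Variable Pr : probability Omega R.
Variables (I : finType) (G : I -> set (set Omega)).
Hypotheses (GT : forall i, G i setT) (GI : forall i, setI_closed (G i))
  (Gm : forall i, G i `<=` measurable).
Hypothesis Gindep : mutually_independent Pr G.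

(** A pi-system generating the sigma-algebra of the draws in [J], made of the finite intersections
    about which mutual independence speaks directly. *)
Definition cylinders (J : {set I}) : set (set Omega) :=
  [set E | exists2 A : I -> set Omega, (forall i, i \in J -> G i (A i)) &
                                       E = \bigcap_(i in [set` J]) A i].

(* Omega with the sigma-algebra generated by the events of the draws in J;
   measurability on it says that a variable depends on these draws only. *)
Definition block (J : {set I}) := g_sigma_algebraType (cylinders J).

Lemma cylinders_setI_closed J : setI_closed (cylinders J).
Proof.
move=> _ _ [A GA ->] [B GB ->]; exists (fun i => A i `&` B i).
  by move=> i iJ; apply: GI; [exact: GA|exact: GB].
by rewrite bigcapI.
Qed.

Lemma cylinders_measurable J : cylinders J `<=` measurable.
Proof.
move=> _ [A GA ->]; apply: fin_bigcap_measurable => [|i iJ].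
  exact: finite_finset.
by apply: Gm; exact: GA.
Qed.

Lemma cylinders_sub (J J' : {set I}) : J \subset J' -> cylinders J `<=` cylinders J'.
Proof.
move=> /fintype.subsetP JJ' _ [A GA ->].
exists (fun i => if i \in J then A i else setT).
  by move=> i _; case: ifPn => [/GA//|_]; exact: GT.
apply/seteqP; split=> w Aw i /=; first by move=> _; case: ifPn => [/Aw|].
by move=> iJ; have := Aw i (JJ' _ iJ); rewrite /= iJ.
Qed.

Lemma cylinders1 (J : {set I}) i : i \in J -> G i `<=` cylinders J.
Proof.
move=> iJ A GA; exists (fun j => if j == i then A else setT).
  by move=> j _; case: eqP => [->|].
apply/seteqP; split=> w Aw; first by move=> j _ /=; case: eqP.
by have := Aw i iJ; rewrite /= eqxx.
Qed.

(** Mutual independence is used on [J1], on [J2] and on their union, where [A3] glues the two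
    families; disjointness splits the product over the union. *)
Lemma cylinders_independent (J1 J2 : {set I}) A B : {in J1, forall i, i \notin J2} ->
  cylinders J1 A -> cylinders J2 B -> independent_events Pr A B.
Proof.
move=> J12 [A1 GA1 ->] [A2 GA2 ->].
have E1 := Gindep GA1; have E2 := Gindep GA2.
pose A3 i := if i \in J1 then A1 i else A2 i.
have N2 i : i \in J2 -> (i \in J1) = false.
  by move=> iJ2; apply/negbTE; apply: contraTN iJ2; exact: J12.
have GA3 i : i \in J1 :|: J2 -> G i (A3 i).
  by rewrite inE /A3; case: ifPn => [/GA1//|_ /=]; exact: GA2.
have := Gindep GA3; rewrite /independent_events.
have -> : \bigcap_(i in [set` J1 :|: J2]) A3 i =
    \bigcap_(i in [set` J1]) A1 i `&` \bigcap_(i in [set` J2]) A2 i.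
  apply/seteqP; split=> [w Aw|w [w1 w2] i /=].
    split=> i /= iJ; first by have := Aw i; rewrite /= inE iJ /A3 iJ; apply.
    by have := Aw i; rewrite /= inE iJ /A3 orbT (N2 _ iJ); apply.
  by rewrite inE /A3; case: ifPn => [iJ _|_ /= iJ]; [exact: w1|exact: w2].
move=> ->; rewrite E1 E2 (bigID (mem J1))/=; congr (_ * _)%E.
  apply: eq_big => [i|i /andP[_ iJ]]; last by rewrite /A3 iJ.
  by rewrite !inE andb_idl// => ->.
apply: eq_big => [i|i /andP[_ /negbTE iJ]]; last by rewrite /A3 iJ.
by rewrite !inE; case: (boolP (i \in J1)) => [/J12/negbTE->|_]; rewrite ?andbF ?andbT.
Qed.

Lemma block_independent (J1 J2 : {set I}) A B : {in J1, forall i, i \notin J2} ->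
  <<s cylinders J1 >> A -> <<s cylinders J2 >> B -> independent_events Pr A B.
Proof.
move=> J12; apply: independent_sigma.
- exact: cylinders_setI_closed.
- exact: cylinders_setI_closed.
- exact: cylinders_measurable.
- exact: cylinders_measurable.
- by move=> {}A {}B; exact: cylinders_independent.
Qed.

Lemma block_measurable (J : {set I}) A : <<s cylinders J >> A -> measurable A.
Proof.
apply: smallest_sub; last exact: cylinders_measurable.
exact: sigma_algebra_measurable.
Qed.

Lemma measurable_to_block (J : {set I}) :
  measurable_fun setT (fun w : Omega => w : block J).
Proof. by move=> _ A mA; rewrite setTI; exact: block_measurable mA. Qed.

Lemma measurable_from_block {d'} {T : measurableType d'} (J : {set I})
  (f : Omega -> T) : measurable_fun setT (f : block J -> T) -> measurable_fun setT f.
Proof. by move=> mf _ A mA; apply: (@block_measurable J); exact: mf. Qed.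

Lemma measurable_block_sub {d'} {T : measurableType d'} (J J' : {set I})
  (f : Omega -> T) : J \subset J' ->
  measurable_fun setT (f : block J -> T) -> measurable_fun setT (f : block J' -> T).
Proof.
move=> JJ' mf _ A mA.
have sub : <<s cylinders J >> `<=` <<s cylinders J' >>.
  apply: sub_smallest2r; last exact: cylinders_sub.
  exact: smallest_sigma_algebra.
by apply: sub; exact: mf.
Qed.

(** Omega is paired with itself, each copy carrying the sigma-algebra of one block, and the two
    identity maps are independent. A diagonal integral thus becomes an iterated one, in which the
    past is frozen while the present is averaged. *)
Lemma block_tonelli (J1 J2 : {set I}) (h : block J1 * block J2 -> \bar R) :
  {in J1, forall i, i \notin J2} -> measurable_fun setT h -> (forall z, 0 <= h z)%E ->
  (\int[Pr]_w h (w, w) = \int[Pr]_w1 \int[Pr]_w2 h (w1, w2))%E.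
Proof.
move=> J12 mh h0.
have := @independent_tonelli _ _ _ Pr _ _ (block J1) (block J2) id id.
apply=> //; try exact: measurable_to_block.
by move=> A B mA mB; exact: (block_independent J12).
Qed.

Lemma measurable_block_inner (J1 J2 : {set I}) (h : block J1 * block J2 -> \bar R) :
  measurable_fun setT h -> (forall z, 0 <= h z)%E ->
  measurable_fun setT (fun w1 : Omega => \int[Pr]_w2 h (w1, w2))%E.
Proof.
move=> mh h0.
have := @measurable_tonelli_inner _ _ _ Pr _ _ (block J1) (block J2) id id.
by apply=> //; exact: measurable_to_block.
Qed.

Lemma block_expectationM (J1 J2 : {set I}) (Y1 Y2 : Omega -> R) :
  {in J1, forall i, i \notin J2} ->
  measurable_fun setT (Y1 : block J1 -> R) ->
  measurable_fun setT (Y2 : block J2 -> R) ->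
  Pr.-integrable setT (EFin \o Y1) -> Pr.-integrable setT (EFin \o Y2) ->
  Pr.-integrable setT (EFin \o (Y1 \* Y2)) /\
  \int[Pr]_w (Y1 w * Y2 w) = \int[Pr]_w Y1 w * \int[Pr]_w Y2 w.
Proof.
move=> J12 m1 m2; apply: independent_expectationM => A B mA mB.
apply: (block_independent J12).
- by have := m1 measurableT A mA; rewrite setTI.
- by have := m2 measurableT B mB; rewrite setTI.
Qed.

End blocks.

(** * Borel measurability of row vectors *)

Section borel_row_vectors.
Context {R : realType} {n : nat}.
Implicit Types (x y v : 'rV[R]_n).

Lemma open_row_measurable (U : set 'rV[R]_n) : open U -> measurable U.
Proof. by move=> oU; apply: sub_sigma_algebra. Qed.

Lemma continuous_row_measurable (f : 'rV[R]_n -> R) :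
  continuous f -> measurable_fun setT f.
Proof.
move=> cf; apply: (measurability _ (RGenOInfty.measurableE R)).
move=> _ [_ [a ->] <-]; rewrite setTI; apply: open_row_measurable.
by apply: open_comp.
Qed.

Lemma measurable_coord i : measurable_fun setT (fun v : 'rV[R]_n => v 0 i).
Proof. by apply: continuous_row_measurable; exact: coord_continuous. Qed.

(** Rational balls form a countable basis. The conditions on centre and radius sit inside the set,
    so that the union runs over a whole countable type. *)
Lemma open_row_bigcup (U : set 'rV[R]_n) : open U ->
  U = \bigcup_(p : 'rV[rat]_n * rat)
        [set v | 0 < ratr p.2 :> R /\ ball (map_mx ratr p.1 : 'rV[R]_n) (ratr p.2) `<=` U
                 /\ ball (map_mx ratr p.1 : 'rV[R]_n) (ratr p.2) v].
Proof.
move=> oU; apply/seteqP; split=> [x Ux|x [p _ [_ [sub]]]]; last exact: sub.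
have /nbhs_ballP[e /= e0 eU] : nbhs x U by move: oU; rewrite openE; apply.
(* A rational radius below e / 2 and a rational centre within that radius of [x] give a ball that
   contains [x] and lies in [ball x e]. *)
have [r] : exists r : rat, ratr r \in `](0:R), (e / 2)[.
  by apply: rat_in_itvoo; rewrite divr_gt0.
rewrite in_itv /= => /andP[r0 re].
have /choice[q qP] : forall i : 'I_n, exists q : rat, `|x 0 i - ratr q| < ratr r.
  move=> i; have [q] : exists q : rat, ratr q \in `](x 0 i - ratr r), (x 0 i + ratr r)[.
    by apply: rat_in_itvoo; lra.
  by rewrite in_itv /= => /andP[q1 q2]; exists q; rewrite ltr_norml; lra.
exists (\row_i q i, r) => //=; split=> //.
have xb : ball (map_mx ratr (\row_i q i) : 'rV[R]_n) (ratr r) x.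
  split => // i j; rewrite !ord1 !mxE /ball/= distrC; exact: qP.
split=> // y yb; apply: eU.
apply: (@le_ball _ _ _ (ratr r + ratr r)); first by lra.
by apply: ball_triangle yb; exact: ball_sym.
Qed.

(** Balls of row vectors are finite intersections of conditions on single coordinates, and by
    [open_row_bigcup] they reach every open set through countable unions. *)
Lemma measurable_row {d} {T : measurableType d} (f : T -> 'rV[R]_n) :
  (forall i, measurable_fun setT (fun w => f w 0 i)) -> measurable_fun setT f.
Proof.
move=> mf; apply: (@measurability _ _ _ _ _ _ _ (erefl : measurable = <<s @open 'rV[R]_n >>)).
move=> _ [U oU <-]; rewrite setTI (open_row_bigcup oU) preimage_bigcup.
apply: countable_bigcupT_measurable => // -[q r] /=.
have [[r0 sub]|no] := pselect (0 < ratr r :> R /\ ball (map_mx ratr q : 'rV[R]_n) (ratr r) `<=` U);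
    last first.
  by rewrite (_ : _ @^-1` _ = set0)//; apply/seteqP; split=> // w /= [r0 [sub _]]; exact: no.
rewrite (_ : _ @^-1` _ = \bigcap_(i : 'I_n) (fun w => f w 0 i) @^-1` ball (ratr (q 0 i) : R) (ratr r)).
  apply: fin_bigcap_measurable; first exact: finite_finset.
  by move=> i _; rewrite -[_ @^-1` _]setTI; apply: mf => //; exact: measurable_ball.
apply/seteqP; split=> w /=.
  by move=> [_ [_ [_ wb]]] i _; have := wb 0 i; rewrite mxE.
move=> wb; split=> //; split=> //; split=> // i j; rewrite !ord1 mxE.
exact: wb.
Qed.

Lemma measurable_rowP {d} {T : measurableType d} (f : T -> 'rV[R]_n) :
  measurable_fun setT f <-> forall i, measurable_fun setT (fun w => f w 0 i).
Proof.
split; last exact: measurable_row.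
by move=> mf i; exact: (measurableT_comp (measurable_coord i) mf).
Qed.

Lemma measurable_rowD {d} {T : measurableType d} (f g : T -> 'rV[R]_n) :
  measurable_fun setT f -> measurable_fun setT g ->
  measurable_fun setT (fun w => f w + g w).
Proof.
move=> /measurable_rowP mf /measurable_rowP mg; apply: measurable_row => i.
by under eq_fun do rewrite mxE; exact: measurable_funD.
Qed.

Lemma measurable_rowZ {d} {T : measurableType d} (a : T -> R) (f : T -> 'rV[R]_n) :
  measurable_fun setT a -> measurable_fun setT f ->
  measurable_fun setT (fun w => a w *: f w).
Proof.
move=> ma /measurable_rowP mf; apply: measurable_row => i.
by under eq_fun do rewrite mxE; exact: measurable_funM.
Qed.

Lemma measurable_dot {d} {T : measurableType d} (f g : T -> 'rV[R]_n) :
  measurable_fun setT f -> measurable_fun setT g ->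
  measurable_fun setT (fun w => dot (f w) (g w)).
Proof.
move=> /measurable_rowP mf /measurable_rowP mg.
by apply: measurable_sum => i; exact: measurable_funM.
Qed.

End borel_row_vectors.

(** * The Euclidean inner product *)

Section dot_theory.
Context {R : realType} {n : nat}.
Implicit Types (x y v : 'rV[R]_n) (a : R).

Lemma dotC x y : dot x y = dot y x.
Proof. by apply: eq_bigr => i _; rewrite mulrC. Qed.

Lemma dotDr x y v : dot x (y + v) = dot x y + dot x v.
Proof. by rewrite -big_split; apply: eq_bigr => i _; rewrite mxE mulrDr. Qed.

Lemma dotNr x y : dot x (- y) = - dot x y.
Proof. by rewrite -sumrN; apply: eq_bigr => i _; rewrite mxE mulrN. Qed.

Lemma dotBr x y v : dot x (y - v) = dot x y - dot x v.
Proof. by rewrite dotDr dotNr. Qed.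

Lemma dotZr a x y : dot x (a *: y) = a * dot x y.
Proof. by rewrite mulr_sumr; apply: eq_bigr => i _; rewrite mxE mulrCA. Qed.

Lemma dotDl x y v : dot (x + y) v = dot x v + dot y v.
Proof. by rewrite ![dot _ v]dotC dotDr. Qed.

Lemma dotNl x y : dot (- x) y = - dot x y.
Proof. by rewrite ![dot _ y]dotC dotNr. Qed.

Lemma dotBl x y v : dot (x - y) v = dot x v - dot y v.
Proof. by rewrite dotDl dotNl. Qed.

Lemma dotZl a x y : dot (a *: x) y = a * dot x y.
Proof. by rewrite ![dot _ y]dotC dotZr. Qed.

Lemma dot_suml (I : Type) (r : seq I) (F : I -> 'rV[R]_n) y :
  dot (\sum_(i <- r) F i) y = \sum_(i <- r) dot (F i) y.
Proof.
elim: r => [|i r IH]; last by rewrite !big_cons dotDl IH.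
by rewrite !big_nil /dot big1// => i _; rewrite mxE mul0r.
Qed.

Lemma dot_delta x i : dot x (delta_mx 0 i) = x 0 i.
Proof.
rewrite /dot (bigD1 i)//= mxE !eqxx mulr1 big1 ?addr0// => j ji.
by rewrite mxE (negbTE ji) andbF mulr0.
Qed.

Lemma dot_ge0 x : 0 <= dot x x.
Proof. by apply: sumr_ge0 => i _; rewrite -expr2 sqr_ge0. Qed.

Lemma dot_eq0 x : dot x x = 0 -> x = 0.
Proof.
move=> /eqP; rewrite psumr_eq0; last by move=> i _; rewrite -expr2 sqr_ge0.
move=> /allP x0; apply/rowP => i; have := x0 i (mem_index_enum _).
by rewrite mxE /= mulf_eq0 orbb => /eqP.
Qed.

Lemma dot_CauchySchwarz x y : dot x y ^+ 2 <= dot x x * dot y y.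
Proof.
have [y0|] := eqVneq (dot y y) 0.
  by rewrite (dot_eq0 y0) -[0 : 'rV_n](scale0r 0) !dotZr !mul0r mulr0 expr0n.
move=> y0; have yy : 0 < dot y y by rewrite lt_def y0 dot_ge0.
have := dot_ge0 (dot y y *: x - dot x y *: y).
rewrite dotBl !dotBr !dotZl !dotZr (dotC y x) => h.
rewrite -(ler_pM2l yy) -subr_ge0.
rewrite (_ : _ - _ = dot y y * (dot y y * dot x x) - dot y y * (dot x y * dot x y) -
  (dot x y * (dot y y * dot x y) - dot x y * (dot x y * dot y y))) //.
by rewrite expr2; ring.
Qed.

Lemma norm2_sq x : norm2 x ^+ 2 = dot x x.
Proof. by rewrite sqr_sqrtr// dot_ge0. Qed.

Lemma norm2_ge0 x : 0 <= norm2 x.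
Proof. exact: sqrtr_ge0. Qed.

Lemma dot_norm2 x y : `|dot x y| <= norm2 x * norm2 y.
Proof.
rewrite -(@ler_pXn2r _ 2)// ?nnegrE ?mulr_ge0 ?norm2_ge0//.
by rewrite exprMn !norm2_sq real_normK ?num_real// dot_CauchySchwarz.
Qed.

End dot_theory.

(** * Integrable real functions on a probability space *)

Section real_integrable.
Context {R : realType} {d : measure_display} {T : measurableType d}.
Variable mu : probability T R.
Implicit Types (f g : T -> R).

Definition L1 f := mu.-integrable setT (EFin \o f).

Lemma L1_measurable f : L1 f -> measurable_fun setT f.
Proof. by move=> /measurable_int /measurable_EFinP. Qed.

Lemma L1_le f g : measurable_fun setT f -> (forall w, `|f w| <= g w) -> L1 g -> L1 f.
Proof.
move=> mf fg; apply: le_integrable => //; first exact/measurable_EFinP.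
by move=> w _ /=; rewrite lee_fin (le_trans (fg w))// ler_norm.
Qed.

Lemma L1_cst c : L1 (cst c).
Proof.
apply: measurable_bounded_integrable => //.
  by apply: le_lt_trans (probability_le1 mu measurableT) _; rewrite ltry.
by exists `|c|; split=> // M cM w _; exact: ltW.
Qed.

Lemma L1D f g : L1 f -> L1 g -> L1 (fun w => f w + g w).
Proof. exact: integrableD. Qed.

Lemma L1N f : L1 f -> L1 (fun w => - f w).
Proof. by move=> /integrableN; apply. Qed.

Lemma L1B f g : L1 f -> L1 g -> L1 (fun w => f w - g w).
Proof. by move=> Lf Lg; apply: L1D => //; exact: L1N. Qed.

Lemma L1Z c f : L1 f -> L1 (fun w => c * f w).
Proof. by move=> /(integrableZl measurableT c); apply. Qed.

Lemma L1Zr c f : L1 f -> L1 (fun w => f w * c).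
Proof. by move=> /(L1Z c); under eq_fun do rewrite mulrC. Qed.

Lemma L1_norm f : L1 f -> L1 (fun w => `|f w|).
Proof.
move=> Lf; apply: (@le_integrable _ _ _ mu _ _ _ (EFin \o f)) => //.
  by apply/measurable_EFinP; apply: measurableT_comp => //; exact: L1_measurable.
by move=> w _ /=; rewrite normr_id.
Qed.

Lemma L1_sum (I : Type) (r : seq I) (P : pred I) (F : I -> T -> R) :
  (forall i, P i -> L1 (F i)) -> L1 (fun w => \sum_(i <- r | P i) F i w).
Proof.
move=> LF; elim: r => [|i r IH]; first by under eq_fun do rewrite big_nil; exact: L1_cst.
under eq_fun do rewrite big_cons.
by have [/LF Li|_ //] := boolP (P i); exact: L1D.
Qed.

Lemma Rintegral_sum (I : Type) (r : seq I) (P : pred I) (F : I -> T -> R) :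
  (forall i, P i -> L1 (F i)) ->
  \int[mu]_w (\sum_(i <- r | P i) F i w) = \sum_(i <- r | P i) \int[mu]_w F i w.
Proof.
move=> LF; elim: r => [|i r IH].
  under eq_Rintegral do rewrite big_nil.
  by rewrite big_nil Rintegral_cst// mul0r.
rewrite big_cons; under eq_Rintegral do rewrite big_cons.
have [/LF Li|_ //] := boolP (P i).
by rewrite RintegralD ?IH//; exact: L1_sum.
Qed.

Lemma Rintegral_prob_cst c : \int[mu]_w c = c.
Proof.
rewrite Rintegral_cst//.
have -> : fine (mu setT) = 1 by rewrite (@probability_setT _ _ _ mu).
by rewrite mulr1.
Qed.

Lemma ae_L1_le f g : measurable_fun setT f -> {ae mu, forall w, `|f w| <= g w} ->
  L1 g -> L1 f.
Proof.
move=> mf fg Lg; have mg := L1_measurable Lg.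
apply/integrableP; split; first exact/measurable_EFinP.
have [_] := integrableP _ _ _ Lg; apply: le_lt_trans.
apply: ae_ge0_le_integral => //.
- by apply: measurableT_comp => //; exact/measurable_EFinP.
- by apply: measurableT_comp => //; exact/measurable_EFinP.
- by apply: filterS fg => w fgw _ /=; rewrite lee_fin (le_trans fgw)// ler_norm.
Qed.

Lemma ae_Rintegral_eq f g : measurable_fun setT f -> measurable_fun setT g ->
  {ae mu, forall w, f w = g w} -> \int[mu]_w f w = \int[mu]_w g w.
Proof.
move=> mf mg fg; congr fine; apply: ae_eq_integral => //; [exact/measurable_EFinP..|].
by apply: filterS fg => w -> _.
Qed.

Lemma ae_Rintegral_le f g : L1 f -> L1 g -> {ae mu, forall w, f w <= g w} ->
  \int[mu]_w f w <= \int[mu]_w g w.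
Proof.
move=> Lf Lg fg.
have mf := L1_measurable Lf; have mg := L1_measurable Lg.
rewrite -subr_ge0 -RintegralB//.
(* The positive part agrees with the difference outside a null set and is nonnegative everywhere. *)
rewrite (@ae_Rintegral_eq _ (fun w => Num.max 0 (g w - f w))).
- by apply: Rintegral_ge0 => w _; rewrite le_max lexx.
- exact: measurable_funB.
- by apply: measurable_maxr => //; exact: measurable_funB.
- by apply: filterS fg => w fgw; rewrite max_r// subr_ge0.
Qed.

Lemma L1_mul_sqr f g : measurable_fun setT f -> measurable_fun setT g ->
  L1 (fun w => f w ^+ 2) -> L1 (fun w => g w ^+ 2) -> L1 (fun w => f w * g w).
Proof.
move=> mf mg Lf Lg.
apply: (@L1_le _ (fun w => f w ^+ 2 + g w ^+ 2)); last exact: L1D.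
  exact: measurable_funM.
move=> w; rewrite normrM -[f w ^+ 2]real_normK ?num_real// -[g w ^+ 2]real_normK ?num_real//.
have := sqr_ge0 (`|f w| - `|g w|); have := mulr_ge0 (normr_ge0 (f w)) (normr_ge0 (g w)).
by nra.
Qed.

Lemma L1_sqr f : measurable_fun setT f -> L1 (fun w => f w ^+ 2) -> L1 f.
Proof.
move=> mf Lf.
have : L1 (fun w => f w * 1).
  apply: L1_mul_sqr => //.
  by under eq_fun do rewrite expr1n; exact: L1_cst.
by under eq_fun do rewrite mulr1.
Qed.

Lemma L1_ge0 f c : measurable_fun setT f -> (forall w, 0 <= f w) ->
  (\int[mu]_w (f w)%:E <= c%:E)%E -> L1 f /\ \int[mu]_w f w <= c.
Proof.
move=> mf f0 fc; have Lf : L1 f.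
  apply/integrableP; split; first exact/measurable_EFinP.
  by under eq_integral do rewrite /= ger0_norm//; apply: le_lt_trans fc (ltry _).
by split => //; rewrite -lee_fin /Rintegral fineK//; exact: integrable_fin_num.
Qed.

Lemma EFin_Rintegral f : L1 f -> (\int[mu]_w f w)%:E = (\int[mu]_w (f w)%:E)%E.
Proof. by move=> Lf; rewrite /Rintegral fineK//; exact: integrable_fin_num. Qed.

End real_integrable.

(** * Transfer of integrals and null sets to a law *)

Section transfer_law.
Context {R : realType} {d d' : measure_display} {T : measurableType d}
  {T' : measurableType d'}.
Variables (mu : probability T R) (nu : probability T' R) (U : T -> T').
Hypotheses (mU : measurable_fun setT U)
  (lawU : forall A, measurable A -> mu (U @^-1` A) = nu A).

Let X : {mfun T >-> T'} := HB.pack U (isMeasurableFun.Build _ _ _ _ _ mU).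

Let nuE A : measurable A -> A `<=` setT -> nu A = distribution mu X A.
Proof. by move=> mA _; rewrite -lawU. Qed.

Lemma ge0_integral_law (f : T' -> \bar R) : measurable_fun setT f ->
  (forall y, 0 <= f y)%E -> (\int[nu]_y f y = \int[mu]_w f (U w))%E.
Proof.
move=> mf f0; rewrite (eq_measure_integral (distribution mu X))//.
exact: ge0_integral_distribution.
Qed.

Lemma L1_law (f : T' -> R) : L1 nu f -> L1 mu (f \o U).
Proof.
move=> Lf; have mf := L1_measurable Lf; apply/integrableP; split.
  by apply/measurable_EFinP; exact: measurableT_comp.
have [_] := integrableP _ _ _ Lf; rewrite ge0_integral_law//.
by apply: measurableT_comp => //; exact/measurable_EFinP.
Qed.

Lemma Rintegral_law (f : T' -> R) : L1 nu f ->
  \int[nu]_y f y = \int[mu]_w f (U w).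
Proof.
move=> Lf; congr fine; rewrite (eq_measure_integral (distribution mu X))//.
rewrite integral_distribution//; last exact: L1_law.
exact: measurable_int Lf.
Qed.

Lemma ae_law (Q : T' -> Prop) : {ae nu, forall y, Q y} -> {ae mu, forall w, Q (U w)}.
Proof.
move=> [N [mN N0 QN]]; exists (U @^-1` N); split.
- by rewrite -[X in measurable X]setTI; exact: mU.
- by rewrite lawU.
- by move=> w /= nQ; exact: QN.
Qed.

End transfer_law.

(** * The uniform law on the sphere *)

Section reflections.
Context {R : realType} {n : nat}.
Implicit Types (u v : 'rV[R]_n).

(** For nonzero [u], the Householder reflection that negates [u] and fixes its orthogonal
    hyperplane. *)
Definition reflect_along u v := v - (2 * dot v u / dot u u) *: u.

Definition reflection_mx u : 'M[R]_n := 1%:M - (2 / dot u u) *: (u^T *m u).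

Lemma dot_mx u v : u *m v^T = (dot u v)%:M.
Proof.
apply/matrixP => i j; rewrite !ord1 !mxE eqxx mulr1n.
by apply: eq_bigr => k _; rewrite mxE.
Qed.

Lemma mul_reflection_mx u v : v *m reflection_mx u = reflect_along u v.
Proof.
rewrite mulmxBr mulmx1 -scalemxAr mulmxA dot_mx mul_scalar_mx scalerA.
by congr (_ - _ *: _); rewrite mulrAC.
Qed.

(** The matrix is symmetric and sends [u] to [- u], hence it is an involution. *)
Lemma reflection_mx_orthogonal u : u != 0 ->
  reflection_mx u *m (reflection_mx u)^T = 1%:M.
Proof.
move=> u0; have uu : dot u u != 0 by apply: contra_neq u0; exact: dot_eq0.
have -> : (reflection_mx u)^T = reflection_mx u.
  by rewrite /reflection_mx linearB linearZ /= trmx1 trmx_mul trmxK.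
rewrite {1}/reflection_mx mulmxBl mul1mx -scalemxAl -mulmxA mul_reflection_mx.
have -> : reflect_along u u = - u.
  rewrite /reflect_along -mulrA divff// mulr1 -[X in X - _]scale1r -scalerBl.
  by rewrite (_ : 1 - 2 = -1) ?scaleN1r//; ring.
by rewrite mulmxN scalerN opprK /reflection_mx subrK.
Qed.

End reflections.

Section uniform_sphere.
Context {R : realType} {n : nat}.
Variable U : probability 'rV[R]_n R.
Hypothesis uniformU : uniform_on_sphere U.
Implicit Types (u v : 'rV[R]_n) (phi : 'rV[R]_n -> R).

Lemma ae_sphere : {ae U, forall v, dot v v = 1}.
Proof.
have mS : measurable [set v : 'rV[R]_n | dot v v = 1].
  rewrite -[X in measurable X]setTI; apply: (measurable_dot _ _ measurableT (measurable_set1 1)) => //.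
have U1 : U [set v | dot v v = 1] = 1%E.
  rewrite -(proj1 uniformU); congr (U _); apply/seteqP; split=> v /=.
    by move=> vv; rewrite /norm2 vv sqrtr1.
  by move=> vv; rewrite -norm2_sq vv expr1n.
exists (~` [set v | dot v v = 1]); split=> //; first exact: measurableC.
by rewrite probability_setC// U1 subee.
Qed.

(** The class of test functions: it contains the coordinates, is stable under sums and products, and
    is integrable for [U] because [U] is carried by the sphere. *)
Definition sphere_bounded phi :=
  measurable_fun setT phi /\ exists C, forall v, dot v v = 1 -> `|phi v| <= C.

Lemma sphere_bounded_L1 phi : sphere_bounded phi -> L1 U phi.
Proof.
move=> [mphi [C bC]]; apply: (@ae_L1_le _ _ _ _ _ (cst C)) => //; last exact: L1_cst.
by apply: filterS ae_sphere => v /bC.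
Qed.

Lemma sphere_bounded_cst c : sphere_bounded (cst c).
Proof. by split=> //; exists `|c|. Qed.

Lemma sphere_boundedM phi psi : sphere_bounded phi -> sphere_bounded psi ->
  sphere_bounded (fun v => phi v * psi v).
Proof.
move=> [m1 [C1 b1]] [m2 [C2 b2]]; split; first exact: measurable_funM.
by exists (C1 * C2) => v vv; rewrite normrM ler_pM// ?b1 ?b2.
Qed.

Lemma sphere_boundedD phi psi : sphere_bounded phi -> sphere_bounded psi ->
  sphere_bounded (fun v => phi v + psi v).
Proof.
move=> [m1 [C1 b1]] [m2 [C2 b2]]; split; first exact: measurable_funD.
by exists (C1 + C2) => v vv; rewrite (le_trans (ler_normD _ _))// lerD ?b1 ?b2.
Qed.

Lemma sphere_boundedX phi k : sphere_bounded phi ->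
  sphere_bounded (fun v => phi v ^+ k).
Proof.
move=> bphi; elim: k => [|k IH]; first exact: sphere_bounded_cst.
by under eq_fun do rewrite exprS; exact: sphere_boundedM.
Qed.

Lemma sphere_bounded_coord i : sphere_bounded (fun v => v 0 i).
Proof.
split; first exact: measurable_coord.
exists 1 => v vv; rewrite -(@ler_pXn2r _ 2)// ?nnegrE// expr1n -vv.
rewrite real_normK ?num_real// /dot (bigD1 i)//= expr2 lerDl.
by apply: sumr_ge0 => j _; rewrite -expr2 sqr_ge0.
Qed.

Lemma sphere_bounded_sum (I : Type) (r : seq I) (F : I -> 'rV[R]_n -> R) :
  (forall i, sphere_bounded (F i)) -> sphere_bounded (fun v => \sum_(i <- r) F i v).
Proof.
move=> bF; elim: r => [|i r IH].
  by under eq_fun do rewrite big_nil; exact: sphere_bounded_cst.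
by under eq_fun do rewrite big_cons; exact: sphere_boundedD.
Qed.

Lemma sphere_bounded_dot u : sphere_bounded (fun v => dot u v).
Proof.
apply: sphere_bounded_sum => i; apply: sphere_boundedM.
  exact: sphere_bounded_cst.
exact: sphere_bounded_coord.
Qed.

Lemma measurable_reflect_along u : measurable_fun setT (reflect_along u).
Proof.
have -> : reflect_along u = fun v => v + (- (2 * dot v u / dot u u)) *: u.
  by apply/funext => v; rewrite scaleNr.
apply: measurable_rowD => //; apply: measurable_rowZ => //.
apply: measurableT_comp => //; apply: measurable_funM => //.
by apply: measurable_funM => //; exact: measurable_dot.
Qed.

Lemma Rintegral_reflect u phi : u != 0 -> sphere_bounded phi ->
  \int[U]_v phi (reflect_along u v) = \int[U]_v phi v.
Proof.
move=> u0 bphi.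
apply: esym; apply: (@Rintegral_law _ _ _ _ _ U U (reflect_along u) (measurable_reflect_along u)).
- move=> A mA; rewrite -((proj2 uniformU) _ (reflection_mx_orthogonal u0) A mA).
  by congr (U _); apply/seteqP; split=> v /=; rewrite mul_reflection_mx.
- exact: sphere_bounded_L1.
Qed.

Lemma delta_mx_neq0 i : delta_mx 0 i != 0 :> 'rV[R]_n.
Proof.
apply/eqP => /(congr1 (fun v : 'rV[R]_n => v 0 i)).
by rewrite !mxE !eqxx; exact/eqP/oner_neq0.
Qed.

Lemma reflect_delta i v j :
  reflect_along (delta_mx 0 i) v 0 j = if j == i then - v 0 i else v 0 j.
Proof.
rewrite /reflect_along !dot_delta !mxE !eqxx /= mulr1n divr1 mulrC.
by case: eqP => [->|_] /=; rewrite ?mulr1n ?mulr0n ?mul0r ?mul1r ?subr0//; ring.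
Qed.

Lemma reflect_swap i j v k : i != j ->
  reflect_along (delta_mx 0 i - delta_mx 0 j) v 0 k = v 0 (tperm i j k).
Proof.
move=> ij; rewrite /reflect_along !dotBr !dotBl !dot_delta !mxE !eqxx.
rewrite (eq_sym j i) (negbTE ij) /= (_ : (1%:R - 0%:R - (0%:R - 1%:R)) = 2 :> R); last first.
  by rewrite mulr1n mulr0n; ring.
rewrite [2 * _]mulrC mulfK ?pnatr_eq0//.
case: tpermP => [->|->|/eqP/negbTE -> /eqP/negbTE ->].
- by rewrite eqxx (negbTE ij) /= ?mulr1n ?mulr0n; ring.
- by rewrite (eq_sym j i) eqxx (negbTE ij) /= ?mulr1n ?mulr0n; ring.
- by rewrite /= ?mulr0n; ring.
Qed.

Lemma swap_neq0 i j : i != j -> delta_mx 0 i - delta_mx 0 j != 0 :> 'rV[R]_n.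
Proof.
move=> ij; apply/eqP => /(congr1 (fun v : 'rV[R]_n => v 0 i)).
by rewrite !mxE !eqxx (negbTE ij) subr0; exact/eqP/oner_neq0.
Qed.

(** A reflection along a basis vector flips the sign of one coordinate; one along the difference of
    two basis vectors swaps two coordinates. *)
Definition signed_permutation_invariant (S : 'rV[R]_n -> R) :=
  (forall i v, S (reflect_along (delta_mx 0 i) v) = S v) /\
  (forall i j v, i != j -> S (reflect_along (delta_mx 0 i - delta_mx 0 j) v) = S v).

Section invariant_weight.
Variable S : 'rV[R]_n -> R.
Hypotheses (bS : sphere_bounded S) (invS : signed_permutation_invariant S).

Let b2 i j : sphere_bounded (fun v => v 0 i * v 0 j * S v).
Proof.
apply: sphere_boundedM => //.
by apply: sphere_boundedM; exact: sphere_bounded_coord.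
Qed.

(** Flipping the sign of coordinate [i] turns the integral into its opposite. *)
Lemma Rintegral_coordM i j : i != j -> \int[U]_v (v 0 i * v 0 j * S v) = 0.
Proof.
move=> ij; have := Rintegral_reflect (delta_mx_neq0 i) (b2 i j).
under eq_Rintegral do rewrite !reflect_delta eqxx (eq_sym j i) (negbTE ij) invS.1 !mulNr.
under eq_Rintegral do rewrite -mulN1r.
by rewrite RintegralZl//; [lra|exact: sphere_bounded_L1].
Qed.

(** Transpositions make the n integrals equal, and they add up to the integral of [S] because the
    squared coordinates sum to 1 on the sphere. *)
Lemma Rintegral_coord_sqr i : \int[U]_v (v 0 i * v 0 i * S v) = n%:R^-1 * \int[U]_v S v.
Proof.
have same j : \int[U]_v (v 0 j * v 0 j * S v) = \int[U]_v (v 0 i * v 0 i * S v).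
  have [->//|ij] := eqVneq j i.
  have := Rintegral_reflect (swap_neq0 ij) (b2 i i).
  under eq_Rintegral do rewrite !reflect_swap// tpermR invS.2//.
  by [].
have : \int[U]_v S v = \sum_(j < n) \int[U]_v (v 0 j * v 0 j * S v).
  rewrite -Rintegral_sum; last by move=> j _; exact/sphere_bounded_L1.
  apply: ae_Rintegral_eq; first by case: bS.
    by apply: measurable_sum => j; case: (b2 j j).
  by apply: filterS ae_sphere => v vv; rewrite -mulr_suml -/(dot v v) vv mul1r.
under eq_bigr do rewrite same; rewrite sumr_const card_ord => ->.
rewrite -[X in _ * X]mulr_natl mulKf// pnatr_eq0.
by rewrite -lt0n; apply: leq_ltn_trans (ltn_ord i).
Qed.

(** The matrix of second moments weighted by [S] is a multiple of the identity. *)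
Lemma Rintegral_dotM x y :
  \int[U]_v (dot x v * dot y v * S v) = dot x y / n%:R * \int[U]_v S v.
Proof.
transitivity (\int[U]_v (\sum_(i < n) \sum_(j < n) (x 0 i * y 0 j) * (v 0 i * v 0 j * S v))).
  apply: eq_Rintegral => v _; rewrite /dot big_distrlr /= mulr_suml.
  by apply: eq_bigr => i _; rewrite mulr_suml; apply: eq_bigr => j _; ring.
have L i j : L1 U (fun v => (x 0 i * y 0 j) * (v 0 i * v 0 j * S v)).
  exact/L1Z/sphere_bounded_L1.
rewrite Rintegral_sum; last by move=> i _; exact: L1_sum.
rewrite -mulrA mulr_suml; apply: eq_bigr => i _.
rewrite Rintegral_sum// (bigD1 i)//= big1 ?addr0.
  by rewrite RintegralZl ?Rintegral_coord_sqr//; exact: sphere_bounded_L1.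
move=> j ji; rewrite RintegralZl ?Rintegral_coordM ?mulr0// 1?eq_sym//.
exact: sphere_bounded_L1.
Qed.

End invariant_weight.

End uniform_sphere.

(** * Moments of one coordinate on the sphere *)

Lemma poly_eq_horner (R : numDomainType) (p q : {poly R}) :
  (forall s, p.[s] = q.[s]) -> p = q.
Proof.
move=> pq; apply/eqP; rewrite -subr_eq0; apply/negPn/negP => pq0.
(* The natural numbers below the size of [p - q] would be too many distinct roots. *)
pose rs := [seq i%:R : R | i <- iota 0 (size (p - q))].
have := @max_poly_roots _ (p - q) rs pq0.
rewrite size_map size_iota ltnn => h; apply: notF; apply: h.
  by apply/allP => s _; rewrite /root hornerD hornerN pq subrr.
by rewrite map_inj_uniq ?iota_uniq// => i j /eqP; rewrite eqr_nat => /eqP.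
Qed.

Lemma coef_1DcX2X (R : comNzRingType) (c : R) k :
  let p := (1 + c *: 'X^2 : {poly R}) ^+ k in
  [/\ p`_0 = 1, p`_1 = 0 & p`_2 = c *+ k].
Proof.
move=> p; rewrite {}/p; elim: k => [|k [p0 p1 p2]]; first by rewrite expr0 !coef1 mulr0n.
by split; rewrite exprS mulrDl mul1r coefD -scalerAl coefZ coefXnM /= ?p0 ?p1 ?p2
   ?mulr0 ?mulr1 ?addr0// mulrSr.
Qed.

Lemma coef2_1DcX2XMXn (R : comNzRingType) (c b : R) a l :
  ((1 + c *: 'X^2) ^+ a * (b *: 'X^l))`_2 =
  match l with 0%N => b * (c *+ a) | 2%N => b | _ => 0 end.
Proof.
have [p0 p1 p2] := coef_1DcX2X c a.
rewrite -scalerAr coefZ coefMXn.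
by case: l => [|[|[|l]]] /=; rewrite ?p0 ?p1 ?p2 ?mulr0 ?mulr1.
Qed.

Section sphere_moments.
Context {R : realType} {n : nat}.
Variable U : probability 'rV[R]_n R.
Hypothesis uniformU : uniform_on_sphere U.
Implicit Types (u v : 'rV[R]_n).

Let bmon i j k l : sphere_bounded (fun v : 'rV[R]_n => v 0 i ^+ k * v 0 j ^+ l).
Proof. by apply: sphere_boundedM; apply: sphere_boundedX; exact: sphere_bounded_coord. Qed.

(** Invariance under the reflection along delta_i + s delta_j, multiplied by (1 + s^2)^k so that
    both sides are polynomials in [s]. As [k] is even, the sign of the reflected coordinate
    disappears. *)
Lemma rotated_moment i j k (s : R) : i != j -> ~~ odd k ->
  \int[U]_v ((1 - s ^+ 2) * v 0 i + 2 * s * v 0 j) ^+ k =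
  (1 + s ^+ 2) ^+ k * \int[U]_v v 0 i ^+ k.
Proof.
move=> ij ek; pose u : 'rV[R]_n := delta_mx 0 i + s *: delta_mx 0 j.
have ui : u 0 i = 1 by rewrite !mxE !eqxx (negbTE ij) /= mulr0 addr0.
have u0 : u != 0.
  by apply/eqP => /(congr1 (fun v : 'rV[R]_n => v 0 i)); rewrite ui mxE; exact/eqP/oner_neq0.
have s0 : 1 + s ^+ 2 != 0 :> R by rewrite gt_eqF// ltr_pwDl// sqr_ge0.
have uu : dot u u = 1 + s ^+ 2.
  rewrite dotDl !dotDr !dotZl !dotZr !dot_delta !mxE !eqxx (negbTE ij) (eq_sym j i) (negbTE ij).
  by rewrite /= ?mulr1n ?mulr0n; ring.
have bk : sphere_bounded (fun v : 'rV[R]_n => v 0 i ^+ k).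
  by apply: sphere_boundedX; exact: sphere_bounded_coord.
rewrite -(Rintegral_reflect uniformU u0 bk) -RintegralZl//; last first.
  have b1 := sphere_bounded_coord i; have b2 := sphere_bounded_coord j.
  have -> : EFin \o (fun v => reflect_along u v 0 i ^+ k) =
      EFin \o (fun v => (v 0 i + (- 2 / dot u u) * (1 * v 0 i + s * v 0 j)) ^+ k).
    apply/funext => v /=; congr ((_ ^+ k)%:E).
    rewrite !mxE dotDr dotZr !dot_delta !eqxx (negbTE ij) /= mulr1n mulr0n; by ring.
  apply: (sphere_bounded_L1 uniformU); apply: sphere_boundedX.
  apply: sphere_boundedD => //; apply: sphere_boundedM; first exact: sphere_bounded_cst.
  by apply: sphere_boundedD; (apply: sphere_boundedM; first exact: sphere_bounded_cst).
apply: eq_Rintegral => v _; rewrite -exprMn.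
have -> : (1 + s ^+ 2) * reflect_along u v 0 i = - ((1 - s ^+ 2) * v 0 i + 2 * s * v 0 j).
  rewrite /reflect_along uu !mxE dotDr dotZr !dot_delta !eqxx (negbTE ij) /= mulr1n mulr0n.
  by field.
by rewrite exprNn -signr_odd (negbTE ek) expr0 mul1r.
Qed.

(* Comparing the coefficients of s ^+ 2 in rotated_moment. *)
Lemma moment_rec2 i j r : i != j ->
  (2 * r + 1)%:R * \int[U]_v (v 0 i ^+ (2 * r) * v 0 j ^+ 2) =
  \int[U]_v v 0 i ^+ (2 * r).+2.
Proof.
move=> ij; set k := (2 * r).+2.
pose E l := \int[U]_v (v 0 i ^+ (k - l) * v 0 j ^+ l).
(* The binomial expansion of the left-hand side of [rotated_moment] as a polynomial in [s], with the
   mixed moments [E l] as coefficients. *)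
pose q : {poly R} := \sum_(l < k.+1) (E l *+ 'C(k, l)) *:
  ((1 + (-1) *: 'X^2) ^+ (k - l) * (2 ^+ l *: 'X^l)).
have ek : ~~ odd k by rewrite /k mul2n /= negbK odd_double.
have qE : q = E 0%N *: (1 + 1 *: 'X^2) ^+ k.
  apply: poly_eq_horner => s; rewrite horner_sum.
  have -> : (E 0%N *: (1 + 1 *: 'X^2) ^+ k).[s] = (1 + s ^+ 2) ^+ k * E 0%N.
    by rewrite hornerZ horner_exp hornerD hornerZ hornerXn hornerC mul1r mulrC.
  have -> : E 0%N = \int[U]_v v 0 i ^+ k.
    by apply: eq_Rintegral => v _; rewrite subn0 expr0 mulr1.
  rewrite -(rotated_moment s ij ek).
  rewrite (@eq_Rintegral _ _ _ U setT (fun v => \sum_(l < k.+1) ((1 - s ^+ 2) ^+ (k - l) * (2 * s) ^+ l *+ 'C(k, l)) *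
     (v 0 i ^+ (k - l) * v 0 j ^+ l))); last first.
    move=> v _; rewrite exprDn; apply: eq_bigr => l _.
    by rewrite !exprMn mulrnAl; congr (_ *+ _); ring.
  rewrite Rintegral_sum; last by move=> l _; apply/L1Z/(sphere_bounded_L1 uniformU).
  apply: eq_bigr => l _; rewrite RintegralZl//; last exact: (sphere_bounded_L1 uniformU).
  rewrite -/(E l) hornerZ hornerM horner_exp hornerD !hornerZ !hornerXn hornerC mulN1r.
  by rewrite exprMn !mulrnAl; congr (_ *+ _); ring.
(* With k = 2 r + 2 this reads 4 C(k, 2) E_2 - k E_0 = k E_0, that is, (k - 1) E_2 = E_0. *)
have : q`_2 = (E 0%N *: (1 + 1 *: 'X^2) ^+ k)`_2 by rewrite qE.
have [_ _ c2] := coef_1DcX2X (1 : R) k.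
rewrite coefZ c2 coef_sum !big_ord_recl /= big1 ?addr0; last first.
  by move=> l _; rewrite coefZ coef2_1DcX2XMXn mulr0.
rewrite !coefZ !coef2_1DcX2XMXn mulr0 add0r /=.
have -> : E 0%N = \int[U]_v v 0 i ^+ k.
  by apply: eq_Rintegral => v _; rewrite subn0 expr0 mulr1.
have -> : E (bump 0 (bump 0 0)) = \int[U]_v (v 0 i ^+ (2 * r) * v 0 j ^+ 2).
  by apply: eq_Rintegral => v _; rewrite /k subSS subSS subn0.
set M := \int[U]_v _; set N := \int[U]_v _.
have kE : k = (2 * r.+1)%N by rewrite mulnS.
have -> : 'C(k, bump 0 (bump 0 0)) = (r.+1 * (2 * r).+1)%N.
  by rewrite bin2 kE -mulnA mul2n doubleK mulnS.
rewrite bin0 mulr1n subn0 expr0 mul1r.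
have r1 : r.+1%:R != 0 :> R by rewrite pnatr_eq0.
have -> : k%:R = 2 * r.+1%:R :> R by rewrite kE natrM.
rewrite -[-1 *+ _]mulr_natr kE !natrM -[N *+ _]mulr_natr natrM [2 ^+ _]expr2 addn1 => h.
apply: (mulfI r1); lra.
Qed.

(** Multiply the integrand by the sum of the v_j^2, which is 1: the term j = i raises the degree by
    2, and [moment_rec2] evaluates the n - 1 others. *)
Lemma moment_rec i r : (1 < n)%N ->
  (n + 2 * r)%:R * \int[U]_v v 0 i ^+ (2 * r).+2 =
  (2 * r + 1)%:R * \int[U]_v v 0 i ^+ (2 * r).
Proof.
move=> n1.
have -> : \int[U]_v v 0 i ^+ (2 * r) =
    \sum_(j < n) \int[U]_v (v 0 i ^+ (2 * r) * v 0 j ^+ 2).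
  rewrite -Rintegral_sum; last by move=> j _; exact: (sphere_bounded_L1 uniformU).
  apply: ae_Rintegral_eq.
  - suff [] : sphere_bounded (fun v : 'rV[R]_n => v 0 i ^+ (2 * r)) by [].
    by apply: sphere_boundedX; exact: sphere_bounded_coord.
  - by apply: measurable_sum => j; have [] := bmon i j (2 * r) 2.
  - apply: filterS (ae_sphere uniformU) => v vv; rewrite -mulr_sumr.
    by under eq_bigr do rewrite expr2; rewrite -/(dot v v) vv mulr1.
rewrite (bigD1 i)//= (eq_bigr (fun=> (2 * r + 1)%:R^-1 * \int[U]_v v 0 i ^+ (2 * r).+2)); last first.
  move=> j ji; rewrite -(@moment_rec2 i j) 1?eq_sym// mulKf// pnatr_eq0 addn1.
rewrite sumr_const cardC1 card_ord.
under [X in _ = _ * (X + _)]eq_Rintegral do rewrite -exprD addn2.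
set M := \int[U]_v _.
have nE : n.-1%:R = n%:R - 1 :> R by rewrite -subn1 natrB// ltnW.
have c0 : (2 * r + 1)%:R != 0 :> R by rewrite pnatr_eq0 addn1.
rewrite -[X in _ = _ * (_ + X)]mulr_natr nE mulrDr mulrA mulVKf//.
by rewrite !natrD; ring.
Qed.

(** Each step of [moment_rec] multiplies by (2 r + 1) / (n + 2 r), which is at most 2 k / n as long
    as r < k; hence the induction on [r] with [k] fixed. *)
Lemma moment_le i r k : (1 < n)%N -> (r <= k)%N ->
  \int[U]_v v 0 i ^+ (2 * r) <= ((2 * k)%:R / n%:R) ^+ r.
Proof.
move=> n1; have n0 : 0 < n%:R :> R by rewrite ltr0n ltnW.
elim: r => [_|r IH rk].
  by under eq_Rintegral do rewrite muln0 expr0; rewrite Rintegral_prob_cst.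
have n2 : 0 < (n + 2 * r)%:R :> R by rewrite ltr0n addn_gt0 ltnW.
rewrite mulnS exprS -(ler_pM2l n2) moment_rec//.
have {}IH := IH (ltnW rk).
have Y0 : 0 <= ((2 * k)%:R / n%:R) ^+ r :> R by rewrite exprn_ge0// divr_ge0// ler0n.
apply: (@le_trans _ _ ((2 * k)%:R * ((2 * k)%:R / n%:R) ^+ r)).
  apply: ler_pM => //; last by rewrite ler_nat addn1 (leq_trans _ (leq_mul (leqnn 2) rk))// mulnS.
  by apply: Rintegral_ge0 => v _; rewrite exprM exprn_ge0// sqr_ge0.
rewrite mulrA ler_wpM2r// mulrCA ler_peMr ?ler0n// ler_pdivlMr// mul1r ler_nat.
exact: leq_addr.
Qed.

End sphere_moments.

(** * Logarithms and the values of rho *)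

Section logarithm_bounds.
Context {R : realType}.

(** This is ln (1 + x) <= x at x = - 1 / 2. *)
Lemma ln2_ge_half : 1 / 2 <= ln 2 :> R.
Proof.
have := @le_ln1Dx R (- (1 / 2)); rewrite (_ : 1 + - (1 / 2) = 2^-1); last by field.
by rewrite lnV ?posrE// => h; have := h ltac:(lra); lra.
Qed.

Lemma ln_nat_ge (n : nat) : (8 <= n)%N -> 3 / 2 <= ln n%:R :> R.
Proof.
move=> n8; apply: (@le_trans _ _ (ln (2 ^+ 3))).
  by rewrite lnXn//; have := ln2_ge_half; rewrite !mulrS mulr0n; lra.
rewrite ler_ln ?posrE ?exprn_gt0// ?ltr0n ?(leq_trans _ n8)//.
by rewrite -natrX ler_nat.
Qed.

(** Minimality of r = [up_log 2 n] gives (r - 1) ln 2 <= ln n, so 4 r <= 8 ln n + 4; this is at most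
    16 ln n - 8 exactly when ln n >= 3 / 2, which n >= 8 ensures. *)
Lemma up_log2_le_ln (n : nat) : (8 <= n)%N ->
  4 * (up_log 2 n)%:R <= 16 * ln n%:R - 8 :> R.
Proof.
move=> n8; have n1 : (1 < n)%N by apply: leq_trans n8.
have l8 := ln_nat_ge n8.
have l2 := ln2_ge_half.
set r := up_log 2 n.
have r0 : (0 < r)%N by rewrite up_log_gt0.
have : ln ((2:R) ^+ r.-1) <= ln n%:R.
  rewrite ler_ln ?posrE ?exprn_gt0// ?ltr0n ?(leq_trans _ n8)//.
  by rewrite -natrX ler_nat ltnW// up_log_gtn.
rewrite lnXn// -[_ *+ _]mulr_natr.
have -> : r%:R = r.-1%:R + 1 :> R by rewrite natr1 prednK.
have l2' : 0 <= ln 2 - 1 / 2 :> R by rewrite subr_ge0.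
have := mulr_ge0 (ler0n R r.-1) l2'.
lra.
Qed.

Lemma rho1E (n : nat) : rho 1 n = (16 * ln n%:R - 8) / n%:R :> R.
Proof.
rewrite /rho /conjugate_exponent inve1 subee// inve0.
have -> : (+oo - 1 = +oo :> \bar R)%E by [].
rewrite min_r ?leey// invey mule0 sub0e /=.
by rewrite powR_inv1// ler0n.
Qed.

Lemma rho2E (n : nat) : (8 <= n)%N -> rho 2 n = 1 :> R.
Proof.
move=> n8; have l8 := ln_nat_ge n8.
rewrite /rho /conjugate_exponent inver pnatr_eq0 /=.
have -> : (1 + (- 2^-1)%:E = (2^-1 : R)%:E)%E by rewrite -EFinD; congr EFin; field.
rewrite inver invr_eq0 pnatr_eq0 invrK inver pnatr_eq0 /=.
rewrite -!EFinD -EFin_min /= divff ?pnatr_eq0// subrr powRr0 mulr1 min_l; last by lra.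
by ring.
Qed.

Lemma rho_gt0 (p n : nat) : (8 <= n)%N -> p = 1%N \/ p = 2%N -> 0 < rho p n :> R.
Proof.
move=> n8 [->|->]; last by rewrite rho2E.
rewrite rho1E divr_gt0 ?ltr0n ?(leq_trans _ n8)//.
by have := ln_nat_ge n8; lra.
Qed.

End logarithm_bounds.

(** * A polynomial majorant of the squared dual norm *)

Lemma bernoulli_ge0 (R : realFieldType) (x : R) r : 0 <= x ->
  r%:R * x <= x ^+ r + (r%:R - 1).
Proof.
move=> x0; elim: r => [|r IH]; first by rewrite expr0; lra.
rewrite -subr_ge0 in IH; have := mulr_ge0 x0 IH.
have := mulr_ge0 (ler0n R r) (sqr_ge0 (x - 1)).
rewrite [x ^+ r.+1]exprS -natr1; lra.
Qed.

Section dual_weight.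
Context {R : realType} {n : nat}.
Variables (r : nat) (b : R).
Hypotheses (r0 : (0 < r)%N) (b0 : 0 < b).
Implicit Types (v x : 'rV[R]_n).

(* By Young's inequality this smooth symmetric function dominates the square of
   the sup-norm; for r = 1 it is the square of the Euclidean norm. *)
Definition dual_weight v : R :=
  (b ^- r.-1 * \sum_(i < n) v 0 i ^+ (2 * r) + (r%:R - 1) * b) / r%:R.

Lemma dual_weight_ge_coord v i : v 0 i ^+ 2 <= dual_weight v.
Proof.
rewrite ler_pdivlMr ?ltr0n//.
have vb : 0 <= v 0 i ^+ 2 / b by rewrite divr_ge0 ?sqr_ge0// ltW.
have bn : b != 0 by rewrite gt_eqF.
(* Bernoulli's inequality at v_i^2 / b, scaled by [b], is the instance of Young's inequality behind
   the weight. *)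
have := ler_wpM2l (ltW b0) (bernoulli_ge0 r vb).
have -> : b * (r%:R * (v 0 i ^+ 2 / b)) = v 0 i ^+ 2 * r%:R by field.
have -> : b * ((v 0 i ^+ 2 / b) ^+ r + (r%:R - 1)) =
    b ^- r.-1 * v 0 i ^+ (2 * r) + (r%:R - 1) * b.
  rewrite expr_div_n -exprM mulrDr [b * (_ - 1)]mulrC; congr (_ + _).
  by rewrite -{2}(prednK r0) exprS; field; rewrite bn expf_neq0.
move=> /le_trans; apply; rewrite lerD2r.
apply: ler_wpM2l; first by rewrite invr_ge0 exprn_ge0// ltW.
rewrite (bigD1 i)//= lerDl.
by apply: sumr_ge0 => j _; rewrite exprM exprn_ge0// sqr_ge0.
Qed.

Lemma dual_weight_ge0 v : 0 <= dual_weight v.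
Proof.
apply: divr_ge0; last exact: ler0n.
apply: addr_ge0; apply: mulr_ge0.
- by rewrite invr_ge0 exprn_ge0// ltW.
- by apply: sumr_ge0 => j _; rewrite exprM exprn_ge0// sqr_ge0.
- by rewrite subr_ge0 ler1n.
- exact: ltW.
Qed.

(** Hoelder's inequality between the sup-norm and the 1-norm. *)
Lemma dot_le_dual_weight v x : dot v x ^+ 2 <= dual_weight v * (\sum_(i < n) `|x 0 i|) ^+ 2.
Proof.
have s0 : 0 <= \sum_(i < n) `|x 0 i| by exact: sumr_ge0.
rewrite -(sqr_sqrtr (dual_weight_ge0 v)) -exprMn -[dot v x ^+ 2]real_normK ?num_real//.
rewrite ler_pXn2r// ?nnegrE ?mulr_ge0 ?sqrtr_ge0//.
rewrite (le_trans (ler_norm_sum _ _ _))// mulr_sumr ler_sum// => i _.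
rewrite normrM ler_wpM2r// -sqrtr_sqr ler_wsqrtr//; exact: dual_weight_ge_coord.
Qed.

Lemma sphere_bounded_dual_weight : sphere_bounded dual_weight.
Proof.
rewrite /dual_weight; under eq_fun do rewrite mulrC.
apply: sphere_boundedM; first exact: sphere_bounded_cst.
apply: sphere_boundedD; last exact: sphere_bounded_cst.
apply: sphere_boundedM; first exact: sphere_bounded_cst.
apply: sphere_bounded_sum => i; apply: sphere_boundedX; exact: sphere_bounded_coord.
Qed.

Lemma dual_weight_invariant : signed_permutation_invariant dual_weight.
Proof.
split=> [i v|i j v ij]; rewrite /dual_weight; congr ((_ * _ + _) / _).
  apply: eq_bigr => j _; rewrite reflect_delta; case: eqP => [->|//].
  by rewrite !exprM sqrrN.
under eq_bigr do rewrite reflect_swap//.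
by rewrite [RHS](reindex_inj (@perm_inj _ (tperm i j))).
Qed.

End dual_weight.

Section dual_weight_mean.
Context {R : realType} {n : nat}.
Variable U : probability 'rV[R]_n R.
Hypotheses (uniformU : uniform_on_sphere U) (n8 : (8 <= n)%N).

Let n0 : 0 < n%:R :> R. Proof. by rewrite ltr0n (leq_trans _ n8). Qed.

Lemma Rintegral_dual_weight r b :
  \int[U]_v dual_weight r b v =
  (b ^- r.-1 * \sum_(i < n) \int[U]_v v 0 i ^+ (2 * r) + (r%:R - 1) * b) / r%:R.
Proof.
have Li i : L1 U (fun v => v 0 i ^+ (2 * r)).
  apply: (sphere_bounded_L1 uniformU); apply: sphere_boundedX; exact: sphere_bounded_coord.
have Ls : L1 U (fun v => \sum_(i < n) v 0 i ^+ (2 * r)) by exact: L1_sum.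
rewrite RintegralZr//; last by apply: L1D; [exact: L1Z|exact: L1_cst].
rewrite RintegralD//; [|exact: L1Z|exact: L1_cst].
by rewrite Rintegral_prob_cst RintegralZl// Rintegral_sum.
Qed.

Lemma dual_weight1_mean b : \int[U]_v dual_weight 1 b v = 1.
Proof.
rewrite -[RHS](@Rintegral_prob_cst _ _ _ U).
apply: ae_Rintegral_eq => //; first by have [] := @sphere_bounded_dual_weight R n 1 b.
apply: filterS (ae_sphere uniformU) => v vv; rewrite /dual_weight subrr mul0r addr0 divr1.
rewrite expr0 invr1 mul1r -vv; apply: eq_bigr => i _; exact: expr2.
Qed.

(** With b = 4 r / n the moment bound is (b / 2)^r, so the power sum contributes at most b n / 2^r,
    and n <= 2^r brings this below b. The mean is then at most (b + (r - 1) b) / r = b. *)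
Lemma dual_weight_mean r : (0 < r)%N -> (n <= 2 ^ r)%N ->
  \int[U]_v dual_weight r (4 * r%:R / n%:R) v <= 4 * r%:R / n%:R.
Proof.
move=> r0 nr; rewrite Rintegral_dual_weight.
set b : R := 4 * r%:R / n%:R.
have b0 : 0 < b by rewrite /b divr_gt0 ?mulr_gt0 ?ltr0n ?(leq_trans _ n8).
have m2 : (1 < n)%N by apply: leq_trans n8.
suff h : b ^- r.-1 * \sum_(i < n) \int[U]_v v 0 i ^+ (2 * r) <= b.
  by rewrite ler_pdivrMr ?ltr0n//; lra.
have bK : b ^- r.-1 * (n%:R * (b / 2) ^+ r) <= b.
  have bE : b ^+ r = b * b ^+ r.-1 by rewrite -exprS prednK.
  have -> : b ^- r.-1 * (n%:R * (b / 2) ^+ r) = b * (n%:R / 2 ^+ r).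
    by rewrite [(b / 2) ^+ r]expr_div_n bE; field; rewrite !expf_neq0 ?gt_eqF.
  rewrite ger_pMr//.
  by rewrite ler_pdivrMr ?exprn_gt0// mul1r -natrX ler_nat.
apply: le_trans bK; apply: ler_wpM2l; first by rewrite invr_ge0 exprn_ge0// ltW.
apply: (@le_trans _ _ (\sum_(i < n) (b / 2) ^+ r)); last first.
  by rewrite sumr_const card_ord mulr_natl.
apply: ler_sum => i _; apply: (le_trans (moment_le uniformU i m2 (leqnn r))).
rewrite le_eqVlt; apply/orP; left; apply/eqP; congr (_ ^+ _).
by rewrite natrM /b; field; rewrite gt_eqF.
Qed.

End dual_weight_mean.

Section dual_weight_choice.
Context {R : realType}.

Definition prox_norm (p n : nat) (v : 'rV[R]_n) : R :=
  if p == 1%N then \sum_(i < n) `|v 0 i| else norm2 v.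

(** For p = 2 take r = 1. For p = 1 the smallest r with n <= 2^r keeps the mean bound 4 r / n of
    order ln n / n, below rho. *)
Lemma dual_weight_exists (p n : nat) : (8 <= n)%N -> p = 1%N \/ p = 2%N ->
  exists S : 'rV[R]_n -> R,
  [/\ sphere_bounded S, signed_permutation_invariant S, forall v, 0 <= S v,
      forall v x, dot v x ^+ 2 <= S v * prox_norm p x ^+ 2 &
      forall U : probability 'rV[R]_n R, uniform_on_sphere U -> \int[U]_v S v <= rho p n].
Proof.
move=> n8 [->|->]; last first.
  exists (dual_weight 1 1); split.
  - exact: sphere_bounded_dual_weight.
  - exact: dual_weight_invariant.
  - exact: dual_weight_ge0.
  - move=> v x; rewrite /prox_norm/= norm2_sq; apply: le_trans (dot_CauchySchwarz _ _) _.
    rewrite ler_wpM2r ?dot_ge0// /dual_weight subrr mul0r addr0 divr1 expr0 invr1 mul1r.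
    by apply: ler_sum => i _; rewrite muln1 expr2.
  - by move=> U hU; rewrite dual_weight1_mean// rho2E.
have n1 : (1 < n)%N by apply: leq_trans n8.
have r0 : (0 < up_log 2 n)%N by rewrite up_log_gt0.
have n0 : 0 < n%:R :> R by rewrite ltr0n ltnW.
exists (dual_weight (up_log 2 n) (4 * (up_log 2 n)%:R / n%:R)); split.
- exact: sphere_bounded_dual_weight.
- exact: dual_weight_invariant.
- by apply: dual_weight_ge0 => //; rewrite divr_gt0 ?mulr_gt0 ?ltr0n ?(ltnW n1).
- by move=> v x; apply: dot_le_dual_weight => //; rewrite divr_gt0 ?mulr_gt0 ?ltr0n ?(ltnW n1).
- move=> U hU; apply: (le_trans (dual_weight_mean hU n8 r0 (up_logP n (isT : (1 < 2)%N)))).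
  by rewrite rho1E ler_wpM2r ?invr_ge0 ?(ltW n0)// up_log2_le_ln.
Qed.

End dual_weight_choice.

(** * The prox-function *)

Section derivative_by_sandwich.
Context {R : realType} {V : normedModType R}.

(* A function squeezed between its tangents is differentiable; this spares the
   separate treatment of the zero coordinates, where real powers are not smooth. *)
Lemma is_derive_sandwich (f : V -> R) (a v : V) (c : R -> R) :
  {for 0, continuous c} ->
  (forall h, c 0 * h <= f (h *: v + a) - f a <= c h * h) ->
  is_derive a v f (c 0).
Proof.
move=> cc fc.
have q0 : (fun h => h^-1 *: ((f \o shift a) (h *: v) - f a)) @ 0^' --> c 0.
  apply/cvgrPdist_le => e e0.
  have : \forall h \near 0^', `|c 0 - c h| <= e.
    apply: nbhs_dnbhs; move/cvgrPdist_le : cc; exact.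
  apply: filterS2 (nbhs_dnbhs_neq (0:R)) => h h0; apply: le_trans.
  rewrite /=; have /andP[] := fc h.
  set d := f _ - f a => d1 d2.
  have -> : h^-1 *: d = d / h by rewrite mulrC.
  rewrite distrC [X in _ <= X]distrC.
  have [hp|hn] := ltP 0 h.
    have c1 : c 0 <= d / h by rewrite ler_pdivlMr.
    have c2 : d / h <= c h by rewrite ler_pdivrMr.
    by rewrite !ger0_norm ?subr_ge0 ?lerD2r// (le_trans c1).
  have {}hn : h < 0 by rewrite lt_neqAle h0.
  have c1 : d / h <= c 0 by rewrite ler_ndivrMr.
  have c2 : c h <= d / h by rewrite ler_ndivlMr.
  by rewrite !ler0_norm ?subr_le0 ?lerN2 ?lerD2r// (le_trans c2).
by split; [apply/cvg_ex; exists (c 0)|exact: cvg_lim].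
Qed.

End derivative_by_sandwich.

(** * Powers of absolute values on the line *)

Section signed_power.
Context {R : realType}.
Implicit Types (a b t u k s M : R).

(** For k > 1, [k * spow (k - 1)] is the derivative of |t|^k. *)
Definition spow s t : R := Num.sg t * `|t| `^ s.

Lemma spowN s t : spow s (- t) = - spow s t.
Proof. by rewrite /spow sgrN normrN mulNr. Qed.

Lemma spow0 s : spow s 0 = 0.
Proof. by rewrite /spow sgr0 mul0r. Qed.

Lemma ge0_spow s t : s != 0 -> 0 <= t -> spow s t = t `^ s.
Proof.
move=> s0; rewrite le_eqVlt => /predU1P[<-|t0]; first by rewrite spow0 powR0.
by rewrite /spow gtr0_sg// mul1r gtr0_norm.
Qed.

Lemma norm_spow s t : s != 0 -> `|spow s t| = `|t| `^ s.
Proof.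
move=> s0; have [->|t0] := eqVneq t 0; first by rewrite spow0 !normr0 powR0.
by rewrite /spow normrM normr_sg t0 mul1r ger0_norm// powR_ge0.
Qed.

Lemma mulr_spow s t : 0 <= s -> t * spow s t = `|t| `^ (s + 1).
Proof.
move=> s0; have [->|t0] := eqVneq t 0; first by rewrite mul0r normr0 powR0// gt_eqF// ltr_wpDl.
rewrite /spow mulrA [t * _]mulrC -normrEsg.
by rewrite -(@mulr_powRB1 _ _ (s + 1)) ?addrK// ltr_wpDl.
Qed.

Lemma continuous_spow s : 0 < s -> continuous (spow s).
Proof.
move=> s0.
have pos t : 0 < t -> {for t, continuous (spow s)}.
  move=> t0; have : {for t, continuous (fun u : R => u `^ s)}.
    apply: differentiable_continuous; apply/derivable1_diffP.
    by apply: derivable_powR; rewrite in_itv /= t0.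
  rewrite /prop_for /continuous_at (ge0_spow (lt0r_neq0 s0) (ltW t0)); apply: cvg_trans.
  apply: near_eq_cvg; near=> u; rewrite ge0_spow ?gt_eqF//; apply: ltW.
  by near: u; exact: lt_nbhsr.
move=> t; have [t0|t0|<-] := ltgtP 0 t; first exact: pos.
  have -> : spow s = (fun u => - spow s u) \o -%R.
    by apply/funext => u /=; rewrite spowN opprK.
  apply: continuous_comp; first exact: opp_continuous.
  by apply: cvgN; apply: pos; rewrite oppr_gt0.
suff : spow s u @[u --> (0 : R)] --> (0 : R) by rewrite -[X in _ --> X](spow0 s).
apply/cvgrPdist_le => e e0.
have d0 : 0 < e `^ s^-1 by rewrite powR_gt0.
near=> u; have ud : `|u| < e `^ s^-1 by near: u; exact: (@nbhs0_lt R R).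
rewrite sub0r normrN norm_spow ?gt_eqF// (_ : e = (e `^ s^-1) `^ s); last first.
  by rewrite -powRrM mulVf ?gt_eqF// powRr1// ltW.
by rewrite ge0_ler_powR ?nnegrE// ltW.
Unshelve. all: by end_near. Qed.

(** Young's inequality with exponents 1 / s and 1 / (1 - s), applied to x^s and 1. *)
Lemma powR_le_tangent s x : 0 < s < 1 -> 0 <= x -> x `^ s <= s * x + (1 - s).
Proof.
move=> /andP[s0 s1] x0.
have s1' : 0 < 1 - s by rewrite subr_gt0.
have := @conjugate_powR R (x `^ s) 1 s^-1 (1 - s)^-1 (powR_ge0 _ _) ler01.
rewrite !invr_gt0 !invrK mulr1 powR1 mul1r -powRrM mulfV ?gt_eqF// powRr1// => h.
have := h s0 s1' ltac:(by ring).
by rewrite [x * s]mulrC.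
Qed.

(** Young's inequality with exponents k and k / (k - 1), applied to |b| and |a|^(k - 1), absorbs the
    mixed term; the terms in [a] combine because a times its signed power is |a|^k. *)
Lemma abs_powR_convex k a b : 1 < k ->
  `|a| `^ k + k * spow (k - 1) a * (b - a) <= `|b| `^ k.
Proof.
move=> k1; have k0 : 0 < k by apply: lt_trans k1.
have k10 : 0 < k - 1 by rewrite subr_gt0.
have := @conjugate_powR R `|b| (`|a| `^ (k - 1)) k (k / (k - 1)) (normr_ge0 _) (powR_ge0 _ _) k0
  (divr_gt0 k0 k10).
rewrite -powRrM [(k - 1) * _]mulrC divfK ?gt_eqF// => /(_ ltac:(by field; rewrite !gt_eqF)) h.
have {}h : k * (`|b| * `|a| `^ (k - 1)) <= `|b| `^ k + (k - 1) * `|a| `^ k.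
  have := ler_wpM2l (ltW k0) h; congr (_ <= _); field; by rewrite !gt_eqF.
have e : spow (k - 1) a * a = `|a| `^ k by rewrite mulrC mulr_spow ?subrK// ltW.
have : k * (spow (k - 1) a * b) <= k * (`|b| * `|a| `^ (k - 1)).
  rewrite ler_pM2l// (le_trans (ler_norm _))// normrM norm_spow ?gt_eqF// mulrC //.
have -> : k * spow (k - 1) a * (b - a) = k * (spow (k - 1) a * b) - k * (spow (k - 1) a * a) by ring.
by rewrite e; lra.
Qed.

Lemma is_derive_abs_powR k a : 1 < k ->
  is_derive a 1 (fun t : R => `|t| `^ k) (k * spow (k - 1) a).
Proof.
move=> k1; have k10 : 0 < k - 1 by rewrite subr_gt0.
have := @is_derive_sandwich R R^o (fun t : R => `|t| `^ k) a 1 (fun h => k * spow (k - 1) (h + a)).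
rewrite add0r; apply.
  apply: cvgM; first exact: cvg_cst.
  apply: (@continuous_comp _ _ _ (fun h => h + a) (spow (k - 1))).
    by apply: cvgD; [exact: cvg_id|exact: cvg_cst].
  exact: continuous_spow.
move=> h; rewrite [h%:A]mulr1.
have := abs_powR_convex a (h + a) k1; have := abs_powR_convex (h + a) a k1.
rewrite addrK (_ : a - (h + a) = - h); last by ring.
by move=> h1 h2; apply/andP; split; lra.
Qed.

(** The slope s |t|^(s - 1) is at least s M^(s - 1) on [-M, M] because s < 1. As it blows up at 0,
    the proof uses the tangents of the concave t^s on [0, M] and extends by oddness. *)
Lemma spow_increment s M u t : 0 < s < 1 -> 0 < M -> - M <= u -> u <= t -> t <= M ->
  s * M `^ (s - 1) * (t - u) <= spow s t - spow s u.
Proof.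
move=> s01 M0; have /andP[s0 s1] := s01.
have pos a b : 0 <= a -> a <= b -> b <= M -> s * M `^ (s - 1) * (b - a) <= spow s b - spow s a.
  move=> a0 ab bM; have b0 := le_trans a0 ab.
  rewrite !ge0_spow ?gt_eqF//.
  have [b00|bn] := eqVneq b 0.
    have -> : a = 0 by apply/eqP; rewrite eq_le a0 andbT -b00.
    by rewrite b00 !subrr mulr0.
  have bp : 0 < b by rewrite lt_def bn.
  have t1 : a `^ s <= b `^ s + s * b `^ (s - 1) * (a - b).
    have ab0 : 0 <= a / b by rewrite divr_ge0.
    have := ler_wpM2l (powR_ge0 b s) (powR_le_tangent s01 ab0).
    rewrite -powRM// [b * _]mulrC divfK// => /le_trans; apply.
    rewrite powRD ?bn ?implybT// powR_inv1// le_eqVlt; apply/orP; left; apply/eqP.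
    by field.
  have t2 : M `^ (s - 1) <= b `^ (s - 1).
    rewrite -[s - 1]opprK opprB !powRN lef_pV2 ?posrE ?powR_gt0//.
    by rewrite ge0_ler_powR ?subr_ge0 ?nnegrE// ltW.
  have : s * M `^ (s - 1) * (b - a) <= s * b `^ (s - 1) * (b - a).
    by rewrite ler_wpM2r ?subr_ge0// ler_pM2l.
  by lra.
move=> Mu ut tM.
have [u0|u0] := leP 0 u; first exact: pos.
have [t0|t0] := leP 0 t.
  have := pos 0 t (lexx _) t0 tM.
  have := pos 0 (- u) (lexx _) ltac:(lra) ltac:(lra).
  by rewrite spowN spow0; lra.
have := pos (- t) (- u) ltac:(lra) ltac:(lra) ltac:(lra).
by rewrite !spowN; lra.
Qed.

(** Subtracting c t^2 from |t|^k leaves a function whose derivative is nondecreasing on [-M, M], by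
    [spow_increment]; the mean value theorem then gives its tangent inequality. *)
Lemma abs_powR_strongly_convex k M a b : 1 < k < 2 -> 0 < M -> `|a| <= M -> `|b| <= M ->
  k * (k - 1) / 2 * M `^ (k - 2) * (b - a) ^+ 2 <=
  `|b| `^ k - `|a| `^ k - k * spow (k - 1) a * (b - a).
Proof.
move=> /andP[k1 k2] M0; rewrite !ler_norml => /andP[Ma aM] /andP[Mb bM].
have s01 : 0 < k - 1 < 1 by apply/andP; split; lra.
set c := k * (k - 1) / 2 * M `^ (k - 2).
pose df t := k * spow (k - 1) t - c * (2 * t).
have fd t : is_derive t 1 (fun t : R => `|t| `^ k - c * t ^+ 2) (df t).
  have h1 := is_derive_abs_powR t k1.
  have h2 : is_derive t 1 (fun t : R => c * t ^+ 2) (c * (2 * t)).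
    apply: is_derive_eq.
    by rewrite /GRing.scale /=; ring.
  exact: is_deriveB.
have mono x y : - M <= x -> x <= y -> y <= M -> df x <= df y.
  move=> Mx xy yM; have := spow_increment s01 M0 Mx xy yM.
  rewrite (_ : k - 1 - 1 = k - 2); last by ring.
  have k0 : 0 < k by lra.
  move=> /(ler_wpM2l (ltW k0)); rewrite /df /c; lra.
have cont x y : {within `[x, y], continuous (fun t : R => `|t| `^ k - c * t ^+ 2)}.
  apply: continuous_subspaceT => t; apply: differentiable_continuous.
  by apply/derivable1_diffP; exact: ex_derive.
have [ab|ba|->] := ltgtP a b; last by rewrite !subrr; lra.
  have [z] := MVT ab (fun x _ => fd x) (cont a b).
  rewrite in_itv /= => /andP[az zb] e.
  have := mono a z Ma (ltW az) (le_trans (ltW zb) bM).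
  have ba0 : 0 <= b - a by lra.
  move=> /(ler_wpM2r ba0); rewrite -e /df; lra.
have [z] := MVT ba (fun x _ => fd x) (cont b a).
rewrite in_itv /= => /andP[bz za] e.
have := mono z a (le_trans Mb (ltW bz)) (ltW za) aM.
have ab0 : 0 <= a - b by lra.
move=> /(ler_wpM2r ab0); rewrite -e /df; lra.
Qed.

End signed_power.

(** * Strong convexity of the squared k-norm *)

HB.lock Definition psum (R : realType) (n : nat) (k : R) (x : 'rV[R]_n) : R :=
  \sum_(i < n) `|x 0 i| `^ k.
HB.lock Definition knorm (R : realType) (n : nat) (k : R) (x : 'rV[R]_n) : R :=
  lnorm k x.

Section power_norm.
Context {R : realType} {n : nat}.
Variable k : R.
Hypothesis k12 : 1 < k < 2.
Implicit Types (x y v : 'rV[R]_n) (a t s : R).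

Let k1 : 1 < k. Proof. by case/andP: k12. Qed.
Let k2 : k < 2. Proof. by case/andP: k12. Qed.
Let k0 : 0 < k. Proof. exact: lt_trans k1. Qed.
Let kn0 : k != 0. Proof. by rewrite gt_eqF. Qed.

Local Notation psum := (psum k).
Local Notation knorm := (knorm k).

Let th : R := 2 / k - 1.

Let th01 : 0 < th < 1.
Proof.
rewrite /th subr_gt0 ltr_pdivlMr// mul1r k2 /= ltrBlDr ltr_pdivrMr//.
by have := k1; lra.
Qed.

Let th0 : 0 < th. Proof. by case/andP: th01. Qed.

Lemma psum_ge0 x : 0 <= psum x.
Proof. by rewrite psum.unlock; apply: sumr_ge0 => i _; exact: powR_ge0. Qed.

Lemma psum_eq0 x : psum x = 0 -> x = 0.
Proof.
rewrite psum.unlock => /eqP; rewrite psumr_eq0; last by move=> i _; exact: powR_ge0.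
move=> /allP h; apply/rowP => i; have := h i (mem_index_enum _).
by rewrite /= powR_eq0 normr_eq0 mxE => /andP[/eqP].
Qed.

Lemma knorm_psum x : knorm x = psum x `^ k^-1.
Proof. by rewrite knorm.unlock psum.unlock. Qed.

Lemma knorm_ge0 x : 0 <= knorm x.
Proof. by rewrite knorm_psum powR_ge0. Qed.

Lemma knorm_sqr x : knorm x ^+ 2 = psum x `^ (2 / k).
Proof. by rewrite knorm_psum -powR_mulrn ?powR_ge0// -powRrM mulrC. Qed.

Lemma knorm_powR x : knorm x `^ k = psum x.
Proof. by rewrite knorm_psum -powRrM mulVf// powRr1// psum_ge0. Qed.

Lemma knormZ a x : knorm (a *: x) = `|a| * knorm x.
Proof.
rewrite !knorm_psum; have -> : psum (a *: x) = `|a| `^ k * psum x.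
  by rewrite psum.unlock mulr_sumr; apply: eq_bigr => i _; rewrite mxE normrM powRM.
by rewrite powRM ?powR_ge0 ?psum_ge0// -powRrM divff// powRr1.
Qed.

Definition grad_sqr_knorm x : 'rV[R]_n :=
  \row_i (2 * psum x `^ th * spow (k - 1) (x 0 i)).

(** The squared norm is [psum] composed with the convex power 2 / k > 1, whose slope at [psum x]
    transmits any surplus [Q] in the tangent inequality of [psum]. *)
Lemma sqr_knorm_ge_linear x y (Q : R) :
  Q + k * \sum_(i < n) spow (k - 1) (x 0 i) * (y 0 i - x 0 i) <= psum y - psum x ->
  2 / k * psum x `^ th * Q <=
  knorm y ^+ 2 - knorm x ^+ 2 - dot (grad_sqr_knorm x) (y - x).
Proof.
move=> hQ; rewrite (knorm_sqr x) (knorm_sqr y).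
have q1 : 1 < 2 / k by rewrite ltr_pdivlMr// mul1r.
have := abs_powR_convex (psum x) (psum y) q1.
rewrite !ger0_norm ?psum_ge0// ge0_spow ?psum_ge0 ?gt_eqF ?subr_gt0// -/th => h.
have -> : dot (grad_sqr_knorm x) (y - x) =
    2 / k * psum x `^ th * (k * \sum_(i < n) spow (k - 1) (x 0 i) * (y 0 i - x 0 i)).
  rewrite (_ : forall a b : R, 2 / k * a * (k * b) = 2 * a * b); last by move=> a b; field.
  rewrite mulr_sumr; by apply: eq_bigr => i _; rewrite !mxE mulrA.
have c0 : 0 <= 2 / k * psum x `^ th by rewrite mulr_ge0 ?powR_ge0// ltW// divr_gt0.
rewrite lerBrDr -mulrDr; apply: le_trans (ler_wpM2l c0 hQ) _.
by rewrite lerBrDl.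
Qed.

Lemma sqr_knorm_convex x y :
  knorm x ^+ 2 + dot (grad_sqr_knorm x) (y - x) <= knorm y ^+ 2.
Proof.
have := @sqr_knorm_ge_linear x y 0; rewrite mulr0 add0r => h.
rewrite -subr_ge0 opprD addrA; apply: h.
rewrite psum.unlock mulr_sumr -sumrB; apply: ler_sum => i _.
by have := abs_powR_convex (x 0 i) (y 0 i) k1; lra.
Qed.

(** Euler's identity for a function homogeneous of degree 2. *)
Lemma dot_grad_sqr_knorm_self x : dot (grad_sqr_knorm x) x = 2 * knorm x ^+ 2.
Proof.
rewrite knorm_sqr -mulr_powRB1 ?psum_ge0 ?divr_gt0// -/th.
rewrite [psum x * _]mulrC mulrA; rewrite {2}psum.unlock mulr_sumr; apply: eq_bigr => i _.
by rewrite mxE -mulrA [spow _ _ * _]mulrC mulr_spow ?subrK// subr_ge0 ltW.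
Qed.

(** Hoelder's inequality, obtained here from convexity at the multiple of [y] that has the norm of
    [x]. *)
Lemma dot_grad_sqr_knorm_le x y :
  dot (grad_sqr_knorm x) y <= 2 * knorm x * knorm y.
Proof.
have zero v : knorm v = 0 -> v = 0.
  by rewrite knorm_psum => /powR_eq0_eq0; exact: psum_eq0.
have [y0|yn] := eqVneq (knorm y) 0.
  rewrite (zero _ y0) -{1}(scale0r (0 : 'rV_n)) dotZr mul0r.
  by rewrite !mulr_ge0// knorm_ge0.
have [x0|xn] := eqVneq (knorm x) 0.
  rewrite x0 mulr0 mul0r (zero _ x0) /dot big1// => i _.
  by rewrite !mxE spow0 mulr0 mul0r.
have yp : 0 < knorm y by rewrite lt_def yn knorm_ge0.
have xp : 0 < knorm x by rewrite lt_def xn knorm_ge0.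
pose l := knorm x / knorm y; have lp : 0 < l by rewrite divr_gt0.
have := sqr_knorm_convex x (l *: y).
rewrite dotBr dot_grad_sqr_knorm_self dotZr knormZ gtr0_norm// {2}/l divfK//.
rewrite gerDl subr_le0 => h; rewrite -(ler_pM2l lp); apply: le_trans h _.
by rewrite le_eqVlt /l; apply/orP; left; apply/eqP; field.
Qed.

Lemma is_derive_sqr_knorm x i :
  is_derive x (delta_mx 0 i) (fun v => knorm v ^+ 2) (grad_sqr_knorm x 0 i).
Proof.
(* The partial derivative along the line. With [spow th] as outer power, [continuous_spow] also
   covers the points where the sum vanishes. *)
pose c s := 2 * spow th (\sum_(j < n) `|s * (j == i)%:R + x 0 j| `^ k) * spow (k - 1) (s + x 0 i).
have cE s : c s = grad_sqr_knorm (s *: delta_mx 0 i + x) 0 i.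
  rewrite !mxE !eqxx mulr1; congr (_ * _ * _).
  rewrite -ge0_spow ?gt_eqF//; last exact: psum_ge0.
  by rewrite psum.unlock; congr spow; apply: eq_bigr => j _; rewrite !mxE eqxx.
have -> : grad_sqr_knorm x 0 i = c 0 by rewrite cE scale0r add0r.
apply: is_derive_sandwich.
  have cD (b : R) : {for 0, continuous (fun s : R => s * b + x 0 i)}.
    by apply: cvgD; [apply: cvgMl; exact: cvg_id|exact: cvg_cst].
  apply: cvgM; last first.
    apply: (@continuous_comp _ _ _ (fun s => s + x 0 i) (spow (k - 1))).
      by apply: cvgD; [exact: cvg_id|exact: cvg_cst].
    by apply: continuous_spow; rewrite subr_gt0.
  apply: cvgM; first exact: cvg_cst.
  apply: (@continuous_comp _ _ _ (fun s => \sum_(j < n) `|s * (j == i)%:R + x 0 j| `^ k) (spow th)); last exact: continuous_spow.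
  apply: cvg_big => [|j _]; first exact: add_continuous.
  apply: (@continuous_comp _ _ _ (fun s => s * (j == i)%:R + x 0 j) (fun t : R => `|t| `^ k)).
    by apply: cvgD; [apply: cvgMl; exact: cvg_id|exact: cvg_cst].
  apply: differentiable_continuous; apply/derivable1_diffP.
  have h := is_derive_abs_powR (0 * (j == i)%:R + x 0 j) k1; exact: ex_derive.
move=> s; rewrite !cE scale0r add0r.
have := sqr_knorm_convex x (s *: delta_mx 0 i + x).
have := sqr_knorm_convex (s *: delta_mx 0 i + x) x.
rewrite addrK (_ : x - (s *: delta_mx 0 i + x) = (- s) *: delta_mx 0 i); last first.
  by rewrite opprD addrCA subrr addr0 scaleNr.
by rewrite !dotZr !dot_delta => h1 h2; apply/andP; split; lra.
Qed.

(** Sum the tangent inequalities of the concave power at the mean of the [u i]. *)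
Lemma power_mean (e : R) (u : 'I_n -> R) : 0 < e < 1 -> (forall i, 0 <= u i) ->
  \sum_(i < n) u i `^ e <= n%:R `^ (1 - e) * (\sum_(i < n) u i) `^ e.
Proof.
move=> e01 u0; have /andP[e0 e1] := e01.
have W0 : 0 <= \sum_(i < n) u i by exact: sumr_ge0.
have [W00|Wn] := eqVneq (\sum_(i < n) u i) 0.
  rewrite W00 powR0 ?gt_eqF// mulr0 big1// => i _.
  move/eqP: W00; rewrite psumr_eq0// => /allP/(_ i (mem_index_enum _)) /eqP ->.
  by rewrite powR0// gt_eqF.
set W := \sum_(i < n) u i in W0 Wn *.
have Wp : 0 < W by rewrite lt_def Wn.
have n0 : 0 < n%:R :> R.
  rewrite ltr0n lt0n; apply: contra_neq Wn => n0; rewrite /W.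
  by apply: big1 => i _; have := leq_ltn_trans (leq0n _) (ltn_ord i); rewrite n0.
have Wn0 : 0 < W / n%:R by rewrite divr_gt0.
have step i : u i `^ e <= (W / n%:R) `^ e * (e * (u i / (W / n%:R)) + (1 - e)).
  have v0 : 0 <= u i / (W / n%:R) by rewrite divr_ge0// ltW.
  have := ler_wpM2l (powR_ge0 (W / n%:R) e) (powR_le_tangent e01 v0).
  by rewrite -powRM ?(ltW Wn0)// mulrCA divff ?gt_eqF// mulr1.
apply: (le_trans (ler_sum _ (fun i _ => step i))).
rewrite -mulr_sumr big_split /= sumr_const card_ord -mulr_sumr -mulr_suml -/W.
have -> : e * (W / (W / n%:R)) + (1 - e) *+ n = n%:R.
  by rewrite -[_ *+ n]mulr_natr; field; rewrite !gt_eqF.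
rewrite powRM ?invr_ge0 ?(ltW n0) ?(ltW Wp)// -powR_inv1 ?(ltW n0)// -powRrM mulN1r.
have -> : n%:R `^ (1 - e) = n%:R * n%:R `^ (- e) :> R.
  by rewrite powRD ?(gt_eqF n0) ?implybT// powRr1// ltW.
by rewrite le_eqVlt; apply/orP; left; apply/eqP; ring.
Qed.

Lemma sum_norm_le_knorm v :
  \sum_(i < n) `|v 0 i| <= n%:R `^ (1 - k^-1) * knorm v.
Proof.
have e01 : 0 < k^-1 < 1 by rewrite invr_gt0 k0 invf_lt1.
have := @power_mean _ (fun i => `|v 0 i| `^ k) e01 (fun i => powR_ge0 _ _).
by under eq_bigr do rewrite -powRrM divff// powRr1//; rewrite knorm_psum psum.unlock.
Qed.

(** The surplus of each |t|^k, at the scale m_i = max(|x_i|, |y_i|), becomes a squared 1-norm by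
    Cauchy-Schwarz. The sum of the m_i^(2 - k) must then be controlled by a power of [psum x], which
    fails when [y] is much larger than [x]. *)
Let strong_near x y : knorm y < 3 * knorm x ->
  (k - 1) / 4 * (\sum_(i < n) `|(y - x) 0 i|) ^+ 2 <=
  n%:R `^ (2 * (1 - k^-1)) *
    (knorm y ^+ 2 - knorm x ^+ 2 - dot (grad_sqr_knorm x) (y - x)).
Proof.
move=> yx; pose m i := Num.max `|x 0 i| `|y 0 i|.
have m0 i : 0 <= m i by rewrite le_max normr_ge0.
have xm i : `|x 0 i| <= m i by rewrite le_max lexx.
have ym i : `|y 0 i| <= m i by rewrite le_max lexx orbT.
pose d i := (y - x) 0 i.
have dm i : m i = 0 -> d i = 0.
  move=> mi; have := xm i; have := ym i; rewrite mi !normr_le0 => /eqP yi /eqP xi.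
  by rewrite /d !mxE yi xi subrr.
pose Q0 := \sum_(i < n) m i `^ (k - 2) * d i ^+ 2.
have hQ : 2 / k * psum x `^ th * (k * (k - 1) / 2 * Q0) <=
    knorm y ^+ 2 - knorm x ^+ 2 - dot (grad_sqr_knorm x) (y - x).
  apply: sqr_knorm_ge_linear; rewrite psum.unlock !mulr_sumr -big_split -sumrB /=.
  apply: ler_sum => i _; have [mi|mi] := eqVneq (m i) 0.
    have := xm i; have := ym i; rewrite mi !normr_le0 (dm _ mi) => /eqP -> /eqP ->.
    by rewrite spow0 !subrr expr0n /= !mulr0 addr0.
  have mp : 0 < m i by rewrite lt_def mi m0.
  have := abs_powR_strongly_convex k12 mp (xm i) (ym i).
  by rewrite /d !mxE; lra.
(* Cauchy-Schwarz with the weights m_i^((k - 2) / 2) and their inverses; where m_i = 0 the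
   difference d_i vanishes as well. *)
have CS : (\sum_(i < n) `|d i|) ^+ 2 <= Q0 * \sum_(i < n) m i `^ (2 - k).
  pose u : 'rV[R]_n := \row_i (`|d i| * m i `^ ((k - 2) / 2)).
  pose w : 'rV[R]_n := \row_i m i `^ ((2 - k) / 2).
  have sq t : t + t = t * 2%:R by ring.
  have half e t : (t `^ (e / 2)) * (t `^ (e / 2)) = t `^ e.
    by rewrite -expr2 -powR_mulrn ?powR_ge0// -powRrM divfK.
  have := dot_CauchySchwarz u w.
  have -> : dot u w = \sum_(i < n) `|d i|.
    apply: eq_bigr => i _; rewrite !mxE; have [mi|mi] := eqVneq (m i) 0.
      by rewrite (dm _ mi) normr0 !mul0r.
    by rewrite -mulrA -powRD ?mi ?implybT// -mulrDl subrKA subrr mul0r powRr0 mulr1.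
  have -> : dot u u = Q0.
    by apply: eq_bigr => i _; rewrite !mxE mulrACA half -expr2 real_normK ?num_real// mulrC.
  have -> : dot w w = \sum_(i < n) m i `^ (2 - k).
    by apply: eq_bigr => i _; rewrite !mxE half.
  by [].
(* The 4 comes from 1 + 3^k <= 4^k; raised to the power [th] it costs 4^(2 - k) <= 4, which the
   quarter in the conclusion compensates. *)
have W4 : \sum_(i < n) m i `^ k <= 4 `^ k * psum x.
  have psy : psum y <= 3 `^ k * psum x.
    rewrite -!knorm_powR -powRM ?knorm_ge0//.
    by rewrite ge0_ler_powR ?nnegrE ?mulr_ge0 ?knorm_ge0 ?ltW.
  have s1 : \sum_(i < n) m i `^ k <= psum x + psum y.
    rewrite psum.unlock -big_split /=; apply: ler_sum => i _.
    have a0 := powR_ge0 `|x 0 i| k; have b0 := powR_ge0 `|y 0 i| k.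
    have [h|h] := leP `|x 0 i| `|y 0 i|; first by rewrite /m (max_r h) lerDr.
    by rewrite /m (max_l (ltW h)) lerDl.
  have s2 : 1 + 3 `^ k <= 4 `^ k :> R.
    have k10 : 0 <= k - 1 by rewrite subr_ge0 ltW.
    have a1 : 1 <= 4 `^ (k - 1) :> R by rewrite -[leLHS](powRr0 (4 : R)); apply: ler_powR => //; lra.
    have a2 : 3 `^ (k - 1) <= 4 `^ (k - 1) :> R by apply: ge0_ler_powR => //; rewrite ?nnegrE; lra.
    have e3 : 3 `^ k = 3 * 3 `^ (k - 1) :> R by rewrite mulr_powRB1.
    have e4 : 4 `^ k = 4 * 4 `^ (k - 1) :> R by rewrite mulr_powRB1.
    move: a1 a2; rewrite e3 e4; move: (3 `^ (k - 1)) (4 `^ (k - 1)) => b c; lra.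
  by have := ler_wpM2r (psum_ge0 x) s2; rewrite mulrDl mul1r; lra.
have M4 : \sum_(i < n) m i `^ (2 - k) <= n%:R `^ (2 * (1 - k^-1)) * (4 * psum x `^ th).
  have := @power_mean th (fun i => m i `^ k) th01 (fun i => powR_ge0 _ _).
  have kth : k * th = 2 - k by rewrite /th; field.
  under eq_bigr do rewrite -powRrM kth.
  have -> : 1 - th = 2 * (1 - k^-1) by rewrite /th; ring.
  move=> /le_trans; apply; rewrite ler_wpM2l ?powR_ge0//.
  apply: (@le_trans _ _ ((4 `^ k * psum x) `^ th)).
    by rewrite ge0_ler_powR ?nnegrE ?mulr_ge0 ?powR_ge0 ?psum_ge0 ?(ltW th0)//; apply: sumr_ge0 => i _; rewrite powR_ge0.
  rewrite powRM ?powR_ge0 ?psum_ge0// ler_wpM2r ?powR_ge0// -powRrM kth.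
  by rewrite -[leRHS]powRr1// ler_powR//; have := k1; lra.
have Q00 : 0 <= Q0 by apply: sumr_ge0 => i _; rewrite mulr_ge0 ?powR_ge0 ?sqr_ge0.
have K0 : 0 <= (k - 1) / 4 by rewrite divr_ge0// subr_ge0 ltW.
have := ler_wpM2l K0 (le_trans CS (ler_wpM2l Q00 M4)).
move=> /le_trans; apply.
have := ler_wpM2l (powR_ge0 n%:R (2 * (1 - k^-1))) hQ; apply: le_trans.
rewrite le_eqVlt; apply/orP; left; apply/eqP; field; exact: kn0.
Qed.

(** When [y] dominates, Hoelder bounds the surplus below by (|y| - |x|)^2, while |y - x| <= |y| +
    |x| <= 2 (|y| - |x|) in the k-norm. *)
Let strong_far x y : 3 * knorm x <= knorm y ->
  (k - 1) / 4 * (\sum_(i < n) `|(y - x) 0 i|) ^+ 2 <=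
  n%:R `^ (2 * (1 - k^-1)) *
    (knorm y ^+ 2 - knorm x ^+ 2 - dot (grad_sqr_knorm x) (y - x)).
Proof.
move=> xy.
have x0 := knorm_ge0 x; have y0 := knorm_ge0 y.
have h : (knorm y - knorm x) ^+ 2 <=
    knorm y ^+ 2 - knorm x ^+ 2 - dot (grad_sqr_knorm x) (y - x).
  by rewrite dotBr dot_grad_sqr_knorm_self; have := dot_grad_sqr_knorm_le x y; rewrite sqrrB; lra.
have := ler_wpM2l (powR_ge0 n%:R (2 * (1 - k^-1))) h; apply: le_trans.
have -> : n%:R `^ (2 * (1 - k^-1)) = (n%:R `^ (1 - k^-1)) ^+ 2 :> R.
  by rewrite -powR_mulrn ?powR_ge0// -powRrM mulrC.
rewrite -exprMn; set s := \sum_(i < n) _.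
have s0 : 0 <= s by exact: sumr_ge0.
set c := n%:R `^ (1 - k^-1).
have c0 : 0 <= c by exact: powR_ge0.
have s2 : s <= 2 * (c * (knorm y - knorm x)).
  apply: (@le_trans _ _ (c * knorm y + c * knorm x)).
    apply: (@le_trans _ _ (\sum_(i < n) `|y 0 i| + \sum_(i < n) `|x 0 i|)).
      by rewrite -big_split; apply: ler_sum => i _; rewrite !mxE ler_normB.
    by apply: lerD; exact: sum_norm_le_knorm.
  by have := ler_wpM2l c0 xy; lra.
have := lerXn2r 2 _ _ s2; rewrite !nnegrE => /(_ s0 (le_trans s0 s2)).
rewrite exprMn => s3.
have kk : (k - 1) * s ^+ 2 <= s ^+ 2 by rewrite ler_piMl ?sqr_ge0//; have := k2; lra.
have -> : (k - 1) / 4 * s ^+ 2 = ((k - 1) * s ^+ 2) / 4 by field.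
by rewrite ler_pdivrMr//; lra.
Qed.

(** Compared with the classical constant k - 1, the quarter pays for the case distinction. *)
Lemma sqr_knorm_strongly_convex x y :
  (k - 1) / 4 * (\sum_(i < n) `|(y - x) 0 i|) ^+ 2 <=
  n%:R `^ (2 * (1 - k^-1)) *
    (knorm y ^+ 2 - knorm x ^+ 2 - dot (grad_sqr_knorm x) (y - x)).
Proof. by have [/strong_far|/strong_near] := leP (3 * knorm x) (knorm y). Qed.

End power_norm.

(** * First-order optimality and the two prox-functions *)

Section first_order_optimality.
Context {R : realType} {n : nat}.
Implicit Types (x y v : 'rV[R]_n) (d : 'rV[R]_n -> R).

Lemma bregman_minimizer d x xp v :
  (forall i, derivable d xp (delta_mx 0 i)) ->
  is_minimizer (fun y => dot v (y - x) + bregman d x y) xp ->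
  gradient d xp = gradient d x - v.
Proof.
move=> dd xpmin; apply/rowP => i; rewrite !mxE.
pose q h : R := h^-1 * (d (h *: delta_mx 0 i + xp) - d xp).
have /cvg_ex[D qD] := dd i.
have -> : 'D_(delta_mx 0 i) d xp = D by exact: cvg_lim qD.
(* Both signs are needed: minimality, in the form [key], bounds the quotient at [r] from below and
   the one at [- r] from above. *)
have near_q e : 0 < e -> exists2 r, 0 < r & `|D - q r| < e /\ `|D - q (- r)| < e.
  move=> e0; have /cvgrPdist_lt/(_ e e0)/nbhs_ballP[r r0 Br] := qD.
  have r2 : 0 < r / 2 by rewrite divr_gt0.
  exists (r / 2) => //; split; apply: Br.
  - by rewrite /ball/= sub0r normrN gtr0_norm// ltr_pdivrMr//; lra.
  - by rewrite gt_eqF.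
  - by rewrite /ball/= sub0r opprK gtr0_norm// ltr_pdivrMr//; lra.
  - by rewrite oppr_eq0 gt_eqF.
have key h : h * (gradient d x 0 i - v 0 i) <= d (h *: delta_mx 0 i + xp) - d xp.
  have := xpmin (h *: delta_mx 0 i + xp); rewrite /bregman -[_ + xp - x]addrA.
  rewrite !dotDr !dotZr !dot_delta; lra.
set g := gradient d x 0 i - v 0 i in key.
suff -> : D = g by rewrite /g mxE.
apply/eqP; rewrite eq_le; apply/andP; split; rewrite leNgt; apply/negP => Dg.
- have [r r0 [_]] := near_q (D - g) ltac:(by rewrite subr_gt0).
  apply/negP; rewrite -leNgt; apply: le_trans (ler_norm _); rewrite lerD2l lerN2.
  by rewrite /q invrN mulNr lerNl ler_pdivlMl// mulrN -mulNr.
- have [r r0 [+ _]] := near_q (g - D) ltac:(by rewrite subr_gt0).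
  apply/negP; rewrite -leNgt distrC; apply: le_trans (ler_norm _); rewrite lerD2r.
  by rewrite /q ler_pdivlMl.
Qed.

End first_order_optimality.

Section prox_function.
Context {R : realType} {n : nat}.
Hypothesis n8 : (8 <= n)%N.
Implicit Types (x y v : 'rV[R]_n).

Let l8 : 3 / 2 <= ln n%:R :> R := ln_nat_ge n8.
Let l0 : 0 < ln n%:R :> R. Proof. by have := l8; lra. Qed.
Let kappa : R := 1 + (ln n%:R)^-1.

Let kappa12 : 1 < kappa < 2.
Proof.
rewrite ltrDl invr_gt0 l0 /= -ltrBrDl (_ : 2 - 1 = 1) ?invf_lt1//; last by ring.
by have := l8; lra.
Qed.

Let C : R := 2^-1 * expR 1 * n%:R `^ ((kappa - 1) * (2 - kappa) / kappa) * ln n%:R.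

Let prox1E x : prox 1 x = C * knorm kappa x ^+ 2.
Proof. by rewrite knorm.unlock. Qed.

Let C_ge0 : 0 <= C.
Proof. by rewrite !mulr_ge0 ?powR_ge0 ?expR_ge0 ?invr_ge0// ltW. Qed.

Let prox1_is_derive x i :
  is_derive x (delta_mx 0 i) (@prox R 1 n) (C * grad_sqr_knorm kappa x 0 i).
Proof.
have -> : @prox R 1 n = C *: (fun v : 'rV[R]_n => knorm kappa v ^+ 2 : R^o).
  by apply/funext => v; rewrite prox1E.
apply: is_deriveZ; exact: is_derive_sqr_knorm.
Qed.

(** The choice of kappa pays off here: exp(1) = n^(kappa - 1) and (kappa - 1) ln n = 1, so the
    scaling of the prox-function cancels the power of n lost between the 1-norm and the
    kappa-norm. *)
Let scaleE : C * ((kappa - 1) / 4) = 8^-1 * n%:R `^ (2 * (1 - kappa^-1)).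
Proof.
have n0 : 0 < n%:R :> R by rewrite ltr0n (leq_trans _ n8).
have k0 : kappa != 0 by case/andP: kappa12 => k1 _; rewrite gt_eqF// (lt_trans _ k1).
have e1 : expR 1 = n%:R `^ (kappa - 1) :> R.
  by rewrite /powR gt_eqF// /kappa addrC addKr mulVf// gt_eqF.
rewrite /C e1 (_ : 2 * (1 - kappa^-1) = (kappa - 1) + (kappa - 1) * (2 - kappa) / kappa); last by field.
rewrite (@powRD _ _ (kappa - 1)) ?(gt_eqF n0) ?implybT//.
have kl : (kappa - 1) * ln n%:R = 1 by rewrite /kappa addrC addKr mulVf// gt_eqF.
set a := _ `^ (kappa - 1); set b := _ `^ _.
transitivity (8^-1 * (a * b) * ((kappa - 1) * ln n%:R)); last by rewrite kl mulr1.
by field.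
Qed.

Let prox1_gradient x : gradient (@prox R 1 n) x = C *: grad_sqr_knorm kappa x.
Proof. by apply/rowP => i; rewrite !mxE; have [_ ->] := prox1_is_derive x i; rewrite mxE. Qed.

Let prox2E x : prox 2 x = 2^-1 * dot x x.
Proof. by rewrite /prox/= norm2_sq. Qed.

Let prox2_is_derive x i : is_derive x (delta_mx 0 i) (@prox R 2 n) (x 0 i).
Proof.
have := @is_derive_sandwich R _ (@prox R 2 n) x (delta_mx 0 i) (fun s => s + x 0 i).
rewrite add0r; apply; first by apply: cvgD; [exact: cvg_id|exact: cvg_cst].
move=> s; rewrite !prox2E !dotDr !dotDl !dotZr !dotZl !dot_delta (dotC _ x) dot_delta.
have -> : (delta_mx 0 i : 'rV[R]_n) 0 i = 1 by rewrite mxE !eqxx.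
by have := sqr_ge0 s; rewrite expr2 => h; apply/andP; split; lra.
Qed.

Let prox2_gradient x : gradient (@prox R 2 n) x = x.
Proof. by apply/rowP => i; rewrite !mxE; have [_ ->] := prox2_is_derive x i. Qed.

Variable p : nat.
Hypothesis p12 : p = 1%N \/ p = 2%N.

Lemma derivable_prox x i : derivable (@prox R p n) x (delta_mx 0 i).
Proof.
case: p12 => ->; first by have [] := prox1_is_derive x i.
by have [] := prox2_is_derive x i.
Qed.

Lemma bregman_prox_ge x y :
  prox_norm p (y - x) ^+ 2 / 8 <= bregman (@prox R p n) x y.
Proof.
case: p12 => ->; rewrite /bregman /prox_norm /=.
  rewrite prox1_gradient dotZl !prox1E -!mulrBr.
  have n0 : 0 < n%:R `^ (2 * (1 - kappa^-1)) :> R.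
    by rewrite powR_gt0// ltr0n (leq_trans _ n8).
  have h := ler_wpM2l C_ge0 (sqr_knorm_strongly_convex kappa12 x y).
  rewrite -(ler_pM2l n0) [leRHS]mulrCA; apply: le_trans h.
  rewrite [leRHS]mulrA scaleE le_eqVlt; apply/orP; left; apply/eqP; ring.
rewrite prox2_gradient !prox2E norm2_sq dotBl !dotBr (dotC y x).
have := dot_ge0 (y - x); rewrite dotBl !dotBr (dotC y x); lra.
Qed.

Lemma dot_le_prox_norm v : dot v v <= prox_norm p v ^+ 2.
Proof.
case: p12 => ->; rewrite /prox_norm /=; last by rewrite norm2_sq.
rewrite expr2 mulr_suml; apply: ler_sum => i _.
rewrite -[leLHS]ger0_norm -?expr2 ?sqr_ge0// normrX expr2 ler_wpM2l//.
by rewrite (bigD1 i)//= lerDl sumr_ge0.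
Qed.

Lemma measurable_prox : measurable_fun setT (@prox R p n).
Proof.
case: p12 => ->.
  rewrite /prox /= /lnorm; apply: measurable_funM => //; apply: measurable_funX.
  apply: (measurableT_comp (measurable_powR _)); apply: measurable_sum => i.
  apply: (measurableT_comp (measurable_powR _)).
  by apply: measurableT_comp => //; exact: measurable_coord.
have -> : @prox R 2 n = fun v => 2^-1 * dot v v by apply/funext => v; exact: prox2E.
by apply: measurable_funM => //; exact: measurable_dot.
Qed.

End prox_function.

(** * Taylor bounds for Lipschitz gradients *)

Section lipschitz_gradient.
Context {R : realType} {n : nat}.
Implicit Types (x y v : 'rV[R]_n) (f : 'rV[R]_n -> R).

Lemma derive_gradient f x v : differentiable f x -> 'D_v f x = dot (gradient f x) v.
Proof.
move=> df; rewrite deriveE// {1}(row_sum_delta v) linear_sum.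
by apply: eq_bigr => i _; rewrite linearZ /= -deriveE// mulrC mxE.
Qed.

Lemma is_derive_line f x v (s D : R) : is_derive (s *: v + x) v f D ->
  is_derive s 1 (fun s : R => f (s *: v + x) : R) D.
Proof.
move=> [df Df]; have E : (fun h => h^-1 *: ((f \o shift (s *: v + x)) (h *: v) - f (s *: v + x)) : R) =
    (fun h => h^-1 *: (((fun s : R => f (s *: v + x)) \o shift s) (h *: (1 : R)) - f (s *: v + x))).
  apply/funext => h; congr (_ *: (f _ - _)).
  by rewrite /= [h *: 1]mulr1 scalerDl addrA.
split; first by rewrite /derivable -E.
by rewrite /derive -E.
Qed.

(* The mean value theorem costs a factor 2 compared with integration of the
   gradient; the constants of the theorem leave room for it. *)
Lemma taylor_lipschitz_gradient f (G : 'rV[R]_n -> 'rV[R]_n) (K : R) :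
  (forall x, has_gradient f x (G x)) ->
  (forall x y, norm2 (G x - G y) <= K * norm2 (x - y)) ->
  forall x y, `|f y - f x - dot (G x) (y - x)| <= `|K| * dot (y - x) (y - x).
Proof.
move=> fG GK x y; set v := y - x.
have dline (s : R) : is_derive s (1 : R) (fun s : R => f (s *: v + x) : R) (dot (G (s *: v + x)) v).
  apply: is_derive_line; have [df <-] := fG (s *: v + x).
  by split; [exact: diff_derivable|exact: derive_gradient].
have cont : {within `[0, 1], continuous (fun s : R => f (s *: v + x) : R)}.
  apply: continuous_subspaceT => s; apply: differentiable_continuous.
  by apply/derivable1_diffP; exact: ex_derive.
have [s] := MVT ltr01 (fun s _ => dline s) cont.
rewrite in_itv /= => /andP[s0 s1].
rewrite subr0 mulr1 scale1r scale0r add0r subrK => ->.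
rewrite -dotBl (le_trans (dot_norm2 _ _))//.
have nv := norm2_ge0 v.
apply: (@le_trans _ _ (`|K| * norm2 v * norm2 v)).
  rewrite ler_wpM2r//; apply: le_trans (GK _ _) _.
  rewrite addrK; have -> : norm2 (s *: v) = s * norm2 v.
    by rewrite /norm2 dotZl dotZr mulrA -expr2 sqrtrM ?sqr_ge0// sqrtr_sqr gtr0_norm.
  have h : s * norm2 v <= norm2 v by rewrite ler_piMl// ltW.
  apply: le_trans (ler_wpM2r _ (ler_norm K)) _; first by rewrite mulr_ge0// ltW.
  by rewrite ler_wpM2l.
by rewrite -mulrA -expr2 norm2_sq.
Qed.

Lemma continuous_coordB (x0 : 'rV[R]_n) i : continuous (fun y => (y - x0) 0 i).
Proof.
have -> : (fun y => (y - x0) 0 i) = (fun y => y 0 i - x0 0 i).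
  by apply/funext => y; rewrite !mxE.
by move=> y; apply: continuousB; [exact: coord_continuous|exact: cst_continuous].
Qed.

Lemma continuous_dot (F G : 'rV[R]_n -> 'rV[R]_n) :
  (forall i, continuous (fun y => F y 0 i)) -> (forall i, continuous (fun y => G y 0 i)) ->
  continuous (fun y => dot (F y) (G y)).
Proof.
move=> cF cG; apply: continuous_big => [|i _ y]; first exact: add_continuous.
by apply: continuousM; [exact: cF|exact: cG].
Qed.

Lemma continuous_quadratic_sandwich f v (K : R) x :
  (forall y, `|f y - f x - dot v (y - x)| <= K * dot (y - x) (y - x)) ->
  {for x, continuous f}.
Proof.
move=> h.
have c1 : continuous (fun y => dot v (y - x)).
  apply: (@continuous_dot (fun=> v) (fun y => y - x)) => i; first exact: cst_continuous.
  exact: continuous_coordB.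
have c2 : continuous (fun y => K * dot (y - x) (y - x)).
  move=> y; apply: (@continuousM R _ (fun=> K) (fun y => dot (y - x) (y - x)) y).
    exact: cst_continuous.
  by apply: (@continuous_dot (fun y => y - x) (fun y => y - x)) => i; exact: continuous_coordB.
have z : (x - x : 'rV[R]_n) = 0 by rewrite subrr.
have d0 u : dot u (0 : 'rV[R]_n) = 0 by rewrite /dot big1// => i _; rewrite mxE mulr0.
have cl : {for x, continuous (fun y => f x + dot v (y - x) - K * dot (y - x) (y - x))}.
  apply: continuousB; last exact: c2.
  by apply: continuousD; [exact: cst_continuous|exact: c1].
have cu : {for x, continuous (fun y => f x + dot v (y - x) + K * dot (y - x) (y - x))}.
  apply: continuousD; last exact: c2.
  by apply: continuousD; [exact: cst_continuous|exact: c1].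
rewrite /prop_for /continuous_at z !d0 mulr0 subr0 addr0 in cl.
rewrite /prop_for /continuous_at z !d0 mulr0 !addr0 in cu.
rewrite /prop_for /continuous_at.
apply: (squeeze_cvgr _ cl cu); apply: nearW => y.
by have := h y; rewrite ler_norml => /andP[h1 h2]; apply/andP; split; lra.
Qed.

End lipschitz_gradient.

(** * The stochastic objective *)

Section objective_theory.
Local Open Scope convex_scope.
Context {R : realType} {n : nat} {d : measure_display} {X : measurableType d}.
Variables (P : probability X R) (F : 'rV[R]_n -> X -> R) (g : 'rV[R]_n -> X -> 'rV[R]_n).
Variables (L : X -> R) (L2 sigma : R).
Hypothesis pb : problem_assumptions P F g L L2 sigma.
Implicit Types (x y u v : 'rV[R]_n).

Let f := objective P F.

(** This vector acts as the gradient of [f] through [objective_taylor] and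
    [objective_subgradient]. *)
Definition mean_gradient x : 'rV[R]_n := \row_i \int[P]_xi g x xi 0 i.

Let mF x : measurable_fun setT (F x).
Proof.
have /= := measurableT_comp (measurable_F pb) (measurable_fun_pair (@measurable_cst _ _ X _ setT x) (@measurable_id _ X setT)).
by [].
Qed.

Lemma measurable_sample_gradient x : measurable_fun setT (g x).
Proof.
exact: measurableT_comp (measurable_g pb) (measurable_fun_pair (@measurable_cst _ _ X _ setT x) (@measurable_id _ X setT)).
Qed.

Let mg x i : measurable_fun setT (fun xi => g x xi 0 i).
Proof. by have /measurable_rowP := measurable_sample_gradient x; apply. Qed.

Let mL := measurable_L pb.
Let L2p : 0 < L2 := L2_gt0 pb.

Lemma L1_L_sqr : L1 P (fun xi => L xi ^+ 2) /\ \int[P]_xi L xi ^+ 2 <= L2 ^+ 2.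
Proof.
apply: L1_ge0 => [|xi|]; [exact: measurable_funX|exact: sqr_ge0|].
have := L_bound pb; rewrite -[X in (_ <= X)%E -> _]gee0_abs ?lee_fin ?(ltW L2p)//.
rewrite -sqrte_sqr lee_sqrt ?sqre_ge0// unlock => h.
by apply: (le_trans h); rewrite expe2 -EFinM -expr2.
Qed.

Lemma L1_norm_L : L1 P (fun xi => `|L xi|) /\ \int[P]_xi `|L xi| <= L2.
Proof.
have [LL iL] := L1_L_sqr.
have L1L : L1 P (fun xi => `|L xi|) by apply/L1_norm/L1_sqr.
split => //; have L2n : L2 != 0 by rewrite gt_eqF.
(* |L| <= L^2 / (2 L2) + L2 / 2 plays the part of the Cauchy-Schwarz inequality for integrals. *)
apply: (@le_trans _ _ (\int[P]_xi (L xi ^+ 2 * (2 * L2)^-1 + L2 / 2))).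
  apply: le_Rintegral => //; first by apply: L1D; [exact: L1Zr|exact: L1_cst].
  move=> xi _; have := sqr_ge0 (`|L xi| - L2); rewrite sqrrB real_normK ?num_real// => h.
  rewrite -(ler_pM2r (_ : 0 < 2 * L2)) ?mulr_gt0//.
  rewrite (_ : (L xi ^+ 2 * (2 * L2)^-1 + L2 / 2) * (2 * L2) = L xi ^+ 2 + L2 ^+ 2); last by field.
  by lra.
rewrite RintegralD//; [|exact: L1Zr|exact: L1_cst].
rewrite RintegralZr// Rintegral_prob_cst.
apply: (@le_trans _ _ (L2 ^+ 2 * (2 * L2)^-1 + L2 / 2)).
  by rewrite lerD2r ler_wpM2r// invr_ge0 mulr_ge0// ltW.
by rewrite le_eqVlt; apply/orP; left; apply/eqP; field.
Qed.

Let c x := gradient f x.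

Let var_c x : L1 P (fun xi => dot (g x xi - c x) (g x xi - c x)) /\
  \int[P]_xi dot (g x xi - c x) (g x xi - c x) <= sigma ^+ 2.
Proof.
apply: L1_ge0 => [|xi|]; [|exact: dot_ge0|].
  have mgc : measurable_fun setT (fun xi => g x xi - c x).
    by apply: measurable_rowD => //; exact: measurable_sample_gradient.
  exact: measurable_dot.
have := variance_bound pb x; rewrite unlock.
by under eq_integral do rewrite norm2_sq.
Qed.

Let L1_gc x i : L1 P (fun xi => (g x xi 0 i - c x 0 i) ^+ 2).
Proof.
have [Lc _] := var_c x; apply: L1_le Lc; first by apply: measurable_funX; exact: measurable_funB.
move=> xi; rewrite ger0_norm ?sqr_ge0// /dot (bigD1 i)//= !mxE -expr2 lerDl.
by apply: sumr_ge0 => j _; rewrite -expr2 sqr_ge0.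
Qed.

Lemma L1_gradient x i : L1 P (fun xi => g x xi 0 i).
Proof.
have : L1 P (fun xi => (g x xi 0 i - c x 0 i) + c x 0 i).
  by apply: L1D (L1_cst _ _); apply: L1_sqr => //; exact: measurable_funB.
by under eq_fun do rewrite subrK.
Qed.

Definition gradient_noise x xi := g x xi - mean_gradient x.

Lemma L1_noise x i : L1 P (fun xi => gradient_noise x xi 0 i).
Proof.
have := L1B (L1_gradient x i) (L1_cst P (mean_gradient x 0 i)).
by congr (L1 _ _); apply/funext => xi; rewrite !mxE.
Qed.

Lemma noise_mean0 x i : \int[P]_xi gradient_noise x xi 0 i = 0.
Proof.
under eq_Rintegral do rewrite !mxE.
rewrite RintegralB//; [|exact: L1_gradient|exact: L1_cst].
by rewrite Rintegral_prob_cst subrr.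
Qed.

Let gcE x xi i : g x xi 0 i - c x 0 i =
  gradient_noise x xi 0 i + (mean_gradient x 0 i - c x 0 i).
Proof. by rewrite /gradient_noise !mxE; ring. Qed.

Lemma L1_noise_sqr x i : L1 P (fun xi => gradient_noise x xi 0 i ^+ 2).
Proof.
set b := mean_gradient x 0 i - c x 0 i.
have : L1 P (fun xi => (g x xi 0 i - c x 0 i) ^+ 2 - 2 * b * gradient_noise x xi 0 i - b ^+ 2).
  by apply: L1B (L1_cst _ _); apply: L1B => //; apply: L1Z; exact: L1_noise.
congr (L1 _ _); apply/funext => xi; rewrite gcE -/b; by ring.
Qed.

(** The assumption bounds the second moment around [gradient f x]; the one around the mean is the
    smallest of all, so the bound passes to the noise. *)
Lemma noise_variance x :
  \sum_(i < n) \int[P]_xi gradient_noise x xi 0 i ^+ 2 <= sigma ^+ 2.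
Proof.
have gE xi i : (g x xi - c x) 0 i = g x xi 0 i - c x 0 i by rewrite mxE [(- c x) 0 i]mxE.
apply: le_trans (proj2 (var_c x)); rewrite Rintegral_sum; last first.
  by move=> i _; under eq_fun do rewrite gE -expr2; exact: L1_gc.
apply: ler_sum => i _; set b := mean_gradient x 0 i - c x 0 i.
under [leRHS]eq_Rintegral do rewrite gE -expr2 gcE -/b.
have -> : \int[P]_xi (gradient_noise x xi 0 i + b) ^+ 2 =
    \int[P]_xi (gradient_noise x xi 0 i ^+ 2 + (2 * b * gradient_noise x xi 0 i + b ^+ 2)).
  by apply: eq_Rintegral => xi _; ring.
have Ln := L1_noise x i.
rewrite RintegralD//; [|exact: L1_noise_sqr|by apply: L1D (L1_cst _ _); exact: L1Z].
rewrite RintegralD//; [|exact: L1Z|exact: L1_cst].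
by rewrite RintegralZl// noise_mean0 mulr0 add0r Rintegral_prob_cst lerDl sqr_ge0.
Qed.

Lemma sample_taylor : {ae P, forall xi, forall x y,
  `|F y xi - F x xi - dot (g x xi) (y - x)| <= `|L xi| * dot (y - x) (y - x)}.
Proof.
apply: filterS (gradient_F pb) => xi [Gxi Lxi] x y.
exact: (taylor_lipschitz_gradient Gxi Lxi).
Qed.

Let L1_dotg x v : L1 P (fun xi => dot (g x xi) v).
Proof. by apply: L1_sum => i _; apply: L1Zr; exact: L1_gradient. Qed.

Lemma mean_dot_gradient x v : \int[P]_xi dot (g x xi) v = dot (mean_gradient x) v.
Proof.
rewrite Rintegral_sum; last by move=> i _; apply: L1Zr; exact: L1_gradient.
by apply: eq_bigr => i _; rewrite RintegralZr ?mxE//; exact: L1_gradient.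
Qed.

Lemma objective_taylor x y :
  `|f y - f x - dot (mean_gradient x) (y - x)| <= L2 * dot (y - x) (y - x).
Proof.
have fE z : f z = \int[P]_xi F z xi by rewrite /f /objective unlock.
have LF z : L1 P (F z) := integrable_F pb z.
have L1D' : L1 P (fun xi => F y xi - F x xi - dot (g x xi) (y - x)).
  by apply: L1B => //; exact: L1B.
have -> : f y - f x - dot (mean_gradient x) (y - x) =
    \int[P]_xi (F y xi - F x xi - dot (g x xi) (y - x)).
  rewrite !fE -mean_dot_gradient -(RintegralB measurableT (LF y) (LF x)).
  by rewrite -(RintegralB measurableT (L1B (LF y) (LF x)) (L1_dotg x (y - x))).
apply: (le_trans (le_normr_Rintegral measurableT L1D')).
have [Ll iL] := L1_norm_L.
apply: (@le_trans _ _ (\int[P]_xi (`|L xi| * dot (y - x) (y - x)))).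
  apply: ae_Rintegral_le; [exact: L1_norm|exact: L1Zr|].
  by apply: filterS sample_taylor => xi; apply.
by rewrite RintegralZr// ler_wpM2r// dot_ge0.
Qed.

Lemma measurable_objective : measurable_fun setT f.
Proof.
apply: continuous_row_measurable => x.
exact: (continuous_quadratic_sandwich (objective_taylor x)).
Qed.

(** Convexity on the segment and the Taylor bound give the inequality up to s q for every s in (0,
    1]; then s tends to 0. *)
Lemma objective_subgradient x u : dot (mean_gradient x) (u - x) <= f u - f x.
Proof.
have [cf _] := objective_closed_convex pb.
set D := dot _ _; set q := L2 * dot (u - x) (u - x).
have q0 : 0 <= q by rewrite mulr_ge0 ?dot_ge0// ltW.
have key s : 0 < s -> s <= 1 -> D <= f u - f x + s * q.
  move=> s0 s1.
  have := cf (Itv01 (ltW s0) s1) u x (in_setT _) (in_setT _).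
  have -> : (u : convex_lmodType _) <| Itv01 (ltW s0) s1 |> x = x + s *: (u - x).
    by rewrite /conv /= /unstable.onem scalerBl scale1r scalerBr addrCA.
  have -> : (f u : R^o) <| Itv01 (ltW s0) s1 |> f x = s * f u + (1 - s) * f x by [].
  have := objective_taylor x (x + s *: (u - x)).
  rewrite (_ : x + _ - x = s *: (u - x)); last by rewrite addrC addKr.
  rewrite dotZl !dotZr -/D mulrCA [L2 * _]mulrCA -/q ler_norml.
  move=> /andP[h1 _] h2; rewrite -(ler_pM2l s0); rewrite /f in h1 h2 *; lra.
rewrite -[leLHS]addr0; apply/ler_addgt0Pr => e e0; rewrite addr0.
have q1 : 0 < q + 1 by rewrite ltr_wpDl.
(* The denominator is q + 1 because q may vanish. *)
have s0 : 0 < Num.min 1 (e / (q + 1)) by rewrite lt_min ltr01 divr_gt0.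
have s1 : Num.min 1 (e / (q + 1)) <= 1 by rewrite ge_min lexx.
apply: (le_trans (key _ s0 s1)); rewrite lerD2l.
apply: (@le_trans _ _ (e / (q + 1) * q)).
  by rewrite ler_wpM2r// ge_min lexx orbT.
by rewrite mulrAC ler_pdivrMr// ler_pM2l// lerDl.
Qed.

(** A gradient step of length 1 / (2 L2) lowers [f] by at least |G|^2 / (4 L2) and cannot pass below
    the minimum. The Taylor bound has L2 in place of L2 / 2, hence 4 in place of the usual 2. *)
Lemma mean_gradient_sqr_le x u : is_minimizer f u ->
  dot (mean_gradient x) (mean_gradient x) <= 4 * L2 * (f x - f u).
Proof.
move=> umin; set G := mean_gradient x.
have := umin (x - (2 * L2)^-1 *: G).
have := objective_taylor x (x - (2 * L2)^-1 *: G).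
rewrite (_ : x - _ - x = - ((2 * L2)^-1 *: G)); last by rewrite addrC addKr.
rewrite -/G !dotNr dotNl opprK !dotZr !dotZl ler_norml.
set a := dot G G => /andP[_ h1] h2.
have L2n : L2 != 0 by rewrite gt_eqF.
have h3 : f u - f x + (2 * L2)^-1 * a <= L2 * ((2 * L2)^-1 * ((2 * L2)^-1 * a)).
  by move: h1 h2; rewrite /f; lra.
rewrite (_ : L2 * _ = (4 * L2)^-1 * a) in h3; last by field.
rewrite (_ : (2 * L2)^-1 * a = 2 * ((4 * L2)^-1 * a)) in h3; last by field.
have -> : a = 4 * L2 * ((4 * L2)^-1 * a) by field.
have L4 : 0 <= 4 * L2 by rewrite mulr_ge0// ltW.
by rewrite ler_wpM2l//; lra.
Qed.

End objective_theory.

(** * Measurable left inverses of expansive maps *)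

Section lipschitz_left_inverse.
Context {R : realType} {n : nat}.
Implicit Types (x y z v : 'rV[R]_n).

Lemma norm2D x y : norm2 (x + y) <= norm2 x + norm2 y.
Proof.
rewrite -(@ler_pXn2r _ 2)// ?nnegrE ?addr_ge0 ?norm2_ge0//.
rewrite sqrrD !norm2_sq dotDl !dotDr (dotC y x).
have := le_trans (ler_norm _) (dot_norm2 x y); rewrite mulr2n; lra.
Qed.

Lemma norm2N x : norm2 (- x) = norm2 x.
Proof. by rewrite /norm2 dotNl dotNr opprK. Qed.

Lemma norm2B x y : norm2 (x - y) = norm2 (y - x).
Proof. by rewrite -norm2N opprB. Qed.

Lemma coord_le_norm2 x i : `|x 0 i| <= norm2 x.
Proof.
rewrite -(@ler_pXn2r _ 2)// ?nnegrE ?norm2_ge0// norm2_sq real_normK ?num_real//.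
rewrite /dot (bigD1 i)//= expr2 lerDl.
by apply: sumr_ge0 => j _; rewrite -expr2 sqr_ge0.
Qed.

Lemma continuous_norm2B x : continuous (fun y => norm2 (y - x)).
Proof.
move=> y; apply: (@continuous_comp _ _ _ (fun y => dot (y - x) (y - x)) Num.sqrt).
  by apply: (@continuous_dot _ _ (fun y => y - x) (fun y => y - x)) => i; exact: continuous_coordB.
exact: sqrt_continuous.
Qed.

(* McShane's extension, applied to the coordinates of the inverse of D. *)
Lemma lipschitz_left_inverse (D : 'rV[R]_n -> 'rV[R]_n) (K : R) : 0 <= K ->
  (forall x y, norm2 (x - y) <= K * norm2 (D x - D y)) ->
  exists2 Phi : 'rV[R]_n -> 'rV[R]_n,
    measurable_fun setT Phi & forall x, Phi (D x) = x.
Proof.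
move=> K0 DK.
pose E i z := [set x 0 i + K * norm2 (z - D x) | x in [set: 'rV[R]_n]].
pose phi i z := inf (E i z).
have E0 i z : E i z !=set0 by exists (0 + K * norm2 (z - D 0)); exists 0 => //; rewrite mxE.
have tri (a b c : 'rV[R]_n) : K * norm2 (a - b) <= K * norm2 (a - c) + K * norm2 (c - b).
  by rewrite -mulrDr ler_wpM2l// (le_trans _ (norm2D _ _))// addrA subrK.
have lbE i z x : lbound (E i z) (x 0 i - K * norm2 (z - D x)).
  move=> _ [y _ <-].
  have := le_trans (coord_le_norm2 (x - y) i) (DK x y); rewrite !mxE => h.
  have := le_trans (ler_norm _) h; have := tri (D x) (D y) z; rewrite (norm2B (D x) z); lra.
have phi_le i z x : phi i z <= x 0 i + K * norm2 (z - D x).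
  by apply: ge_inf; [exists (x 0 i - K * norm2 (z - D x)); exact: lbE|exists x].
have lip i z z' : phi i z <= phi i z' + K * norm2 (z - z').
  rewrite -lerBlDr; apply: lb_le_inf => // _ [x _ <-].
  have := phi_le i z x; have := tri z (D x) z'; lra.
have phiD i x : phi i (D x) = x 0 i.
  have zero : norm2 (D x - D x) = 0 by rewrite subrr /norm2 /dot big1 ?sqrtr0// => j _; rewrite mxE mul0r.
  apply/eqP; rewrite eq_le; apply/andP; split.
    by have := phi_le i (D x) x; rewrite zero mulr0 addr0.
  by apply: lb_le_inf => //; have := lbE i (D x) x; rewrite zero mulr0 subr0.
exists (fun z => \row_i phi i z); last by move=> x; apply/rowP => i; rewrite mxE phiD.
apply: measurable_row => i; under eq_fun do rewrite mxE.
apply: continuous_row_measurable => z.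
have c0 : {for z, continuous (fun y => K * norm2 (y - z))}.
  apply: (@continuousM R _ (fun=> K) (fun y => norm2 (y - z)) z); first exact: cst_continuous.
  exact: continuous_norm2B.
have cl : {for z, continuous (fun y => phi i z - K * norm2 (y - z))}.
  by apply: continuousB => //; exact: cst_continuous.
have cu : {for z, continuous (fun y => phi i z + K * norm2 (y - z))}.
  by apply: continuousD => //; exact: cst_continuous.
have zero : norm2 (z - z) = 0 by rewrite subrr /norm2 /dot big1 ?sqrtr0// => j _; rewrite mxE mul0r.
rewrite /prop_for /continuous_at zero mulr0 subr0 in cl.
rewrite /prop_for /continuous_at zero mulr0 addr0 in cu.
apply: (squeeze_cvgr _ cl cu); apply: nearW => y.
have := lip i z y; have := lip i y z; rewrite (norm2B z y) => h1 h2.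
by apply/andP; split; lra.
Qed.

End lipschitz_left_inverse.

(** * One iteration of RDFDS *)

Section gradient_estimator.
Context {R : realType} {n : nat} {d d' : measure_display}.
Context {X : measurableType d} {Omega : measurableType d'}.
Variables (P : probability X R) (F : 'rV[R]_n -> X -> R) (g : 'rV[R]_n -> X -> 'rV[R]_n).
Variables (L : X -> R) (L2 sigma : R).
Hypothesis pb : problem_assumptions P F g L L2 sigma.
Variables (Pr : probability Omega R) (m : nat).
Variables (e : Omega -> 'rV[R]_n) (xi : 'I_m -> Omega -> X) (U : probability 'rV[R]_n R).
Hypothesis m0 : (0 < m)%N.
Hypothesis n0 : (0 < n)%N.
Hypothesis uniformU : uniform_on_sphere U.
Hypothesis me : measurable_fun setT e.
Hypothesis lawe : forall A, measurable A -> Pr (e @^-1` A) = U A.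
Hypothesis mxi : forall i, measurable_fun setT (xi i).
Hypothesis indep1 : forall i (a : X -> R) (phi : 'rV[R]_n -> R),
  L1 P a -> sphere_bounded phi ->
  L1 Pr (fun w => a (xi i w) * phi (e w)) /\
  \int[Pr]_w (a (xi i w) * phi (e w)) = \int[P]_y a y * \int[U]_v phi v.
Hypothesis indep2 : forall i j (a b : X -> R) (phi : 'rV[R]_n -> R), i != j ->
  L1 P a -> L1 P b -> sphere_bounded phi ->
  L1 Pr (fun w => a (xi i w) * b (xi j w) * phi (e w)) /\
  \int[Pr]_w (a (xi i w) * b (xi j w) * phi (e w)) =
    \int[P]_y a y * \int[P]_y b y * \int[U]_v phi v.
Implicit Types (x v u : 'rV[R]_n) (phi : 'rV[R]_n -> R).

Let nn : n%:R != 0 :> R. Proof. by rewrite pnatr_eq0 -lt0n. Qed.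
Let mn : m%:R != 0 :> R. Proof. by rewrite pnatr_eq0 -lt0n. Qed.

Let E phi : sphere_bounded phi ->
  L1 Pr (fun w => phi (e w)) /\ \int[Pr]_w phi (e w) = \int[U]_v phi v.
Proof.
move=> bphi; have Lphi := sphere_bounded_L1 uniformU bphi.
by split; [exact: (L1_law me lawe Lphi)|rewrite (Rintegral_law me lawe Lphi)].
Qed.

Lemma signed_permutation_invariant_cst (c : R) :
  signed_permutation_invariant (fun=> c : R) (n := n).
Proof. by []. Qed.

Lemma direction_second_moment u v phi : sphere_bounded phi ->
  signed_permutation_invariant phi ->
  L1 Pr (fun w => dot u (e w) * dot v (e w) * phi (e w)) /\
  \int[Pr]_w (dot u (e w) * dot v (e w) * phi (e w)) =
    dot u v / n%:R * \int[U]_v phi v.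
Proof.
move=> bphi iphi; have [L1' EE] := E (phi := fun s => dot u s * dot v s * phi s)
  ltac:(by apply: sphere_boundedM => //; apply: sphere_boundedM; exact: sphere_bounded_dot).
by split => //; rewrite EE Rintegral_dotM.
Qed.

Section fixed_point.
Variable x : 'rV[R]_n.

Let mu := mean_gradient P g x.
Let G := gradient_noise P g x.

Definition mean_noise (w : Omega) : 'rV[R]_n := m%:R^-1 *: \sum_(i < m) G (xi i w).

Let LG a : L1 P (fun y => G y 0 a) := L1_noise pb x a.

Let LGG a b : L1 P (fun y => G y 0 a * G y 0 b).
Proof.
by apply: L1_mul_sqr; [exact: L1_measurable (LG a)|exact: L1_measurable (LG b)|exact: L1_noise_sqr pb x a|exact: L1_noise_sqr pb x b].
Qed.

Let noiseE w : dot (mean_noise w) (e w) =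
  \sum_(p : 'I_m * 'I_n) m%:R^-1 * (G (xi p.1 w) 0 p.2 * e w 0 p.2).
Proof.
rewrite dotZl dot_suml mulr_sumr -(pair_bigA _ (fun i a => m%:R^-1 * (G (xi i w) 0 a * e w 0 a))) /=.
by apply: eq_bigr => i _; rewrite /dot mulr_sumr.
Qed.

(** Expanded in coordinates, each term factors by independence and one of its factors is the mean of
    a centred noise. *)
Lemma noise_first_moment phi : sphere_bounded phi ->
  L1 Pr (fun w => dot (mean_noise w) (e w) * phi (e w)) /\
  \int[Pr]_w (dot (mean_noise w) (e w) * phi (e w)) = 0.
Proof.
move=> bphi.
have bp a : sphere_bounded (fun s => s 0 a * phi s).
  by apply: sphere_boundedM => //; exact: sphere_bounded_coord.
have I1 (p : 'I_m * 'I_n) := indep1 p.1 (LG p.2) (bp p.2).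
have -> : (fun w => dot (mean_noise w) (e w) * phi (e w)) = (fun w =>
    \sum_(p : 'I_m * 'I_n) m%:R^-1 * (G (xi p.1 w) 0 p.2 * (e w 0 p.2 * phi (e w)))).
  by apply/funext => w; rewrite noiseE mulr_suml; apply: eq_bigr => p _; ring.
have Lp (p : 'I_m * 'I_n) : L1 Pr (fun w => m%:R^-1 * (G (xi p.1 w) 0 p.2 * (e w 0 p.2 * phi (e w)))).
  by apply: L1Z; exact: (I1 p).1.
split; first exact: L1_sum.
rewrite Rintegral_sum// big1// => p _; rewrite RintegralZl//; last exact: (I1 p).1.
by rewrite (I1 p).2 (noise_mean0 pb) ?mul0r ?mulr0.
Qed.

(** The square is expanded over pairs (sample, coordinate). Distinct samples contribute nothing
    because the noise is centred, distinct coordinates of one sample because of sign symmetry; the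
    diagonal gives the variance over m n. *)
Lemma noise_second_moment phi : sphere_bounded phi ->
  signed_permutation_invariant phi -> (forall s, 0 <= phi s) ->
  L1 Pr (fun w => dot (mean_noise w) (e w) ^+ 2 * phi (e w)) /\
  \int[Pr]_w (dot (mean_noise w) (e w) ^+ 2 * phi (e w)) <=
    sigma ^+ 2 / (m%:R * n%:R) * \int[U]_v phi v.
Proof.
move=> bphi iphi phi0.
have bp a b : sphere_bounded (fun s => s 0 a * s 0 b * phi s).
  by apply: sphere_boundedM => //; apply: sphere_boundedM; exact: sphere_bounded_coord.
pose T (p q : 'I_m * 'I_n) w := G (xi p.1 w) 0 p.2 * G (xi q.1 w) 0 q.2 *
  (e w 0 p.2 * e w 0 q.2 * phi (e w)).
have IT (p q : 'I_m * 'I_n) : L1 Pr (T p q) /\ \int[Pr]_w T p q w =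
    if q == p then \int[P]_y (G y 0 p.2 ^+ 2) / n%:R * \int[U]_v phi v else 0.
  have [pq1|pq1] := eqVneq p.1 q.1; last first.
    have [L1' ->] := indep2 pq1 (LG p.2) (LG q.2) (bp p.2 q.2); split => //.
    rewrite (noise_mean0 pb) mul0r mul0r; case: eqP => // qp.
    by move: pq1; rewrite qp eqxx.
  have := indep1 p.1 (LGG p.2 q.2) (bp p.2 q.2).
  rewrite /T -pq1 => -[L1' ->]; split => //.
  have [pq2|pq2] := eqVneq p.2 q.2; last first.
    rewrite Rintegral_coordM// mulr0; case: eqP => // qp.
    by move: pq2; rewrite qp eqxx.
  have -> : q == p by apply/eqP; case: p q pq1 pq2 {L1'} => [? ?] [? ?] /= -> ->.
  have sqE : \int[P]_y (G y 0 p.2 * G y 0 p.2) = \int[P]_y (G y 0 p.2 ^+ 2).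
    by apply: eq_Rintegral => y _; rewrite expr2.
  by rewrite -pq2 Rintegral_coord_sqr// mulrA sqE.
have -> : (fun w => dot (mean_noise w) (e w) ^+ 2 * phi (e w)) = (fun w =>
    \sum_(p : 'I_m * 'I_n) \sum_(q : 'I_m * 'I_n) m%:R^-2 * T p q w).
  apply/funext => w; rewrite noiseE expr2 big_distrlr /= mulr_suml.
  apply: eq_bigr => p _; rewrite mulr_suml; apply: eq_bigr => q _.
  by rewrite /T -exprVn expr2; ring.
have LT (p q : 'I_m * 'I_n) : L1 Pr (fun w => m%:R^-2 * T p q w).
  by apply: L1Z; exact: (IT p q).1.
have LTs (p : 'I_m * 'I_n) : L1 Pr (fun w => \sum_(q : 'I_m * 'I_n) m%:R^-2 * T p q w).
  exact: L1_sum.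
split; first exact: L1_sum.
rewrite Rintegral_sum//.
have q0 : 0 <= \int[U]_v phi v by apply: Rintegral_ge0 => s _.
have -> : \sum_(p : 'I_m * 'I_n) \int[Pr]_w (\sum_(q : 'I_m * 'I_n) m%:R^-2 * T p q w) =
    \sum_(p : 'I_m * 'I_n) m%:R^-2 * (\int[P]_y (G y 0 p.2 ^+ 2) / n%:R * \int[U]_v phi v).
  apply: eq_bigr => p _; rewrite Rintegral_sum// (bigD1 p)//= big1 ?addr0.
    by rewrite RintegralZl ?(IT p p).2 ?eqxx//; exact: (IT p p).1.
  move=> q qp; rewrite RintegralZl//; last exact: (IT p q).1.
  by rewrite (IT p q).2 (negbTE qp) mulr0.
rewrite -(pair_bigA _ (fun (i : 'I_m) a => m%:R^-2 * (\int[P]_y (G y 0 a ^+ 2) / n%:R * \int[U]_v phi v))) /=.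
rewrite sumr_const card_ord -mulr_sumr.
under eq_bigr do rewrite -mulrA.
rewrite -mulr_suml -[leLHS]mulr_natr.
have h := noise_variance pb x.
set V := \sum_(i < n) _ in h *.
have -> : m%:R^-2 * (V * (n%:R^-1 * \int[U]_v phi v)) * m%:R =
    V / (m%:R * n%:R) * \int[U]_v phi v.
  by field; rewrite nn mn.
by rewrite ler_wpM2r// ler_wpM2r// invr_ge0 mulr_ge0// ler0n.
Qed.

Lemma error_moment (c1 c2 : R) phi : 0 <= c1 -> sphere_bounded phi -> (forall s, 0 <= phi s) ->
  L1 Pr (fun w => (c1 * (m%:R^-1 * \sum_(i < m) L (xi i w) ^+ 2) + c2) * phi (e w)) /\
  \int[Pr]_w ((c1 * (m%:R^-1 * \sum_(i < m) L (xi i w) ^+ 2) + c2) * phi (e w)) <=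
    (c1 * L2 ^+ 2 + c2) * \int[U]_v phi v.
Proof.
move=> c10 bphi phi0.
have [LL iL] := L1_L_sqr pb.
have I1 i := indep1 i LL bphi.
have -> : (fun w => (c1 * (m%:R^-1 * \sum_(i < m) L (xi i w) ^+ 2) + c2) * phi (e w)) =
    (fun w => \sum_(i < m) (c1 / m%:R) * (L (xi i w) ^+ 2 * phi (e w)) + c2 * phi (e w)).
  by apply/funext => w; rewrite mulrDl -mulr_sumr -mulr_suml; ring.
have Li i : L1 Pr (fun w => (c1 / m%:R) * (L (xi i w) ^+ 2 * phi (e w))).
  by apply: L1Z; exact: (I1 i).1.
have Ls : L1 Pr (fun w => \sum_(i < m) (c1 / m%:R) * (L (xi i w) ^+ 2 * phi (e w))).
  exact: L1_sum.
have [Lp Ep] := E bphi.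
split; first by apply: L1D => //; exact: L1Z.
rewrite RintegralD//; last exact: L1Z.
rewrite Rintegral_sum// RintegralZl// Ep mulrDl lerD2r.
apply: (@le_trans _ _ (\sum_(i < m) (c1 / m%:R) * (L2 ^+ 2 * \int[U]_v phi v))).
  apply: ler_sum => i _; rewrite RintegralZl//; last exact: (I1 i).1.
  rewrite (I1 i).2 ler_wpM2l ?divr_ge0 ?ler0n// ler_wpM2r//.
  by apply: Rintegral_ge0 => s _.
rewrite sumr_const card_ord -[leLHS]mulr_natr le_eqVlt; apply/orP; left; apply/eqP.
by field.
Qed.

Variables (theta : Omega -> R) (c1 c2 : R).
Hypothesis mtheta : measurable_fun setT theta.
Hypotheses (c10 : 0 <= c1) (c20 : 0 <= c2).

Let err w := c1 * (m%:R^-1 * \sum_(i < m) L (xi i w) ^+ 2) + c2.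

Hypothesis theta_err : {ae Pr, forall w,
  (theta w - dot mu (e w) - dot (mean_noise w) (e w)) ^+ 2 <= err w}.

Let main w := dot mu (e w) + dot (mean_noise w) (e w).

Lemma main_second_moment phi : sphere_bounded phi ->
  signed_permutation_invariant phi -> (forall s, 0 <= phi s) ->
  L1 Pr (fun w => main w ^+ 2 * phi (e w)) /\
  \int[Pr]_w (main w ^+ 2 * phi (e w)) <=
    (dot mu mu + sigma ^+ 2 / m%:R) / n%:R * \int[U]_v phi v.
Proof.
move=> bphi iphi phi0.
have [LA EA] := direction_second_moment mu mu bphi iphi.
have bmp : sphere_bounded (fun s => dot mu s * phi s).
  by apply: sphere_boundedM => //; exact: sphere_bounded_dot.
have [LAB EAB] := noise_first_moment bmp.
have [LB EB] := noise_second_moment bphi iphi phi0.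
have -> : (fun w => main w ^+ 2 * phi (e w)) = (fun w =>
    dot mu (e w) * dot mu (e w) * phi (e w) +
    (2 * (dot (mean_noise w) (e w) * (dot mu (e w) * phi (e w))) +
     dot (mean_noise w) (e w) ^+ 2 * phi (e w))).
  by apply/funext => w; rewrite /main; ring.
split; first by apply: L1D => //; apply: L1D => //; exact: L1Z.
rewrite RintegralD//; last by apply: L1D => //; exact: L1Z.
rewrite RintegralD//; last exact: L1Z.
rewrite RintegralZl// EA EAB mulr0 add0r.
apply: (@le_trans _ _ (dot mu mu / n%:R * \int[U]_v phi v +
    sigma ^+ 2 / (m%:R * n%:R) * \int[U]_v phi v)); first by rewrite lerD2l.
by rewrite le_eqVlt; apply/orP; left; apply/eqP; field; rewrite nn mn.
Qed.

Variable S : 'rV[R]_n -> R.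
Hypotheses (bS : sphere_bounded S) (iS : signed_permutation_invariant S)
  (S0 : forall s, 0 <= S s).

Let b1 : sphere_bounded (fun=> 1 : R) (n := n). Proof. exact: sphere_bounded_cst. Qed.

Let mmain : measurable_fun setT main.
Proof.
apply: measurable_funD; first exact: measurable_dot.
apply: measurable_dot => //.
have -> : mean_noise = fun w => \row_a (m%:R^-1 * \sum_(i < m) G (xi i w) 0 a).
  by apply/funext => w; apply/rowP => a; rewrite !mxE summxE.
apply: measurable_row => a; under eq_fun do rewrite mxE.
apply: measurable_funM => //; apply: measurable_sum => i.
have mGa : measurable_fun setT (fun y => G y 0 a) := L1_measurable (LG a).
exact: measurableT_comp mGa (mxi i).
Qed.

Let theta_sqr : {ae Pr, forall w, theta w ^+ 2 <= 2 * main w ^+ 2 + 2 * err w}.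
Proof.
apply: filterS theta_err => w h.
have := sqr_ge0 (2 * main w - theta w).
by rewrite /main in h *; move: h; set A := dot mu _; set B := dot _ _; nra.
Qed.

Lemma estimator_L1_sqr phi : sphere_bounded phi ->
  signed_permutation_invariant phi -> (forall s, 0 <= phi s) ->
  L1 Pr (fun w => theta w ^+ 2 * phi (e w)).
Proof.
move=> bphi iphi phi0.
have [Lm _] := main_second_moment bphi iphi phi0.
have [Le _] := error_moment c2 c10 bphi phi0.
apply: (@ae_L1_le _ _ _ _ _ (fun w => 2 * (main w ^+ 2 * phi (e w)) + 2 * (err w * phi (e w)))).
- apply: measurable_funM; first exact: measurable_funX.
  by apply: measurableT_comp me; case: bphi.
- apply: filterS theta_sqr => w h.
  rewrite (ger0_norm (mulr_ge0 (sqr_ge0 _) (phi0 _))).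
  rewrite (_ : 2 * _ + 2 * _ = (2 * main w ^+ 2 + 2 * err w) * phi (e w)); last by ring.
  by rewrite ler_wpM2r.
- exact: (L1D (L1Z 2 Lm) (L1Z 2 Le)).
Qed.

Lemma estimator_L1_dot v : L1 Pr (fun w => theta w * dot v (e w)).
Proof.
apply: L1_mul_sqr => //; first exact: measurable_dot.
  have := estimator_L1_sqr b1 (signed_permutation_invariant_cst 1) (fun=> ler01).
  by under eq_fun do rewrite mulr1.
have [+ _] := direction_second_moment v v b1 (signed_permutation_invariant_cst 1).
by under eq_fun do rewrite mulr1 -expr2.
Qed.

(** The error of [theta] is correlated with <e, v>. Young's inequality with the free weight [lam]
    splits their product into the squared error and <e, v>^2, whose mean is |v|^2 / n. *)
Lemma estimator_bound v (a b lam : R) : 0 <= a -> 0 <= b -> 0 < lam ->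
  \int[Pr]_w (b * (theta w ^+ 2 * S (e w)) - a * (theta w * dot v (e w))) <=
  - a * (dot mu v / n%:R) +
  a / 2 * (lam * (c1 * L2 ^+ 2 + c2) + dot v v / (n%:R * lam)) +
  2 * b * ((dot mu mu + sigma ^+ 2 / m%:R) / n%:R + (c1 * L2 ^+ 2 + c2)) * \int[U]_s S s.
Proof.
move=> a0 b0 lam0.
have i1 := signed_permutation_invariant_cst 1.
have one : \int[U]_s (1 : R) = 1 by exact: Rintegral_prob_cst.
have [LAv EAv] := direction_second_moment mu v b1 i1.
have [Lvv Evv] := direction_second_moment v v b1 i1.
have [LBv EBv] := noise_first_moment (sphere_bounded_dot v).
have [Lm Em] := main_second_moment bS iS S0.
have [Le Ee] := error_moment c2 c10 bS S0.
have [Le1 Ee1] := error_moment c2 c10 b1 (fun=> ler01).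
rewrite one mulr1 in EAv Evv Ee1.
(* [Z1] carries the mean gradient, [Z2] the centred noise, [Z3] and [Z4] the two halves of Young's
   inequality; [Z5] and [Z6] bound the quadratic term. *)
pose Z1 w := - a * (dot mu (e w) * dot v (e w) * 1).
pose Z2 w := - a * (dot (mean_noise w) (e w) * dot v (e w)).
pose Z3 w := a / 2 * lam * (err w * 1).
pose Z4 w := a / 2 / lam * (dot v (e w) * dot v (e w) * 1).
pose Z5 w := 2 * b * (main w ^+ 2 * S (e w)).
pose Z6 w := 2 * b * (err w * S (e w)).
have L1_1 : L1 Pr Z1 by exact: L1Z.
have L1_2 : L1 Pr Z2 by exact: L1Z.
have L1_3 : L1 Pr Z3 by exact: L1Z.
have L1_4 : L1 Pr Z4 by exact: L1Z.
have L1_5 : L1 Pr Z5 by exact: L1Z.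
have L1_6 : L1 Pr Z6 by exact: L1Z.
have L56 := L1D L1_5 L1_6; have L46 := L1D L1_4 L56; have L36 := L1D L1_3 L46.
have L26 := L1D L1_2 L36; have L16 := L1D L1_1 L26.
apply: (@le_trans _ _ (\int[Pr]_w (Z1 w + (Z2 w + (Z3 w + (Z4 w + (Z5 w + Z6 w))))))).
  apply: ae_Rintegral_le => //.
    by apply: L1B; apply: L1Z; [exact: estimator_L1_sqr|exact: estimator_L1_dot].
  apply: filterS2 theta_err theta_sqr => w h1 h2.
  have t1 : b * (theta w ^+ 2 * S (e w)) <= Z5 w + Z6 w.
    rewrite /Z5 /Z6 (_ : _ + _ = b * ((2 * main w ^+ 2 + 2 * err w) * S (e w))); last by ring.
    by rewrite ler_wpM2l// ler_wpM2r.
  set A := dot mu (e w) in h1 *; set B := dot (mean_noise w) (e w) in h1 *.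
  set D := dot v (e w).
  set r := theta w - A - B in h1.
  have t2 : - (r * D) <= (lam * err w + D * D / lam) / 2.
    apply: (@le_trans _ _ ((lam * r ^+ 2 + D * D / lam) / 2)).
      have := sqr_ge0 (lam * r + D) => h; rewrite -(ler_pM2l (_ : 0 < 2 * lam)) ?mulr_gt0//.
      rewrite (_ : 2 * lam * ((lam * r ^+ 2 + D * D / lam) / 2) = lam ^+ 2 * r ^+ 2 + D * D); last by field; rewrite gt_eqF.
      by lra.
    by rewrite ler_pM2r ?invr_gt0// lerD2r ler_pM2l.
  have t3 : - a * (theta w * D) <= Z1 w + (Z2 w + (Z3 w + Z4 w)).
    have := ler_wpM2l a0 t2; rewrite /Z1 /Z2 /Z3 /Z4 -/A -/B -/D /r; lra.
  by rewrite -mulNr; lra.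
do 5 (rewrite RintegralD//).
rewrite /Z1 /Z2 /Z3 /Z4 /Z5 /Z6 !RintegralZl//.
rewrite EAv EBv mulr0 add0r Evv.
have a2 : 0 <= a / 2 * lam by rewrite !mulr_ge0 ?invr_ge0// ltW.
have b2 : 0 <= 2 * b by rewrite mulr_ge0.
have k1 := ler_wpM2l a2 Ee1; have k2 := ler_wpM2l b2 Em; have k3 := ler_wpM2l b2 Ee.
rewrite -/err in k1 k3.
have -> : a / 2 * (lam * (c1 * L2 ^+ 2 + c2) + dot v v / (n%:R * lam)) =
  a / 2 * lam * (c1 * L2 ^+ 2 + c2) + a / 2 / lam * (dot v v / n%:R).
  by field; rewrite nn gt_eqF.
move: k1 k2 k3; set q := \int[U]_s S s; set M := _ / n%:R * q.
set W := (c1 * L2 ^+ 2 + c2).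
have -> : 2 * b * ((dot mu mu + sigma ^+ 2 / m%:R) / n%:R + W) * q = 2 * b * M + 2 * b * (W * q).
  by rewrite /M; ring.
by lra.
Qed.

End fixed_point.
End gradient_estimator.

(** The empirical variance is nonnegative. *)
Lemma sqr_mean_le (R : realFieldType) (m : nat) (q : 'I_m -> R) : (0 < m)%N ->
  (m%:R^-1 * \sum_(i < m) q i) ^+ 2 <= m%:R^-1 * \sum_(i < m) q i ^+ 2.
Proof.
move=> m0; have mp : 0 < m%:R :> R by rewrite ltr0n.
set a := m%:R^-1 * \sum_(i < m) q i.
have : 0 <= m%:R^-1 * \sum_(i < m) (q i - a) ^+ 2.
  by rewrite mulr_ge0 ?invr_ge0 ?ler0n// sumr_ge0// => i _; exact: sqr_ge0.
have -> : \sum_(i < m) (q i - a) ^+ 2 = \sum_(i < m) q i ^+ 2 - 2 * a * \sum_(i < m) q i + m%:R * a ^+ 2.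
  have -> : m%:R * a ^+ 2 = \sum_(i < m) a ^+ 2 by rewrite sumr_const card_ord -[RHS]mulr_natl.
  rewrite mulr_sumr -sumrB -big_split /=.
  by apply: eq_bigr => i _; ring.
have -> : m%:R^-1 * (\sum_(i < m) q i ^+ 2 - 2 * a * \sum_(i < m) q i + m%:R * a ^+ 2) =
    m%:R^-1 * \sum_(i < m) q i ^+ 2 - a ^+ 2.
  have -> : \sum_(i < m) q i = m%:R * a by rewrite /a mulVKf ?gt_eqF.
  by field; rewrite gt_eqF.
by rewrite subr_ge0.
Qed.

(** * Error of the averaged finite differences *)

Section finite_difference.
Context {R : realType} {n : nat} {d : measure_display} {X : measurableType d}.
Variables (F eta : 'rV[R]_n -> X -> R) (m : nat) (t : R).
Implicit Types (x v : 'rV[R]_n).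

Definition finite_difference x v (s : 'I_m -> X) : R :=
  m%:R^-1 * \sum_(i < m)
    (F (x + t *: v) (s i) + eta (x + t *: v) (s i) - (F x (s i) + eta x (s i))) / t.

Lemma measurable_finite_difference {d'} {T : measurableType d'}
    (x v : T -> 'rV[R]_n) (s : 'I_m -> T -> X) :
  measurable_fun setT (fun z : 'rV[R]_n * X => F z.1 z.2) ->
  measurable_fun setT (fun z : 'rV[R]_n * X => eta z.1 z.2) ->
  measurable_fun setT x -> measurable_fun setT v ->
  (forall i, measurable_fun setT (s i)) ->
  measurable_fun setT (fun w => finite_difference (x w) (v w) (fun i => s i w)).
Proof.
move=> mF meta mx mv ms.
have mxv : measurable_fun setT (fun w => x w + t *: v w).
  by apply: measurable_rowD => //; exact: measurable_rowZ.
have comp (H : 'rV[R]_n -> X -> R) (y : T -> 'rV[R]_n) i :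
    measurable_fun setT (fun z : 'rV[R]_n * X => H z.1 z.2) -> measurable_fun setT y ->
    measurable_fun setT (fun w => H (y w) (s i w)).
  move=> mH my; exact: (measurableT_comp mH (measurable_fun_pair my (ms i))).
apply: measurable_funM => //; apply: measurable_sum => i.
apply: measurable_funM => //.
by apply: measurable_funB; apply: measurable_funD; exact: comp.
Qed.

Lemma gradient_approximation_finite_difference (N : nat) (e : 'I_N -> 'rV[R]_n)
    (xi : 'I_N -> 'I_m -> X) (x : nat -> 'rV[R]_n) (k : 'I_N) :
  gradient_approximation (oracle F eta) t e xi x k =
  finite_difference (x k) (e k) (xi k) *: e k.
Proof.
rewrite /gradient_approximation /queries big_map big_enum /= -scaler_suml scalerA.
by congr (_ *: _).
Qed.

(** For each sample the Taylor remainder contributes at most t |L| and the two noise values at most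
    2 Delta / t; (a + b)^2 <= 2 a^2 + 2 b^2 separates them. *)
Lemma finite_difference_error (g : 'rV[R]_n -> X -> 'rV[R]_n) (L : X -> R) (Delta : R)
    x v (s : 'I_m -> X) :
  (0 < m)%N -> 0 < t -> dot v v = 1 ->
  (forall i x y, `|F y (s i) - F x (s i) - dot (g x (s i)) (y - x)| <= `|L (s i)| * dot (y - x) (y - x)) ->
  (forall i x, `|eta x (s i)| <= Delta) ->
  (finite_difference x v s - m%:R^-1 * \sum_(i < m) dot (g x (s i)) v) ^+ 2 <=
  2 * t ^+ 2 * (m%:R^-1 * \sum_(i < m) L (s i) ^+ 2) + 8 * Delta ^+ 2 / t ^+ 2.
Proof.
move=> m0 t0 vv FT etaD; have tn : t != 0 by rewrite gt_eqF.
rewrite -mulrBr -sumrB; apply: (le_trans (sqr_mean_le _ m0)).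
have mp : 0 < m%:R :> R by rewrite ltr0n.
have -> : 8 * Delta ^+ 2 / t ^+ 2 = m%:R^-1 * \sum_(i < m) (8 * Delta ^+ 2 / t ^+ 2).
  by rewrite sumr_const card_ord -[X in _ = _ * X]mulr_natl mulKf// gt_eqF.
rewrite [X in _ <= X + _]mulrCA -mulrDr ler_wpM2l ?invr_ge0 ?ler0n// mulr_sumr -big_split /=.
apply: ler_sum => i _.
have h1 := FT i x (x + t *: v).
have e1 : x + t *: v - x = t *: v by rewrite addrC addKr.
rewrite e1 !dotZr !dotZl vv mulr1 in h1.
have h2 := etaD i (x + t *: v); have h3 := etaD i x.
set A := F (x + _) _ in h1 *; set B := F x _ in h1 *.
set a := eta (x + _) _ in h2 *; set b := eta x _ in h3 *.
set D := dot (g x _) v in h1 *.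
have D0 : 0 <= Delta by apply: le_trans h3.
have -> : (A + a - (B + b)) / t - D = (A - B - t * D + (a - b)) / t by field.
have r1 : `|A - B - t * D + (a - b)| <= `|L (s i)| * (t * t) + 2 * Delta.
  apply: (le_trans (ler_normD _ _)); apply: lerD => //.
  by apply: (le_trans (ler_normB _ _)); lra.
rewrite expr_div_n -[X in X / _]real_normK ?num_real// ler_pdivrMr ?exprn_gt0//.
have -> : (2 * t ^+ 2 * L (s i) ^+ 2 + 8 * Delta ^+ 2 / t ^+ 2) * t ^+ 2 =
    2 * (`|L (s i)| * (t * t)) ^+ 2 + 2 * (2 * Delta) ^+ 2.
  by rewrite exprMn real_normK ?num_real//; field.
set p := `|L (s i)| * (t * t) in r1 *.
have p0 : 0 <= p by rewrite !mulr_ge0// ltW.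
apply: (@le_trans _ _ ((p + 2 * Delta) ^+ 2)).
  by rewrite ler_pXn2r ?nnegrE// addr_ge0// mulr_ge0.
by have := sqr_ge0 (p - 2 * Delta); nra.
Qed.

End finite_difference.

Lemma exp1_le4 (R : realType) : expR 1 <= 4 :> R.
Proof.
have h : expR (1 / 2) <= 2 :> R.
  by rewrite -[leRHS](@lnK R 2) ?posrE// ler_expR ln2_ge_half.
have -> : (1 : R) = 1 / 2 + 1 / 2 by field.
rewrite expRD; have := ler_pM (expR_ge0 _) (expR_ge0 _) h h.
by move=> /le_trans; apply; lra.
Qed.

Lemma expr_1DinvN_le4 (R : realType) (N : nat) : (0 < N)%N -> (1 + N%:R^-1) ^+ N <= 4 :> R.
Proof.
move=> N0; apply: le_trans (exp1_le4 R).
have -> : expR 1 = expR (N%:R^-1) ^+ N :> R.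
  by rewrite -expRM_natl mulfV// pnatr_eq0 -lt0n.
by rewrite lerXn2r ?nnegrE ?addr_ge0 ?invr_ge0 ?ler0n ?expR_ge0// expR_ge1Dx.
Qed.

(** * The mirror descent step *)

Section mirror_step.
Context {R : realType} {n p : nat}.
Hypotheses (n8 : (8 <= n)%N) (p12 : p = 1%N \/ p = 2%N).
Implicit Types (x y u v s : 'rV[R]_n).

Let d := @prox R p n.

Lemma bregman_prox_ge0 x y : 0 <= bregman d x y.
Proof.
apply: le_trans (bregman_prox_ge n8 p12 x y).
by rewrite divr_ge0// sqr_ge0.
Qed.

Lemma dot_le_bregman_prox x y : dot (y - x) (y - x) <= 8 * bregman d x y.
Proof.
have h1 := bregman_prox_ge n8 p12 x y; have h2 := dot_le_prox_norm p12 (y - x).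
by rewrite -ler_pdivrMl// mulrC (le_trans _ h1)// ler_pM2r// invr_gt0.
Qed.

(** The two divergences between [x] and [y] add up to <grad d x - grad d y, x - y>, and each is at
    least an eighth of the squared distance. *)
Lemma gradient_prox_expansive x y :
  norm2 (x - y) <= 4 * norm2 (gradient d x - gradient d y).
Proof.
have h1 := dot_le_bregman_prox x y; have h2 := dot_le_bregman_prox y x.
have [->|/eqP nz] := eqVneq (norm2 (x - y)) 0; first by rewrite mulr_ge0 ?norm2_ge0.
have np : 0 < norm2 (x - y) by rewrite lt_def norm2_ge0 andbT; apply/eqP.
rewrite -(ler_pM2r np) -expr2 norm2_sq.
have := le_trans (ler_norm _) (dot_norm2 (gradient d x - gradient d y) (x - y)).
have e1 : dot (y - x) (y - x) = dot (x - y) (x - y).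
  by rewrite -[y - x]opprB dotNl dotNr opprK.
have e2 : bregman d x y + bregman d y x = dot (gradient d x - gradient d y) (x - y).
  by rewrite /bregman dotBl -[y - x]opprB dotNr; ring.
rewrite -e2 => h3; rewrite e1 in h1; move: h1 h2 h3.
set A := bregman d x y; set B := bregman d y x; set Q := dot _ _; set M := norm2 _ * norm2 _.
rewrite -mulrA -/M; lra.
Qed.

Section dual_weight.
Variable S : 'rV[R]_n -> R.
Hypotheses (S0 : forall v, 0 <= S v)
  (Sd : forall v y, dot v y ^+ 2 <= S v * prox_norm p y ^+ 2).

(** Twice the geometric mean of z / 8 and 2 c^2 S is the square root of c^2 S z, which dominates the
    inner product. Besides the mirror step, this gives the nonnegativity of [descent] that Tonelli
    requires. *)
Lemma mirror_step_ge0 x u s (c : R) :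
  0 <= bregman d x u - c * dot s (x - u) + 2 * (c ^+ 2 * S s).
Proof.
have h1 := bregman_prox_ge n8 p12 x u; have h2 := Sd s (u - x); have h3 := S0 s.
rewrite -[x - u]opprB dotNr mulrN opprK; rewrite -/d in h1.
set q := dot s (u - x) in h2 *; set Br := bregman d x u in h1 *.
set z := prox_norm p (u - x) ^+ 2 in h1 h2.
have z0 : 0 <= z by exact: sqr_ge0.
suff : - (c * q) <= z / 8 + 2 * (c ^+ 2 * S s) by lra.
have r0 : 0 <= z / 8 + 2 * (c ^+ 2 * S s).
  by apply: addr_ge0; [exact: divr_ge0|apply: mulr_ge0 => //; apply: mulr_ge0 => //; exact: sqr_ge0].
apply: le_trans (ler_norm _) _; rewrite normrN.
rewrite -(@ler_pXn2r _ 2)// ?nnegrE// real_normK ?num_real// exprMn.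
have h4 := ler_wpM2l (sqr_ge0 c) h2.
apply: (le_trans h4).
have := sqr_ge0 (z / 8 - 2 * (c ^+ 2 * S s)).
set b := S s; set a := c ^+ 2 => h; rewrite -subr_ge0.
by rewrite (_ : _ - _ = (z / 8 - 2 * (a * b)) ^+ 2) //; field.
Qed.

(** The three-point identity leaves the bracket V[x](xp) - c <s, x - xp>, which [mirror_step_ge0] at
    [xp] bounds from below. *)
Lemma mirror_step_bound x u s xp (c : R) :
  gradient d xp = gradient d x - c *: s ->
  bregman d xp u <= bregman d x u - c * dot s (x - u) + 2 * (c ^+ 2 * S s).
Proof.
move=> gxp; have h := mirror_step_ge0 x xp s c.
suff : bregman d xp u = bregman d x u - c * dot s (x - u) -
    (bregman d x xp - c * dot s (x - xp)) by move: h; lra.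
rewrite {1}/bregman gxp dotBl dotZl /bregman.
have -> : dot (gradient d x) (u - x) = dot (gradient d x) (u - xp) + dot (gradient d x) (xp - x).
  by rewrite -dotDr; congr dot; apply/rowP => i; rewrite !mxE; ring.
have -> : dot s (u - xp) = - dot s (x - u) + dot s (x - xp).
  by rewrite -dotNr -dotDr; congr dot; apply/rowP => i; rewrite !mxE; ring.
by ring.
Qed.

End dual_weight.

End mirror_step.

(** * The numerical constants *)

Lemma error_budget (R : realFieldType) (eps u1 u2 u3 : R) : 0 < eps ->
  u1 <= eps / 10 -> u2 <= eps -> u3 <= 96 * 480 * eps ->
  u1 / 3 + u2 / 300 / 1000 + u3 / 600 / 1000 <= eps / 3.
Proof. by move=> *; lra. Qed.

Section parameters.
Context {R : realType} {n p : nat}.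
Hypotheses (n8 : (8 <= n)%N) (p12 : p = 1%N \/ p = 2%N).
Variables (L2 Theta eps sigma : R) (N m : nat).
Hypotheses (L20 : 0 < L2) (Theta0 : 0 < Theta) (eps0 : 0 < eps).
Hypotheses (N0 : (0 < N)%N) (m0 : (0 < m)%N).

Let A := if p == 1%N then ln n%:R * L2 * Theta / eps else n%:R * L2 * Theta / eps.
Let M := Num.max 1 (sigma ^+ 2 / (L2 * eps)).
Let D := Num.min (eps / n%:R) (eps ^+ 2 / (n%:R * L2 * Theta)).
Let T := Num.min (Num.sqrt (eps / (n%:R * L2)))
                 (eps / Num.sqrt (n%:R * L2 ^+ 2 * Theta)).
Let rh : R := rho p n.

Let np : 0 < n%:R :> R. Proof. by rewrite ltr0n (leq_trans _ n8). Qed.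
Let l8 : 3 / 2 <= ln n%:R :> R := ln_nat_ge n8.
Let rp : 0 < rh. Proof. exact: rho_gt0. Qed.
Let Np : 0 < N%:R :> R. Proof. by rewrite ltr0n. Qed.
Let mp : 0 < m%:R :> R. Proof. by rewrite ltr0n. Qed.

Lemma noise_level_gt0 : 0 < D.
Proof. by rewrite lt_min !divr_gt0 ?mulr_gt0 ?exprn_gt0. Qed.

(** The two terms of the minimum [T] are the square roots of those of [D], divided by L2. *)
Lemma smoothing_sqr : 0 < T /\ T ^+ 2 = D / L2.
Proof.
have a0 : 0 < eps / (n%:R * L2) by rewrite divr_gt0 ?mulr_gt0.
have b0 : 0 < n%:R * L2 ^+ 2 * Theta by rewrite !mulr_gt0 ?exprn_gt0.
have T0 : 0 < T by rewrite lt_min sqrtr_gt0 a0 divr_gt0 ?sqrtr_gt0.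
split => //.
have -> : T = Num.sqrt (D / L2).
  rewrite /T -[X in X / Num.sqrt _]ger0_norm ?(ltW eps0)// -sqrtr_sqr -sqrtrV ?(ltW b0)//.
  rewrite -sqrtrM ?sqr_ge0// /D minr_pMl ?invr_ge0 ?(ltW L20)//.
  have -> : eps / n%:R / L2 = eps / (n%:R * L2) by field; rewrite !gt_eqF.
  have -> : eps ^+ 2 / (n%:R * L2 * Theta) / L2 = eps ^+ 2 / (n%:R * L2 ^+ 2 * Theta).
    by field; rewrite !gt_eqF.
  have [ab|ba] := leP (eps / (n%:R * L2)) (eps ^+ 2 / (n%:R * L2 ^+ 2 * Theta)).
    by rewrite min_l// ler_wsqrtr.
  by rewrite min_r// ler_wsqrtr// ltW.
by rewrite sqr_sqrtr// divr_ge0 ?(ltW noise_level_gt0) ?ltW.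
Qed.

(* As T ^+ 2 = D / L2, the squared bias t^2 L2^2 + Delta^2 / t^2 of the finite
   differences is a small multiple of L2 D when t = ct T and Delta = cDelta D. *)
Lemma bias_bound (ct cDelta : R) : 0 < ct -> 0 < cDelta ->
  2 * (ct * T) ^+ 2 * L2 ^+ 2 + 8 * (cDelta * D) ^+ 2 / (ct * T) ^+ 2 =
  (2 * ct ^+ 2 + 8 * cDelta ^+ 2 / ct ^+ 2) * (L2 * D).
Proof.
move=> ct0 cD0; have [_ T2] := smoothing_sqr; have D0 := noise_level_gt0.
rewrite !exprMn T2; field; rewrite !gt_eqF//.
Qed.

Let nDle : n%:R * D <= eps.
Proof. by rewrite -ler_pdivlMl// mulrC ge_min lexx. Qed.

Let ADle : A * D <= 8^-1 * (8 * eps * rh).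
Proof.
have Dle : D <= eps ^+ 2 / (n%:R * L2 * Theta) by rewrite ge_min lexx orbT.
have A0 : 0 < A by rewrite /A; case: ifP => _; rewrite !mulr_gt0 ?invr_gt0//; have := l8; lra.
apply: (le_trans (ler_wpM2l (ltW A0) Dle)).
rewrite /A /rh; case: p12 => ->; rewrite /= ?rho1E ?rho2E//.
  rewrite [leLHS](_ : _ = ln n%:R * (eps / n%:R)); last by field; rewrite !gt_eqF.
  rewrite [leRHS](_ : _ = (16 * ln n%:R - 8) * (eps / n%:R)); last by field; rewrite !gt_eqF.
  by rewrite ler_wpM2r ?divr_ge0 ?ltW//; have := l8; lra.
by rewrite le_eqVlt; apply/orP; left; apply/eqP; field; rewrite !gt_eqF.
Qed.

(** For both values of [p] the left-hand side is at most 48 * 16 * A eps = 768 A eps, and 48 * 480 =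
    30 * 768. *)
Let steps_large : (48 * 480) * A <= N%:R -> 48 * n%:R * rh * L2 * Theta <= N%:R * eps / 30.
Proof.
move=> /(ler_wpM2r (ltW eps0)) h.
apply: (@le_trans _ _ (768 * (A * eps))); last by move: h; lra.
have LT : 0 < L2 * Theta by rewrite mulr_gt0.
rewrite /A /rh; case: p12 => ->; rewrite /= ?rho1E ?rho2E//.
  rewrite (_ : _ * eps = ln n%:R * (L2 * Theta)); last by field; rewrite gt_eqF.
  rewrite [leLHS](_ : _ = 48 * (16 * ln n%:R - 8) * (L2 * Theta)); last by field; rewrite gt_eqF.
  by rewrite [leRHS]mulrA ler_wpM2r ?(ltW LT)//; lra.
rewrite (_ : _ * eps = n%:R * (L2 * Theta)); last by field; rewrite gt_eqF.
have := mulr_gt0 np LT; set z := n%:R * (L2 * Theta) => z0.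
by rewrite [leLHS](_ : _ = 48 * z); [lra|rewrite /z; ring].
Qed.

(** Multiplied by 1 / alpha, the left-hand side splits into the initial divergence, the variance and
    two bias terms. The last bias term is proportional to N, through the weight of Young's
    inequality, so it is the upper bound on N that keeps it below a multiple of eps. *)
Lemma complexity_bound (ct cDelta : R) (alpha := (48 * n%:R * rh * L2)^-1)
    (d2 := 2 * (ct * T) ^+ 2 * L2 ^+ 2 + 8 * (cDelta * D) ^+ 2 / (ct * T) ^+ 2) :
  ct = 1 / 1000 -> cDelta = 1 / (1000 * 1000) ->
  (48 * 480) * A <= N%:R -> N%:R <= 2 * (48 * 480) * A -> 10 * M <= m%:R ->
  4 * (Theta + N%:R * (4 * alpha ^+ 2 * n%:R * rh * sigma ^+ 2 / m%:R +
         4 * alpha ^+ 2 * n%:R ^+ 2 * rh * d2 + 2 * alpha ^+ 2 * n%:R * N%:R * d2)) <=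
  2 * alpha / 3 * (N%:R * eps).
Proof.
move=> ctE cDE hN1 hN2 hm.
have ct0 : 0 < ct by rewrite ctE; lra.
have cD0 : 0 < cDelta by rewrite cDE; lra.
(* With cDelta = ct^2 = 10^-6 the coefficient 2 ct^2 + 8 cDelta^2 / ct^2 is 10^-5. *)
have d2E : d2 = L2 * D / (100 * 1000).
  by rewrite /d2 bias_bound// ctE cDE; field.
have h1 := steps_large hN1.
have Mle : sigma ^+ 2 / (L2 * eps) <= M by rewrite le_max lexx orbT.
have h2 : sigma ^+ 2 / (L2 * m%:R) <= eps / 10.
  rewrite ler_pdivrMr ?mulr_gt0// [leRHS](_ : _ = m%:R / 10 * (L2 * eps)); last by field.
  by rewrite -ler_pdivrMr ?mulr_gt0//; lra.
have h3 : N%:R * D / rh <= 96 * 480 * eps.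
  rewrite ler_pdivrMr//; have := ler_wpM2r (ltW noise_level_gt0) hN2; have := ADle.
  by rewrite -!mulrA; lra.
have K0 : 0 < 48 * n%:R * rh * L2 by apply: mulr_gt0 => //; apply: mulr_gt0 => //; exact: mulr_gt0.
rewrite -(ler_pM2l K0).
have -> : 48 * n%:R * rh * L2 * (2 * alpha / 3 * (N%:R * eps)) = 2 / 3 * (N%:R * eps).
  by rewrite /alpha; field; rewrite !gt_eqF.
have -> : 48 * n%:R * rh * L2 * (4 * (Theta + N%:R * (4 * alpha ^+ 2 * n%:R * rh * sigma ^+ 2 / m%:R +
         4 * alpha ^+ 2 * n%:R ^+ 2 * rh * d2 + 2 * alpha ^+ 2 * n%:R * N%:R * d2))) =
    4 * (48 * n%:R * rh * L2 * Theta) + N%:R * (sigma ^+ 2 / (L2 * m%:R) / 3 +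
     n%:R * D / 300 / 1000 + (N%:R * D / rh) / 600 / 1000).
  by rewrite d2E /alpha; field; rewrite !gt_eqF.
have h4 : sigma ^+ 2 / (L2 * m%:R) / 3 + n%:R * D / 300 / 1000 + (N%:R * D / rh) / 600 / 1000 <= eps / 3.
  exact: error_budget.
have h5 := ler_wpM2l (ltW Np) h4; have Ne := mulr_gt0 Np eps0.
have lin (u v w : R) : u <= w / 30 -> v <= w / 3 -> 0 < w -> 4 * u + v <= 2 / 3 * w.
  by move=> *; lra.
by apply: lin => //; rewrite -[leRHS]mulrA.
Qed.

(** The maximum is the product of A and M, and 4 * 480 * 480 is the product of 2 * 48 * 480 and 2 *
    10. *)
Lemma oracle_calls_bound : N%:R <= 2 * (48 * 480) * A -> m%:R <= 2 * 10 * M ->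
  (N * m)%:R <= 4 * (480 * 480) *
    (if p == 1%N then Num.max (L2 * Theta * ln n%:R / eps) (sigma ^+ 2 * Theta * ln n%:R / eps ^+ 2)
     else Num.max (n%:R * L2 * Theta / eps) (n%:R * sigma ^+ 2 * Theta / eps ^+ 2)).
Proof.
move=> hN hm.
have A0 : 0 < A by rewrite /A; case: ifP => _; rewrite !mulr_gt0 ?invr_gt0//; have := l8; lra.
have -> : (if p == 1%N then Num.max (L2 * Theta * ln n%:R / eps) (sigma ^+ 2 * Theta * ln n%:R / eps ^+ 2)
     else Num.max (n%:R * L2 * Theta / eps) (n%:R * sigma ^+ 2 * Theta / eps ^+ 2)) = A * M.
  rewrite /A /M maxr_pMr ?(ltW A0)// /A mulr1; case: ifP => _; congr Num.max;
    by field; rewrite !gt_eqF.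
rewrite natrM; apply: (le_trans (ler_pM (ler0n _ _) (ler0n _ _) hN hm)).
by rewrite le_eqVlt; apply/orP; left; apply/eqP; ring.
Qed.

End parameters.

(** * Convergence of RDFDS *)

Section draws.
Context {R : realType} {n N m : nat} {dX dO : measure_display}.
Context {X : measurableType dX} {Omega : measurableType dO}.
Variables (P : probability X R) (Pr : probability Omega R).
Variables (e : 'I_N -> {RV Pr >-> 'rV[R]_n}) (xi : 'I_N -> 'I_m -> {RV Pr >-> X}).
Hypothesis rand : rdfds_randomness P e xi.

Definition draw := ('I_N + 'I_N * 'I_m)%type.

Definition draw_events (j : draw) : set (set Omega) :=
  match j with
  | inl k => g_sigma_algebra_preimage (e k)
  | inr (k, i) => g_sigma_algebra_preimage (xi k i)
  end.

Lemma draw_events_setT j : draw_events j setT.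
Proof. by case: j => [k|[k i]] /=; exists setT => //; rewrite setTI preimage_setT. Qed.

Lemma draw_events_setI j : setI_closed (draw_events j).
Proof.
by case: j => [k|[k i]] A B [A' mA <-] [B' mB <-];
  exists (A' `&` B'); rewrite ?setTI ?preimage_setI//; exact: measurableI.
Qed.

Lemma draw_events_measurable j : draw_events j `<=` measurable.
Proof. by case: j => [k|[k i]] _ [A mA <-]; exact: measurable_funPT. Qed.

Definition iteration (j : draw) : 'I_N :=
  match j with inl k => k | inr (k, _) => k end.

Definition past (k : nat) : {set draw} := finset.finset (fun j => iteration j < k)%N.

Definition present (k : 'I_N) : {set draw} := finset.finset (fun j => iteration j == k).

Notation block := (block draw_events).

Lemma past_present (k : 'I_N) : {in past k, forall j, j \notin present k}.
Proof. by move=> j; rewrite !inE => jk; rewrite neq_ltn jk. Qed.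

Lemma past_sub (k : nat) : past k \subset past k.+1.
Proof. by apply/fintype.subsetP => j; rewrite !inE => /ltnW. Qed.

Lemma present_sub_past (k : 'I_N) : present k \subset past k.+1.
Proof. by apply/fintype.subsetP => j; rewrite !inE => /eqP ->. Qed.

Let measurable_draw {d} {T : measurableType d} (U : Omega -> T) (J : {set draw}) j :
  j \in J -> draw_events j = preimage_set_system setT U measurable ->
  measurable_fun setT (U : block J -> T).
Proof.
move=> jJ E _ A mA; apply: sub_sigma_algebra; apply: (cylinders1 draw_events_setT jJ).
by rewrite E; exists A.
Qed.

Lemma measurable_direction (J : {set draw}) k :
  inl k \in J -> measurable_fun setT (e k : block J -> 'rV[R]_n).
Proof. by move=> kJ; apply: (measurable_draw kJ). Qed.

Lemma measurable_sample (J : {set draw}) k i :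
  inr (k, i) \in J -> measurable_fun setT (xi k i : block J -> X).
Proof. by move=> kJ; apply: (measurable_draw kJ). Qed.

Lemma direction_present k : inl k \in present k.
Proof. by rewrite inE. Qed.

Lemma sample_present k i : inr (k, i) \in present k.
Proof. by rewrite inE. Qed.

Let law_e k A : measurable A -> Pr (e k @^-1` A) = distribution Pr (e k) A.
Proof. by []. Qed.

Let law_xi k i A : measurable A -> Pr (xi k i @^-1` A) = P A.
Proof. exact: (samples_law rand). Qed.

Let me k : measurable_fun setT (e k). Proof. exact: measurable_funPT. Qed.
Let mxi k i : measurable_fun setT (xi k i). Proof. exact: measurable_funPT. Qed.

Let expectationM := block_expectationM draw_events_setI draw_events_measurable
  (draws_independent rand).

Lemma expectation_sample_direction k i (a : X -> R) (phi : 'rV[R]_n -> R) :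
  L1 P a -> sphere_bounded phi ->
  L1 Pr (fun w => a (xi k i w) * phi (e k w)) /\
  \int[Pr]_w (a (xi k i w) * phi (e k w)) =
    \int[P]_y a y * \int[distribution Pr (e k)]_v phi v.
Proof.
move=> La bphi; have mphi : measurable_fun setT phi by case: bphi.
have Lphi := sphere_bounded_L1 (directions_uniform rand k) bphi.
rewrite (Rintegral_law (mxi k i) (@law_xi k i) La) (Rintegral_law (me k) (@law_e k) Lphi).
apply: (expectationM (J1 := finset.set1 (inr (k, i))) (J2 := finset.set1 (inl k))
  (Y1 := a \o xi k i) (Y2 := phi \o e k)).
- by move=> j; rewrite !inE => /eqP ->.
- apply: measurableT_comp (L1_measurable La) _; apply: measurable_sample.
  by rewrite inE.
- apply: measurableT_comp mphi _; apply: measurable_direction.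
  by rewrite inE.
- exact: L1_law (mxi k i) (@law_xi k i) _ La.
- exact: L1_law (me k) (@law_e k) _ Lphi.
Qed.

(** Sample [j] and the direction form one block, independent of sample [i]; the previous lemma then
    factors that block. *)
Lemma expectation_samples_direction k i j (a b : X -> R) (phi : 'rV[R]_n -> R) :
  i != j -> L1 P a -> L1 P b -> sphere_bounded phi ->
  L1 Pr (fun w => a (xi k i w) * b (xi k j w) * phi (e k w)) /\
  \int[Pr]_w (a (xi k i w) * b (xi k j w) * phi (e k w)) =
    \int[P]_y a y * \int[P]_y b y * \int[distribution Pr (e k)]_v phi v.
Proof.
move=> ij La Lb bphi; have mphi : measurable_fun setT phi by case: bphi.
have [Lbphi Ebphi] := expectation_sample_direction k j Lb bphi.
rewrite -mulrA -Ebphi (Rintegral_law (mxi k i) (@law_xi k i) La).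
have -> : (fun w => a (xi k i w) * b (xi k j w) * phi (e k w)) =
    (fun w => a (xi k i w) * (b (xi k j w) * phi (e k w))).
  by apply/funext => w; rewrite mulrA.
apply: (expectationM (J1 := finset.set1 (inr (k, i)))
  (J2 := finset.setU (finset.set1 (inr (k, j))) (finset.set1 (inl k)))
  (Y1 := a \o xi k i) (Y2 := fun w => b (xi k j w) * phi (e k w))).
- move=> l; rewrite !inE => /eqP ->; rewrite orbF.
  by apply: contra ij => /eqP[->].
- apply: measurableT_comp (L1_measurable La) _; apply: measurable_sample.
  by rewrite inE.
- apply: measurable_funM.
    apply: measurableT_comp (L1_measurable Lb) _; apply: measurable_sample.
    by rewrite !inE eqxx.
  apply: measurableT_comp mphi _; apply: measurable_direction.
  by rewrite !inE eqxx orbT.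
- exact: L1_law (mxi k i) (@law_xi k i) _ La.
- exact: Lbphi.
Qed.

End draws.

(** As 48 n rho L2 alpha = 1, the part of the quadratic term due to [mq] is at most alpha phi / 3,
    so adding 2 alpha phi / 3 exhausts the decrease - alpha phi. The weight 4 alpha N turns [vv]
    into vv / (8 N) <= V / N. *)
Lemma step_arithmetic (R : realFieldType) (n N m : nat)
    (rh L2 phi V mq dm vv s2 d2 q : R) (alpha := (48 * n%:R * rh * L2)^-1) :
  (0 < n)%N -> (0 < N)%N -> (0 < m)%N -> 0 < rh -> 0 < L2 -> 0 <= d2 -> 0 <= s2 ->
  0 <= q -> q <= rh ->
  0 <= mq -> mq <= 4 * L2 * phi -> phi <= dm -> vv <= 8 * V ->
  - (alpha * n%:R) * (dm / n%:R) +
  alpha * n%:R / 2 * (4 * alpha * N%:R * d2 + vv / (n%:R * (4 * alpha * N%:R))) +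
  2 * (2 * (alpha * n%:R) ^+ 2) * ((mq + s2 / m%:R) / n%:R + d2) * q + 2 * alpha / 3 * phi <=
  V / N%:R + (4 * alpha ^+ 2 * n%:R * rh * s2 / m%:R +
    4 * alpha ^+ 2 * n%:R ^+ 2 * rh * d2 + 2 * alpha ^+ 2 * n%:R * N%:R * d2).
Proof.
move=> n0 N0 m0 rh0 L20 d20 s20 q0 qrh mq0 hmq hdm hvv.
have np : 0 < n%:R :> R by rewrite ltr0n.
have Np : 0 < N%:R :> R by rewrite ltr0n.
have mp : 0 < m%:R :> R by rewrite ltr0n.
have a0 : 0 < alpha by rewrite invr_gt0 !mulr_gt0.
have aE : alpha * (48 * n%:R * rh * L2) = 1 by rewrite mulVf// gt_eqF// !mulr_gt0.
have t1 : - (alpha * n%:R) * (dm / n%:R) <= - (alpha * phi).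
  rewrite (_ : - (alpha * n%:R) * (dm / n%:R) = - (alpha * dm)); last by field; rewrite gt_eqF.
  by rewrite lerN2 ler_pM2l.
have t2 : alpha * n%:R / 2 * (4 * alpha * N%:R * d2 + vv / (n%:R * (4 * alpha * N%:R))) <=
    2 * alpha ^+ 2 * n%:R * N%:R * d2 + V / N%:R.
  rewrite (_ : alpha * n%:R / 2 * _ = 2 * alpha ^+ 2 * n%:R * N%:R * d2 + vv / 8 / N%:R); last first.
    by field; rewrite !gt_eqF.
  rewrite lerD2l ler_pM2r ?invr_gt0//; lra.
have t3 : 2 * (2 * (alpha * n%:R) ^+ 2) * ((mq + s2 / m%:R) / n%:R + d2) * q <=
    alpha * phi / 3 + 4 * alpha ^+ 2 * n%:R * rh * s2 / m%:R + 4 * alpha ^+ 2 * n%:R ^+ 2 * rh * d2.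
  apply: (@le_trans _ _ (2 * (2 * (alpha * n%:R) ^+ 2) * ((4 * L2 * phi + s2 / m%:R) / n%:R + d2) * rh)).
    have c0 : 0 <= 2 * (2 * (alpha * n%:R) ^+ 2).
      by apply: mulr_ge0 => //; apply: mulr_ge0 => //; exact: sqr_ge0.
    have i0 : 0 <= (mq + s2 / m%:R) / n%:R + d2.
      by apply: addr_ge0 => //; apply: divr_ge0; [apply: addr_ge0 => //; exact: divr_ge0|exact: ltW].
    apply: ler_pM => //; first exact: mulr_ge0.
    by apply: ler_wpM2l => //; rewrite lerD2r ler_pM2r ?invr_gt0// lerD2r.
  rewrite le_eqVlt; apply/orP; left; apply/eqP.
  transitivity (alpha * (48 * n%:R * rh * L2) * (alpha * phi / 3) + 4 * alpha ^+ 2 * n%:R * rh * s2 / m%:R + 4 * alpha ^+ 2 * n%:R ^+ 2 * rh * d2); last by rewrite aE mul1r.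
  by field; rewrite !gt_eqF.
lra.
Qed.

(** * Recursion along the run and the averaged output *)

Section rdfds.
Context {R : realType} {n p N m : nat} {dX dO : measure_display}.
Context {X : measurableType dX} {Omega : measurableType dO}.
Variables (P : probability X R) (Pr : probability Omega R).
Variables (F : 'rV[R]_n -> X -> R) (g : 'rV[R]_n -> X -> 'rV[R]_n) (L : X -> R).
Variables (L2 sigma : R) (eta : 'rV[R]_n -> X -> R) (Delta : R).
Variables (x0 u : 'rV[R]_n) (t : R).
Variables (e : 'I_N -> {RV Pr >-> 'rV[R]_n}) (xi : 'I_N -> 'I_m -> {RV Pr >-> X}).
Variable x : nat -> Omega -> 'rV[R]_n.
Hypotheses (n8 : (8 <= n)%N) (p12 : p = 1%N \/ p = 2%N).
Hypothesis pb : problem_assumptions P F g L L2 sigma.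
Hypothesis noise : noise_assumptions P eta Delta.
Hypotheses (N0 : (0 < N)%N) (m0 : (0 < m)%N) (t0 : 0 < t).
Hypothesis rand : rdfds_randomness P e xi.

Let d := @prox R p n.
Let rh : R := rho p n.
Let alpha := (48 * n%:R * rh * L2)^-1.
Let f := objective P F.

Hypothesis run : forall w, rdfds_run (oracle F eta) t alpha d x0
  (fun k => e k w) (fun k i => xi k i w) (fun k => x k w).
Hypothesis umin : is_minimizer f u.

Let n0 : (0 < n)%N. Proof. exact: leq_trans n8. Qed.
Let rp : 0 < rh. Proof. exact: rho_gt0. Qed.
Let L2p : 0 < L2 := L2_gt0 pb.
Let a0 : 0 < alpha.
Proof. by rewrite invr_gt0; apply: mulr_gt0 => //; apply: mulr_gt0 => //; apply: mulr_gt0; rewrite ?ltr0n. Qed.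

Notation block := (block (draw_events e xi)).

Let theta k y w := finite_difference F eta t y (e k w) (fun i => xi k i w).

Lemma gradient_iterate (k : 'I_N) w :
  gradient d (x k.+1 w) =
  gradient d (x k w) - (alpha * n%:R * theta k (x k w) w) *: e k w.
Proof.
have [_ /(_ k)] := run w; rewrite gradient_approximation_finite_difference => xmin.
rewrite -scalerA; apply: bregman_minimizer => [i|]; first exact: derivable_prox.
by move=> y; have := xmin y; rewrite !dotZl.
Qed.

(* gradient d is injective with a Borel left inverse, so that the minimization
   defining x k.+1 yields a measurable function of the first k.+1 rounds of draws. *)
Lemma measurable_iterate (k : nat) : (k <= N)%N ->
  measurable_fun setT (x k : block (past k) -> 'rV[R]_n) /\
  measurable_fun setT ((fun w => gradient d (x k w)) : block (past k) -> 'rV[R]_n).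
Proof.
have [Phi mPhi PhiK] := lipschitz_left_inverse (ler0n R 4) (gradient_prox_expansive n8 p12).
elim: k => [_|k IH kN].
  have -> : x 0 = cst x0 by apply/funext => w; exact: (run w).1.
  by split; [exact: measurable_cst|exact: (measurable_cst (gradient d x0))].
have [mx mg] := IH (ltnW kN); pose K := Ordinal kN.
have mx' := measurable_block_sub (draw_events_setT e xi) (past_sub k) mx.
have mg' := measurable_block_sub (draw_events_setT e xi) (past_sub k) mg.
have sub := fintype.subsetP (present_sub_past K).
have me : measurable_fun setT (e K : block (past k.+1) -> 'rV[R]_n).
  by apply: measurable_direction; apply: sub; exact: direction_present.
have mxi i : measurable_fun setT (xi K i : block (past k.+1) -> X).
  by apply: measurable_sample; apply: sub; exact: sample_present.
have mG : measurable_fun setT ((fun w => gradient d (x k.+1 w)) : block (past k.+1) -> 'rV[R]_n).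
  under eq_fun do rewrite (gradient_iterate K) -scaleNr.
  apply: measurable_rowD => //; apply: measurable_rowZ => //.
  apply: measurableT_comp => //; apply: measurable_funM => //.
  exact: measurable_finite_difference (measurable_F pb) (proj1 noise) mx' me mxi.
split => //.
have -> : x k.+1 = fun w => Phi (gradient d (x k.+1 w)) by apply/funext => w; rewrite PhiK.
exact: measurableT_comp mPhi mG.
Qed.

Let V k w := bregman d (x k w) u.

Lemma measurable_bregman_iterate k : (k <= N)%N -> measurable_fun setT (V k : block (past k) -> R).
Proof.
move=> kN; have [mx mg] := measurable_iterate kN.
apply: measurable_funB.
  apply: measurable_funB; first exact: measurable_cst.
  exact: measurableT_comp (measurable_prox p12) mx.
apply: measurable_dot => //; apply: measurable_rowD; first exact: measurable_cst.
under eq_fun do rewrite -scaleN1r.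
exact: measurable_rowZ (measurable_cst _) mx.
Qed.

Let c1 := 2 * t ^+ 2.
Let c2 := 8 * Delta ^+ 2 / t ^+ 2.

Lemma finite_difference_bias k y : {ae Pr, forall w,
  (theta k y w - dot (mean_gradient P g y) (e k w)
     - dot (mean_noise P g (fun i w => xi k i w) y w) (e k w)) ^+ 2 <=
  c1 * (m%:R^-1 * \sum_(i < m) L (xi k i w) ^+ 2) + c2}.
Proof.
(* A property of almost every point passes to all samples of the round at once, as there are
   finitely many. *)
have aexi Q : {ae P, forall z, Q z} -> {ae Pr, forall w, forall i, Q (xi k i w)}.
  move=> aQ; apply: filter_forall => i.
  by apply: (ae_law (U := xi k i)) aQ => //; exact: (samples_law rand).
have aee : {ae Pr, forall w, dot (e k w) (e k w) = 1}.
  by apply: (ae_law (U := e k)) (ae_sphere (directions_uniform rand k)).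
have := aexi _ (proj2 noise); have := aexi _ (sample_taylor pb); move: aee.
apply: filterS3 => w ew Fw etaw.
have := @finite_difference_error R n _ X F eta m t g L Delta y (e k w) (fun i => xi k i w) m0 t0 ew Fw etaw.
congr (_ ^+ 2 <= _); rewrite /theta -addrA -opprD; congr (_ - _).
rewrite /mean_noise dotZl dot_suml.
under [in RHS]eq_bigr do rewrite /gradient_noise dotBl.
set q := dot (mean_gradient P g y) (e k w).
have qE : \sum_(i < m) q = m%:R * q by rewrite sumr_const card_ord -[LHS]mulr_natl.
rewrite sumrB qE mulrBr mulKf ?pnatr_eq0 -?lt0n//.
by rewrite addrC subrK.
Qed.

Variable S : 'rV[R]_n -> R.
Hypotheses (bS : sphere_bounded S) (iS : signed_permutation_invariant S)
  (S0 : forall v, 0 <= S v)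
  (Sd : forall v y, dot v y ^+ 2 <= S v * prox_norm p y ^+ 2)
  (Sint : forall U : probability 'rV[R]_n R, uniform_on_sphere U -> \int[U]_v S v <= rh).

Let phi y := f y - f u.

Let phi0 y : 0 <= phi y. Proof. by rewrite subr_ge0. Qed.

Let a := alpha * n%:R.

(* Upper bound for the next Bregman divergence when the current iterate is y;
   decoupling y from the draw w makes Tonelli's theorem applicable. *)
Let descent k y w := bregman d y u - (a * theta k y w) * dot (e k w) (y - u)
  + 2 * ((a * theta k y w) ^+ 2 * S (e k w)) + 2 * alpha / 3 * phi y.

Let c0 : 0 <= 2 * alpha / 3. Proof. by rewrite divr_ge0// mulr_ge0// ltW. Qed.

Lemma descent_ge0 k y w : 0 <= descent k y w.
Proof.
by apply: addr_ge0; [exact: (mirror_step_ge0 n8 p12 S0 Sd)|exact: mulr_ge0].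
Qed.

Lemma bregman_iterate_descent (k : 'I_N) w :
  V k.+1 w + 2 * alpha / 3 * phi (x k w) <= descent k (x k w) w.
Proof. by rewrite lerD2r; apply: (mirror_step_bound n8 p12 S0 Sd); exact: gradient_iterate. Qed.

Let B := 4 * alpha ^+ 2 * n%:R * rh * sigma ^+ 2 / m%:R +
  4 * alpha ^+ 2 * n%:R ^+ 2 * rh * (c1 * L2 ^+ 2 + c2) +
  2 * alpha ^+ 2 * n%:R * N%:R * (c1 * L2 ^+ 2 + c2).

Lemma mean_descent_le (k : 'I_N) y :
  (\int[Pr]_w (descent k y w)%:E <= ((1 + N%:R^-1) * bregman d y u + B)%:E)%E.
Proof.
have uk := directions_uniform rand k.
have me : measurable_fun setT (e k) by exact: measurable_funPT.
have mxi i : measurable_fun setT (xi k i) by exact: measurable_funPT.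
have mth : measurable_fun setT (theta k y).
  exact: measurable_finite_difference (measurable_F pb) (proj1 noise) (measurable_cst y) me mxi.
have c10 : 0 <= c1 by rewrite mulr_ge0// sqr_ge0.
have c20 : 0 <= c2 by apply: divr_ge0; [apply: mulr_ge0 => //|]; exact: sqr_ge0.
have lawe A : measurable A -> Pr (e k @^-1` A) = distribution Pr (e k) A by [].
have i1 := expectation_sample_direction rand k.
have i2 i j a b psi := @expectation_samples_direction _ _ _ _ _ _ _ _ _ _ _ _ rand k i j a b psi.
have err := finite_difference_bias k y.
have L1s := estimator_L1_sqr pb m0 n0 uk me lawe i1 i2 mth c10 err bS iS S0.
have L1d := estimator_L1_dot pb m0 n0 uk me lawe i1 i2 mth c10 err (y - u).
have a_ge0 : 0 <= a by rewrite mulr_ge0// ltW.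
have bnd := estimator_bound pb m0 n0 uk me lawe i1 i2 mth c10 err bS iS S0 (y - u)
  (a := a) (b := 2 * a ^+ 2) (lam := 4 * alpha * N%:R) a_ge0.
have b_ge0 : 0 <= 2 * a ^+ 2 by apply: mulr_ge0 => //; exact: sqr_ge0.
have lam0 : 0 < 4 * alpha * N%:R by apply: mulr_gt0; [exact: mulr_gt0|rewrite ltr0n].
have {}bnd := bnd b_ge0 lam0.
set Z := \int[Pr]_w _ in bnd.
set r := bregman d y u + 2 * alpha / 3 * phi y.
pose z w := 2 * a ^+ 2 * (theta k y w ^+ 2 * S (e k w)) - a * (theta k y w * dot (y - u) (e k w)).
have dE : descent k y = fun w => r + z w.
  by apply/funext => w; rewrite /descent /r /z (dotC (y - u)); ring.
have Lz : L1 Pr z by exact: (L1B (L1Z _ L1s) (L1Z _ L1d)).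
rewrite dE -EFin_Rintegral; last exact: (L1D (L1_cst Pr r) Lz).
rewrite RintegralD//; last exact: L1_cst.
rewrite Rintegral_prob_cst lee_fin -/Z.
set mu := mean_gradient P g y in bnd.
have q0 : 0 <= \int[distribution Pr (e k)]_s S s by apply: Rintegral_ge0 => s _.
have d20 : 0 <= c1 * L2 ^+ 2 + c2 by apply: addr_ge0 => //; apply: mulr_ge0 => //; exact: sqr_ge0.
have hdm : phi y <= dot mu (y - u).
  by have := objective_subgradient pb y u; rewrite -opprB dotNr /phi -/f -/mu => h; lra.
have hvv : dot (y - u) (y - u) <= 8 * bregman d y u.
  by rewrite -opprB dotNl dotNr opprK; exact: dot_le_bregman_prox.
have ar := step_arithmetic n0 N0 m0 rp L2p d20 (sqr_ge0 sigma) q0 (Sint uk) (dot_ge0 mu)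
  (mean_gradient_sqr_le pb y umin) hdm hvv.
have lin (T v vN c bb zz : R) : zz <= T -> T + c <= vN + bb -> v + c + zz <= v + vN + bb.
  by move=> *; lra.
rewrite mulrDl mul1r [X in _ <= _ + X + _]mulrC.
exact: (lin _ _ _ _ _ _ bnd ar).
Qed.

(** The iterate lives on the past block and the new draws on the present one, so Tonelli reduces the
    mean of [descent] to [mean_descent_le] with the iterate frozen. Both new integrabilities follow
    by domination, since the two summands are nonnegative. *)
Lemma mean_bregman_recursion (k : 'I_N) v : L1 Pr (V k) -> \int[Pr]_w V k w <= v ->
  [/\ L1 Pr (V k.+1), L1 Pr (fun w => phi (x k w)) &
   \int[Pr]_w V k.+1 w + 2 * alpha / 3 * \int[Pr]_w phi (x k w) <= (1 + N%:R^-1) * v + B].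
Proof.
move=> LV Vv; have kN := ltnW (ltn_ord k).
have GI := draw_events_setI (e := e) (xi := xi).
have Gm := draw_events_measurable (e := e) (xi := xi).
have mx := proj1 (measurable_iterate kN).
have mV := measurable_bregman_iterate kN.
have mf := measurable_objective pb.
pose W := (block (past k) * block (present k))%type.
have mx1 : measurable_fun setT (fun z : W => x k z.1) by exact: measurableT_comp mx measurable_fst.
have mV1 : measurable_fun setT (fun z : W => V k z.1) by exact: measurableT_comp mV measurable_fst.
have me2 : measurable_fun setT (fun z : W => e k z.2).
  by apply: measurableT_comp measurable_snd; apply: measurable_direction; exact: direction_present.
have mxi2 i : measurable_fun setT (fun z : W => xi k i z.2).
  by apply: measurableT_comp measurable_snd; apply: measurable_sample; exact: sample_present.
have mS : measurable_fun setT S by case: bS.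
pose H (z : W) := (descent k (x k z.1) z.2)%:E.
have mH : measurable_fun setT H.
  have mth : measurable_fun setT (fun z : W => a * theta k (x k z.1) z.2).
    apply: measurable_funM => //.
    exact: measurable_finite_difference (measurable_F pb) (proj1 noise) mx1 me2 mxi2.
  apply/measurable_EFinP; apply: measurable_funD; last first.
    apply: measurable_funM => //; apply: measurable_funB => //; exact: measurableT_comp mf mx1.
  apply: measurable_funD; last first.
    apply: measurable_funM => //; apply: measurable_funM; first exact: measurable_funX.
    exact: measurableT_comp mS me2.
  apply: measurable_funB => //; apply: measurable_funM => //; apply: measurable_dot => //.
  exact: measurable_rowD mx1 (measurable_cst _).
have H0 z : (0 <= H z)%E by rewrite lee_fin descent_ge0.
have mVr : measurable_fun setT (V k) by exact: measurable_from_block mV.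
have mVr1 : measurable_fun setT (V k.+1).
  exact: measurable_from_block (measurable_bregman_iterate (ltn_ord k)).
have mphi : measurable_fun setT (fun w => phi (x k w)).
  by apply: measurable_funB => //; apply: measurableT_comp mf _; exact: measurable_from_block mx.
have V0 j w : 0 <= V j w by exact: (bregman_prox_ge0 n8 p12).
have cphi0 w : 0 <= 2 * alpha / 3 * phi (x k w) by exact: mulr_ge0.
have LB : L1 Pr (fun w => (1 + N%:R^-1) * V k w + B) by apply: L1D (L1_cst _ _); exact: L1Z.
have mM : measurable_fun setT (fun w => V k.+1 w + 2 * alpha / 3 * phi (x k w)).
  by apply: measurable_funD => //; exact: measurable_funM.
have [LM EM] : L1 Pr (fun w => V k.+1 w + 2 * alpha / 3 * phi (x k w)) /\
    \int[Pr]_w (V k.+1 w + 2 * alpha / 3 * phi (x k w)) <= (1 + N%:R^-1) * v + B.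
  apply: L1_ge0 => // [w|]; first exact: addr_ge0.
  have mdiag : measurable_fun setT (fun w : Omega => H (w, w)).
    apply: (measurableT_comp mH); apply: measurable_fun_pair.
      exact: (measurable_to_block Gm).
    exact: (measurable_to_block Gm).
  apply: (@le_trans _ _ (\int[Pr]_w H (w, w))%E).
    apply: ge0_le_integral => //.
    - by move=> w _; rewrite lee_fin addr_ge0.
    - exact/measurable_EFinP.
    - by move=> w _; rewrite lee_fin; exact: bregman_iterate_descent.
  rewrite (block_tonelli GI Gm (draws_independent rand) (@past_present _ _ k) mH H0).
  apply: (@le_trans _ _ (\int[Pr]_w ((1 + N%:R^-1) * V k w + B)%:E)%E).
    apply: ge0_le_integral => //.
    - by move=> w _; apply: integral_ge0.
    - exact: (measurable_block_inner Pr Gm mH H0).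
    - by apply/measurable_EFinP; exact: L1_measurable LB.
    - by move=> w _; exact: (mean_descent_le k (x k w)).
  rewrite -EFin_Rintegral// lee_fin RintegralD//; [|exact: L1Z|exact: L1_cst].
  by rewrite RintegralZl// Rintegral_prob_cst lerD2r ler_wpM2l ?addr_ge0 ?invr_ge0 ?ler0n.
have LV1 : L1 Pr (V k.+1).
  by apply: L1_le LM => // w; rewrite ger0_norm// lerDl.
have Lphi : L1 Pr (fun w => phi (x k w)).
  have : L1 Pr (fun w => 2 * alpha / 3 * phi (x k w)).
    apply: L1_le LM => [|w]; first exact: measurable_funM.
    by rewrite ger0_norm// lerDr.
  move=> /(L1Z (2 * alpha / 3)^-1); congr (L1 _ _); apply/funext => w.
  by rewrite mulKf// gt_eqF// divr_gt0// mulr_gt0.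
split => //; move: EM; rewrite RintegralD//; last exact: L1Z.
by rewrite RintegralZl.
Qed.

Let B0 : 0 <= B.
Proof.
have a2 : 0 <= alpha ^+ 2 := sqr_ge0 _.
have d20 : 0 <= c1 * L2 ^+ 2 + c2.
  apply: addr_ge0; first by apply: mulr_ge0; [apply: mulr_ge0 => //|]; exact: sqr_ge0.
  by apply: divr_ge0; [apply: mulr_ge0 => //|]; exact: sqr_ge0.
have rh0 := ltW rp; have s2 := sqr_ge0 sigma.
have n2 : 0 <= n%:R ^+ 2 :> R := sqr_ge0 _.
apply: addr_ge0; first apply: addr_ge0; first apply: divr_ge0 => //.
all: by repeat (apply: mulr_ge0 => //).
Qed.

Variable Theta : R.
Hypothesis Theta_ge : bregman d x0 u <= Theta.

(** A discrete Gronwall argument. *)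
Lemma mean_bregman_le (k : nat) : (k <= N)%N ->
  [/\ L1 Pr (V k), forall j, (j < k)%N -> L1 Pr (fun w => phi (x j w)) &
   \int[Pr]_w V k w + 2 * alpha / 3 * \sum_(j < k) \int[Pr]_w phi (x j w) <=
     (1 + N%:R^-1) ^+ k * (Theta + k%:R * B)].
Proof.
elim: k => [_|k IH kN].
  have -> : V 0 = cst (bregman d x0 u) by apply/funext => w; rewrite /V (run w).1.
  split => //; first exact: L1_cst.
  by rewrite big_ord0 mulr0 addr0 expr0 mul1r mul0r addr0 Rintegral_prob_cst.
have [LV Lp E] := IH (ltnW kN).
have [LV' Lp' E'] := mean_bregman_recursion (k := Ordinal kN) LV (lexx _).
split => // [j|].
  by rewrite ltnS leq_eqVlt => /predU1P[->|]; [exact: Lp'|exact: Lp].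
rewrite big_ord_recr/= [X in _ + X]mulrDr; move: E E'.
have s0 : 0 <= 2 * alpha / 3 * \sum_(j < k) \int[Pr]_w phi (x j w).
  by apply: mulr_ge0 => //; apply: sumr_ge0 => j _; apply: Rintegral_ge0 => w _.
move: s0.
set s := _ * \sum_(j < k) _; set v := \int[Pr]_w V k w; set v' := \int[Pr]_w V _ w.
set q := _ * \int[Pr]_w _ => s0 E E'.
have N1 : 1 <= 1 + N%:R^-1 :> R by rewrite lerDl invr_ge0 ler0n.
have N1' : 0 <= 1 + N%:R^-1 :> R := le_trans ler01 N1.
(* The earlier gaps [s] may be multiplied by 1 + 1 / N as well, being nonnegative; this restores the
   form of the induction hypothesis. *)
apply: (@le_trans _ _ ((1 + N%:R^-1) * (v + s) + B)).
  have := ler_wpM2r s0 N1; rewrite mul1r mulrDr => h; move: E' h.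
  set r := _ * v; set r' := _ * s; lra.
apply: (@le_trans _ _ ((1 + N%:R^-1) * ((1 + N%:R^-1) ^+ k * (Theta + k%:R * B)) + B)).
  by rewrite lerD2r; exact: ler_wpM2l.
have -> : Theta + k.+1%:R * B = (Theta + k%:R * B) + B by rewrite -natr1 mulrDl mul1r addrA.
rewrite mulrA -exprS [leRHS]mulrDr lerD2l -[leLHS]mul1r ler_wpM2r//.
exact: exprn_ege1.
Qed.

Lemma sum_suboptimality_le :
  (forall j, (j < N)%N -> L1 Pr (fun w => phi (x j w))) /\
  2 * alpha / 3 * \sum_(j < N) \int[Pr]_w phi (x j w) <= 4 * (Theta + N%:R * B).
Proof.
have [_ Lp E] := mean_bregman_le (leqnn N); split => //.
have V0 : 0 <= \int[Pr]_w V N w.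
  by apply: Rintegral_ge0 => w _; exact: (bregman_prox_ge0 n8 p12).
have T0 : 0 <= Theta + N%:R * B.
  apply: addr_ge0; last by apply: mulr_ge0 => //; rewrite ler0n.
  by apply: le_trans Theta_ge; exact: (bregman_prox_ge0 n8 p12).
have := ler_wpM2r T0 (expr_1DinvN_le4 R N0); move: E V0.
set q := _ * \sum_(j < N) _; set v := \int[Pr]_w V N w; lra.
Qed.

(** Jensen's inequality, from the subgradient inequality at the average: the linear terms add up to
    zero. *)
Lemma output_suboptimality w :
  phi (rdfds_output N (fun k => x k w)) <= N%:R^-1 * \sum_(j < N) phi (x j w).
Proof.
set xb := rdfds_output _ _; have Np : 0 < N%:R :> R by rewrite ltr0n.
rewrite mulrC ler_pdivlMr//.
have : \sum_(j < N) dot (mean_gradient P g xb) (x j w - xb) <= \sum_(j < N) (phi (x j w) - phi xb).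
  apply: ler_sum => j _; apply: (le_trans (objective_subgradient pb xb (x j w))).
  by rewrite /phi -/f; lra.
have cN (c : R) : \sum_(j < N) c = c * N%:R by rewrite sumr_const card_ord -[LHS]mulr_natr.
suff -> : \sum_(j < N) dot (mean_gradient P g xb) (x j w - xb) = 0 by rewrite sumrB cN subr_ge0.
under eq_bigr do rewrite dotBr.
rewrite sumrB cN {2}/xb /rdfds_output dotZr mulrAC mulVf ?gt_eqF// mul1r.
rewrite dotC dot_suml; apply/eqP; rewrite subr_eq0; apply/eqP.
by apply: eq_bigr => j _; rewrite dotC.
Qed.

Lemma expected_output_le eps : 4 * (Theta + N%:R * B) <= 2 * alpha / 3 * (N%:R * eps) ->
  ('E_Pr[fun w => f (rdfds_output N (fun k => x k w))] - (f u)%:E <= eps%:E)%E.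
Proof.
move=> hB; have [Lp Es] := sum_suboptimality_le.
have Np : 0 < N%:R :> R by rewrite ltr0n.
have cp : 0 < 2 * alpha / 3 by rewrite divr_gt0// mulr_gt0.
have {Es hB} := le_trans Es hB; rewrite ler_pM2l// => Es.
set xb := fun w => rdfds_output N (fun k => x k w).
have Ls : L1 Pr (fun w => N%:R^-1 * \sum_(j < N) phi (x j w)).
  by apply: L1Z; apply: L1_sum => j _; exact: Lp.
have mxb : measurable_fun setT xb.
  apply: measurable_row => i; under eq_fun do rewrite mxE summxE.
  apply: measurable_funM => //; apply: measurable_sum => j.
  have mx := proj1 (measurable_iterate (ltnW (ltn_ord j))).
  apply: measurableT_comp (measurable_coord i) _.
  have Gm := draw_events_measurable (e := e) (xi := xi).
  exact: measurable_from_block mx.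
have Lphi : L1 Pr (fun w => phi (xb w)).
  apply: L1_le Ls => [|w]; last by rewrite ger0_norm//; exact: output_suboptimality.
  by apply: measurable_funB => //; exact: measurableT_comp (measurable_objective pb) mxb.
have Lf : L1 Pr (fun w => f (xb w)).
  have := L1D Lphi (L1_cst Pr (f u)); congr (L1 _ _); apply/funext => w.
  by rewrite /phi subrK.
rewrite unlock -EFin_Rintegral// -EFinB lee_fin.
have -> : \int[Pr]_w f (xb w) - f u = \int[Pr]_w phi (xb w).
  by rewrite RintegralB//; [rewrite Rintegral_prob_cst|exact: L1_cst].
apply: (@le_trans _ _ (\int[Pr]_w (N%:R^-1 * \sum_(j < N) phi (x j w)))).
  by apply: ae_Rintegral_le => //; apply: aeW => w; exact: output_suboptimality.
rewrite RintegralZl//; last by apply: L1_sum => j _; exact: Lp.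
by rewrite Rintegral_sum ?ler_pdivrMl// => j _; exact: Lp.
Qed.

End rdfds.

Theorem corollary2p10 (R : realType) :
  exists cN cm cDelta ct C : R,
    [/\ 0 < cN, 0 < cm, 0 < cDelta, 0 < ct & 0 < C] /\
  forall (n p : nat) (dX dOmega : measure_display)
    (X : measurableType dX) (P : probability X R)
    (F : 'rV[R]_n -> X -> R) (g : 'rV[R]_n -> X -> 'rV[R]_n) (L : X -> R)
    (L2 sigma : R) (eta : 'rV[R]_n -> X -> R) (Delta : R)
    (x0 xstar : 'rV[R]_n) (Theta eps : R)
    (Omega : measurableType dOmega) (Pr : probability Omega R)
    (N m : nat) (e : 'I_N -> {RV Pr >-> 'rV[R]_n})
    (xi : 'I_N -> 'I_m -> {RV Pr >-> X})
    (x : nat -> Omega -> 'rV[R]_n),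
  let f := objective P F in
  let A := if p == 1%N then ln n%:R * L2 * Theta / eps
           else n%:R * L2 * Theta / eps in
  let M := Num.max 1 (sigma ^+ 2 / (L2 * eps)) in
  let D := Num.min (eps / n%:R) (eps ^+ 2 / (n%:R * L2 * Theta)) in
  let T := Num.min (Num.sqrt (eps / (n%:R * L2)))
                   (eps / Num.sqrt (n%:R * L2 ^+ 2 * Theta)) in
  let t := ct * T in
  let alpha := (48 * n%:R * rho p n * L2)^-1 in
  let e_ w := fun k => e k w in
  let xi_ w := fun k i => xi k i w in
  let x_ w := fun k => x k w in
  (8 <= n)%N ->
  p = 1%N \/ p = 2%N ->
  problem_assumptions P F g L L2 sigma ->
  noise_assumptions P eta Delta ->
  is_minimizer f xstar ->
  bregman (@prox R p n) x0 xstar <= Theta ->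
  0 < eps ->
  0 < Delta -> Delta <= L2 * Theta * n%:R * rho p n ^+ 2 / 2 ->
  Delta = cDelta * D ->
  (0 < N)%N -> (0 < m)%N ->
  cN * A <= N%:R -> N%:R <= 2 * cN * A ->
  cm * M <= m%:R -> m%:R <= 2 * cm * M ->
  rdfds_randomness P e xi ->
  (forall w, rdfds_run (oracle F eta) t alpha (@prox R p n) x0
               (e_ w) (xi_ w) (x_ w)) ->
  [/\ ('E_Pr[fun w => f (rdfds_output N (x_ w))] - (f xstar)%:E <= eps%:E)%E,
      forall w, size (oracle_calls t (e_ w) (xi_ w) (x_ w)) = (N * m)%N
    & (N * m)%:R <= C *
        (if p == 1%N then
           Num.max (L2 * Theta * ln n%:R / eps)
                   (sigma ^+ 2 * Theta * ln n%:R / eps ^+ 2)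
         else
           Num.max (n%:R * L2 * Theta / eps)
                   (n%:R * sigma ^+ 2 * Theta / eps ^+ 2)) ].
Proof.
(* [complexity_bound] accounts for the first four constants, [oracle_calls_bound] for the last. *)
exists (48 * 480), 10, (1 / (1000 * 1000)), (1 / 1000), (4 * (480 * 480)); split; first by split; lra.
move=> n p dX dOmega X P F g L L2 sigma eta Delta x0 xstar Theta eps Omega Pr N m e xi x.
move=> f A M D T t alpha e_ xi_ x_ n8 p12 pb noise umin Theta_ge eps0 Delta0 Delta_le DeltaE
  N0 m0 N_ge N_le m_ge m_le rand run.
have L20 := L2_gt0 pb.
(* Positivity of [Theta] is read off from 0 < Delta <= L2 Theta n rho^2 / 2. *)
have Theta0 : 0 < Theta.
  have k0 : 0 < L2 * n%:R * rho p n ^+ 2 / 2.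
    apply: divr_gt0 => //; apply: mulr_gt0; last by apply: exprn_gt0; exact: rho_gt0.
    by apply: mulr_gt0 => //; rewrite ltr0n; exact: leq_trans n8.
  rewrite -(pmulr_rgt0 _ k0); apply: (lt_le_trans Delta0); apply: (le_trans Delta_le).
  by rewrite le_eqVlt; apply/orP; left; apply/eqP; ring.
have [T0 _] := smoothing_sqr n8 L20 Theta0 eps0.
have t0 : 0 < t by apply: mulr_gt0 T0; lra.
split.
- have [S [bS iS S0 Sd Sint]] := @dual_weight_exists R p n n8 p12.
  apply: (expected_output_le n8 p12 pb noise N0 m0 t0 rand run umin bS iS S0 Sd Sint Theta_ge).
  rewrite DeltaE.
  exact: (@complexity_bound R n p n8 p12 L2 Theta eps sigma N m L20 Theta0 eps0 N0 m0
    _ _ erefl erefl N_ge N_le m_ge).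
- by move=> w; rewrite /oracle_calls size_allpairs !size_enum_ord.
- exact: (oracle_calls_bound n8 L20 Theta0 eps0 N_le m_le).
Qed.
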